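(* Let $k\geq 4$ be an integer and let $\mathcal H$ be a $3$-uniform linear hypergraph on $n$ vertices that contains no Berge path of length $k$ as a subhypergraph. Then the number of hyperedges of $\mathcal H$ is at most $\frac{k-1}{6}n$.
   Context: A hypergraph $\mathcal H$ is a family of subsets (hyperedges) of a finite vertex set $V(\mathcal H)$. It is $3$-uniform if every hyperedge has exactly $3$ elements. It is linear if any two distinct hyperedges share at most one vertex. A Berge path of length $k$ in $\mathcal H$ is an alternating sequence $v_1,h_1,v_2,h_2,\dots,h_k,v_{k+1}$ of pairwise distinct vertices $v_1,\dots,v_{k+1}$ and pairwise distinct hyperedges $h_1,\dots,h_k$ of $\mathcal H$ such that $\{v_i,v_{i+1}\}\subseteq h_i$ for all $i\in\{1,\dots,k\}$. *)

(* Defs.v *)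
From mathcomp Require Import all_boot.
Set Implicit Arguments. Unset Strict Implicit. Unset Printing Implicit Defensive.

Definition uniform3 (T : finType) (H : {set {set T}}) : Prop :=
  forall e, e \in H -> #|e| = 3.

Definition linear_hg (T : finType) (H : {set {set T}}) : Prop :=
  forall e f, e \in H -> f \in H -> e != f -> #|e :&: f| <= 1.

Definition berge_path (T : finType) (H : {set {set T}}) (k : nat)
    (v : 'I_k.+1 -> T) (h : 'I_k -> {set T}) : Prop :=
  injective v /\ injective h /\
  forall i : 'I_k, h i \in H /\
     v (widen_ord (leqnSn k) i) \in h i /\ v (lift ord0 i) \in h i.

Definition has_berge_path (T : finType) (H : {set {set T}}) (k : nat) : Prop :=
  exists v h, @berge_path T H k v h.

(* Main.v *)
Require Import Defs.
From mathcomp Require Import all_boot.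
From mathcomp Require Import zify.
From Stdlib Require Import Classical.
Set Implicit Arguments. Unset Strict Implicit. Unset Printing Implicit Defensive.

(** Count degrees in the shadow graph, in which two vertices are adjacent when
they share an edge; every edge contributes 6 to the degree sum. If the bound
fails, take a smallest vertex set W whose induced degree sum exceeds (k-1)|W| and
replace the edges by their traces on W. Minimality makes the shadow connected
and forces large degree sums on single vertices, adjacent pairs and triangles.

A Berge path is a path of the shadow whose consecutive pairs lie on pairwise
distinct edges, its colours (a rainbow path). Let c be the largest number of
colours of a rainbow path, so c < k. Rainbow cycles of length c+1 or c, and those
of length c-1 that cover enough vertices, are impossible: such a cycle together
with the third vertices of its edges would be all of W, and W would then have too
few adjacent pairs.

Finally choose a rainbow path with c colours, covering as many vertices as
possible through its edges and then having as many edges as possible that leave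
it. The degrees of its two end vertices (or of the third vertex of an end edge,
which may replace the end vertex) force a neighbour of one end to follow a
neighbour of the other, as in Dirac's theorem, and this closes up to one of the
excluded cycles or improves the path. *)

(** * Rainbow paths and cycles *)

(** What separates this from Dirac's argument in graphs is that a pair used to close a path may lie
    on an edge that the path already uses. Since edges have at most three vertices and two of them
    share at most one, such an edge must be an end edge of one of the two pieces being joined;
    deleting that end vertex frees the colour. Closing at a crossing can thus cost up to two
    vertices, and this is why cycles of the three lengths c+1, c and c-1 have to be excluded.
    Passing to W destroys uniformity: traces have one, two or three vertices, hence the hypothesis
    [card13]. The constants come from deleting a set X from W and comparing degree sums: a vertex
    has degree at least k/2, an adjacent pair degree sum at least k+1, a triangle more than
    3(k+1)/2. The gain for pairs pays for the additional neighbour of a path end whose end edge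
    leaves the path: the end and that third vertex are adjacent and interchangeable. The gain for
    triangles is needed only once, in the last and tightest case. *)

Section Rainbow.
Variables (V : finType) (H : {set {set V}}).

(* [set0] when [x] and [y] lie on no common edge; since edges are nonempty,
   [col x y \in H] then characterises adjacency. *)
Definition col (x y : V) : {set V} :=
  odflt set0 [pick e in H | (x \in e) && (y \in e)].

Definition adj (x y : V) := (x != y) && (col x y \in H).

Definition nb (X : {set V}) (x : V) := [set y in X | adj x y].
Definition deg (X : {set V}) (x : V) := #|nb X x|.

Definition cols (p : seq V) := if p is x :: s then pairmap col x s else [::].

Definition rainbow p :=
  [&& uniq p, all [in H] (cols p) & uniq (cols p)].

Definition ccols (C : seq V) := if C is a :: t then cols (a :: rcons t a) else [::].

Definition rcyc C :=
  [&& 3 <= size C, uniq C, all [in H] (ccols C) & uniq (ccols C)].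

Definition seg a p (b : V) := exists2 t, p = a :: t & last a t = b.

(** Cycle edges are indexed by the vertex they leave. By [cn_inj] this is injective on a rainbow
    cycle, so sets of cycle edges can be counted as sets of vertices. *)
Definition cn C v := col v (next C v).

Hypothesis card13 : forall e, e \in H -> 0 < #|e| <= 3.
Hypothesis lin : linear_hg H.

Lemma colC x y : col x y = col y x.
Proof.
rewrite /col; congr (odflt _ _); apply: eq_pick => e /=.
by rewrite [(x \in e) && _]andbC.
Qed.

Lemma adjC x y : adj x y = adj y x.
Proof. by rewrite /adj colC eq_sym. Qed.

Lemma adj_neq x y : adj x y -> x != y.
Proof. by case/andP. Qed.

Lemma adj_col x y : adj x y -> col x y \in H.
Proof. by case/andP. Qed.

Lemma col_eq e x y : e \in H -> x \in e -> y \in e -> x != y -> col x y = e.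
Proof.
move=> eH xe ye xy; rewrite /col; case: pickP => [f /andP[fH /andP[xf yf]]|] /=; last first.
  by move/(_ e); rewrite eH xe ye.
apply/eqP; apply/negPn/negP => fe.
have := lin fH eH fe; rewrite leqNgt; apply/negP; rewrite negbK.
by apply/card_gt1P; exists x, y; rewrite !inE xf xe yf ye.
Qed.

Lemma adj_edge e x y : e \in H -> x \in e -> y \in e -> x != y -> adj x y.
Proof. by move=> eH xe ye xy; rewrite /adj xy (col_eq eH). Qed.

Lemma col_mem x y : col x y \in H -> x \in col x y /\ y \in col x y.
Proof.
rewrite /col; case: pickP => [f /andP[fH /andP[xf yf]]|h0] //= /card13.
by rewrite cards0.
Qed.

(** The size bound in its working form: nearly every coincidence of two colours is refuted by four
    vertices on one edge. *)
Lemma no4 e a b c d : e \in H -> uniq [:: a; b; c; d] ->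
  a \in e -> b \in e -> c \in e -> d \in e -> False.
Proof.
move=> eH u ae be ce de.
have : #|[set x in [:: a; b; c; d]]| <= #|e|.
  apply: subset_leq_card; apply/subsetP => x; rewrite !inE.
  by case/or4P => /eqP->.
rewrite cardsE (card_uniqP u) /= => h4.
by have /andP[_ h3] := card13 eH; move: (leq_trans h4 h3).
Qed.

Lemma edges_share1 e f x y : e \in H -> f \in H -> x != y ->
  x \in e -> y \in e -> x \in f -> y \in f -> e = f.
Proof. by move=> eH fH xy xe ye xf yf; rewrite -(col_eq eH xe ye xy) (col_eq fH). Qed.

Lemma cols_shared p a q : cols (p ++ a :: q) = cols (rcons p a) ++ cols (a :: q).
Proof.
by case: p => [|x p] //=; rewrite -cats1 !pairmap_cat /= -catA.
Qed.

Lemma cols_rcons2 p y x : cols (rcons (rcons p y) x) = rcons (cols (rcons p y)) (col y x).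
Proof. by rewrite -[rcons (rcons p y) x]cats1 cat_rcons cols_shared cats1. Qed.

Lemma cols_rev p : cols (rev p) = rev (cols p).
Proof.
elim: p => // x [|y p] IH //.
by rewrite 2!rev_cons cols_rcons2 -rev_cons IH /= [in RHS]rev_cons (colC y x).
Qed.

Lemma size_cols p : size (cols p) = (size p).-1.
Proof. by case: p => //= x s; rewrite size_pairmap. Qed.

Lemma mem_cols p e : e \in cols p ->
  exists p1 x y p2, p = p1 ++ x :: y :: p2 /\ e = col x y.
Proof.
elim: p => // x [|y p] IH //=; rewrite inE => /predU1P[->|he].
  by exists [::], x, y, p.
have [p1 [x' [y' [p2 [-> ->]]]]] := IH he.
by exists (x :: p1), x', y', p2.
Qed.

Lemma cols_mid p1 x y p2 :
  cols (p1 ++ x :: y :: p2) = cols (rcons p1 x) ++ col x y :: cols (y :: p2).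
Proof. by rewrite cols_shared. Qed.

Lemma rainbow_rev p : rainbow (rev p) = rainbow p.
Proof. by rewrite /rainbow cols_rev rev_uniq all_rev rev_uniq. Qed.

Lemma rainbow_intro p : uniq p -> (forall e, e \in cols p -> e \in H) ->
  uniq (cols p) -> rainbow p.
Proof. by move=> u h uc; rewrite /rainbow u uc andbT /=; apply/allP. Qed.

Lemma rainbow_uniq p : rainbow p -> uniq p.
Proof. by case/and3P. Qed.
Lemma rainbow_cuniq p : rainbow p -> uniq (cols p).
Proof. by case/and3P. Qed.
Lemma rainbow_colH p e : rainbow p -> e \in cols p -> e \in H.
Proof. by case/and3P => _ /allP h _ /h. Qed.

Lemma seg_rev a p b : seg a p b -> seg b (rev p) a.
Proof.
case=> t ->; case/lastP: t => [|t y]; rewrite ?last_rcons /= => <-; first by exists [::].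
by rewrite rev_cons rev_rcons; exists (rcons (rev t) a); rewrite // last_rcons.
Qed.

Lemma seg_cat a p b c q d : seg a p b -> seg c q d -> seg a (p ++ q) d.
Proof. by case=> t -> tb [s -> sd]; exists (t ++ c :: s); rewrite // last_cat. Qed.

Lemma seg1 a : seg a [:: a] a.
Proof. by exists [::]. Qed.

Lemma seg_rcons a p b : seg a p b -> exists t, p = rcons t b.
Proof.
case=> t ->; case/lastP: t => [|t y]; rewrite ?last_rcons /= => <-.
  by exists [::].
by exists (a :: t).
Qed.

Lemma seg_mem a p b : seg a p b -> (a \in p) * (b \in p).
Proof. by case=> t -> <-; rewrite mem_last mem_head. Qed.

Lemma cols_seg P1 a s v P2 : seg a s v ->
  cols (P1 ++ s ++ P2) = cols (rcons P1 a) ++ cols s ++ cols (v :: P2).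
Proof.
move=> hs; have [t' Es] := seg_rcons hs; rewrite {2}Es -cols_shared -cat_rcons -Es.
by case: hs => t -> _; rewrite /= cols_shared.
Qed.

Lemma cols_seg2 P1 A Q B P2 a b c d : seg a A b -> seg c B d ->
  cols (P1 ++ A ++ Q ++ B ++ P2) =
  cols (rcons P1 a) ++ cols A ++ cols (b :: rcons Q c) ++ cols B ++ cols (d :: P2).
Proof.
move=> sA sB; rewrite (cols_seg _ _ sA); congr (_ ++ (_ ++ _)).
by rewrite -[RHS]/(cols (rcons (b :: Q) c) ++ _) -(cols_seg (b :: Q) P2 sB).
Qed.

(** The interior colours of [A] are distinct already, so only the link colours [L] remain to be
    checked; this keeps the later path constructions down to a few comparisons. *)
Lemma glue1 P1 A P2 a b : seg a A b -> rainbow A -> uniq (P1 ++ A ++ P2) ->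
  let L := cols (rcons P1 a) ++ cols (b :: P2) in
  uniq L -> (forall l, l \in L -> l \in H /\ l \notin cols A) ->
  rainbow (P1 ++ A ++ P2).
Proof.
move=> sA rA u L uL hL; have E := cols_seg P1 P2 sA.
have pE : perm_eq (cols (P1 ++ A ++ P2)) (L ++ cols A).
  by rewrite E /L -catA perm_cat2l perm_catC.
apply: rainbow_intro => // [e|].
  rewrite (perm_mem pE) mem_cat => /orP[/hL[]//|]; exact: rainbow_colH.
rewrite (perm_uniq pE) cat_uniq uL (rainbow_cuniq rA) andbT /=.
by apply/hasPn => x xA; apply/negP => /hL[_]; rewrite xA.
Qed.

Lemma glue2 P1 A Q B P2 a b c d : seg a A b -> seg c B d ->
  uniq (P1 ++ A ++ Q ++ B ++ P2) ->
  uniq (cols A ++ cols B) -> all [in H] (cols A ++ cols B) ->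
  let L := cols (rcons P1 a) ++ cols (b :: rcons Q c) ++ cols (d :: P2) in
  uniq L -> (forall l, l \in L -> l \in H /\ l \notin cols A ++ cols B) ->
  rainbow (P1 ++ A ++ Q ++ B ++ P2).
Proof.
move=> sA sB u uAB /allP hAB L uL hL; have E := cols_seg2 P1 Q P2 sA sB.
have pE : perm_eq (cols (P1 ++ A ++ Q ++ B ++ P2)) (L ++ (cols A ++ cols B)).
  by rewrite E; apply/permP => z; rewrite /L !count_cat; lia.
apply: rainbow_intro => // [e|].
  by rewrite (perm_mem pE) mem_cat => /orP[/hL[]//|/hAB].
rewrite (perm_uniq pE) cat_uniq uL uAB andbT /=.
by apply/hasPn => x xA; apply/negP => /hL[_]; rewrite xA.
Qed.

Lemma ccols_seg a A b : seg a A b -> perm_eq (ccols A) (col b a :: cols A).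
Proof.
move=> sA; case: (sA) => t -> <-; rewrite /ccols.
rewrite -rcons_cons -cats1 -[_ ++ _]/([::] ++ (a :: t) ++ [:: a]).
rewrite (@cols_seg _ a _ (last a t)); last by exists t.
by rewrite /= cats1 perm_rcons.
Qed.

Lemma rcyc_intro a A b : seg a A b -> 3 <= size A -> rainbow A ->
  col b a \in H -> col b a \notin cols A -> rcyc A.
Proof.
move=> sA s3 rA bH bA; have pE := ccols_seg sA.
rewrite /rcyc s3 (rainbow_uniq rA) (perm_uniq pE) /= bA (rainbow_cuniq rA) andbT /=.
by rewrite andbT (perm_all _ pE) /= bH; case/and3P: rA.
Qed.

Lemma ccolsE C : uniq C -> ccols C = [seq cn C v | v <- C].
Proof.
case: C => // a t u; rewrite /ccols /cols /cn.
apply: (@eq_from_nth _ set0).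
  by rewrite size_pairmap size_map size_rcons.
move=> i; rewrite size_pairmap size_rcons => hi.
rewrite (nth_pairmap a) ?size_rcons // (nth_map a) //=.
have -> : nth a (a :: rcons t a) i = nth a (a :: t) i.
  by rewrite -rcons_cons nth_rcons -[size _]/(size t).+1 hi.
congr (col _ _); rewrite -[LHS]/(nth a (rcons t a) i) -[RHS]/(next (a :: t) (nth a (a :: t) i)).
rewrite next_nth mem_nth // index_uniq //.
rewrite nth_rcons; move: hi; rewrite ltnS leq_eqVlt => /predU1P[->|->] //.
by rewrite ltnn eqxx nth_default.
Qed.

Lemma rcyc_uniq C : rcyc C -> uniq C. Proof. by case/and4P. Qed.
Lemma rcyc_size C : rcyc C -> 3 <= size C. Proof. by case/and4P. Qed.
Lemma rcyc_cn C v : rcyc C -> v \in C -> cn C v \in ccols C.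
Proof. by move=> rC vC; rewrite ccolsE ?rcyc_uniq // map_f. Qed.
Lemma rcyc_colH C e : rcyc C -> e \in ccols C -> e \in H.
Proof. by case/and4P => _ _ /allP h _ /h. Qed.
Lemma rcyc_ccols C e : rcyc C -> e \in ccols C -> exists2 v, v \in C & e = cn C v.
Proof. by move=> rC; rewrite ccolsE ?rcyc_uniq // => /mapP. Qed.
Lemma cn_inj C : rcyc C -> {in C &, injective (cn C)}.
Proof.
move=> rC; have uC := rcyc_uniq rC.
have: uniq (ccols C) by case/and4P: rC.
rewrite ccolsE // => u x y xC yC exy.
rewrite -(nth_index x xC) -(nth_index x yC); congr (nth x C _).
apply/eqP; rewrite -(nth_uniq set0 _ _ u) ?size_map ?index_mem //.
by rewrite !(nth_map x) ?index_mem // !nth_index // exy.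
Qed.

Lemma next_seg a A b C : uniq C -> seg a A b -> perm_eq A C ->
  (forall v, next C v = next A v) -> next C b = a.
Proof.
move=> uC sA pA ->; case: sA pA => t -> tb pA.
rewrite next_nth (perm_mem pA) -(perm_mem pA) -tb mem_last.
have u : uniq (a :: t) by rewrite (perm_uniq pA).
by rewrite index_last // nth_default.
Qed.

Lemma next_mid (s1 : seq V) x y s2 : uniq (s1 ++ x :: y :: s2) -> next (s1 ++ x :: y :: s2) x = y.
Proof.
by move=> u; rewrite -(next_rot (size s1) u) rot_size_cat /= eqxx.
Qed.

(** * Cutting rainbow cycles open and attaching paths *)

Lemma cyc_break1 C v : rcyc C -> v \in C ->
  exists s, [/\ seg (next C v) s v, perm_eq s C, rainbow s,
                perm_eq (ccols C) (cn C v :: cols s) & next s =1 next C].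
Proof.
move=> rC vC; have uC := rcyc_uniq rC.
have [i s Es] : rot_to_spec C (next C v) by apply: rot_to; rewrite mem_next.
pose A := rot i C; have pA : perm_eq A C by rewrite perm_rot.
have nA x : next A x = next C x by rewrite next_rot.
have vA : v \in A by rewrite (perm_mem pA).
have sA : seg (next C v) A (last (next C v) s) by exists s.
have E := next_seg uC sA pA (fun x => esym (nA x)).
have Ev : last (next C v) s = v by apply: (can_inj (prev_next uC)).
rewrite Ev in sA.
have pc : perm_eq (ccols C) (ccols A).
  rewrite !ccolsE ?(perm_uniq pA) //.
  have -> : [seq cn A x | x <- A] = [seq cn C x | x <- A].
    by apply: eq_map => x; rewrite /cn nA.
  by apply: perm_map; rewrite perm_sym.
have pc2 : perm_eq (ccols C) (cn C v :: cols A).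
  by apply: perm_trans pc _; apply: ccols_seg sA.
exists A; split=> //.
case/and4P: rC => _ _ aH ucc; rewrite (perm_all _ pc2) in aH.
rewrite (perm_uniq pc2) in ucc; case/andP: aH => _ aH; case/andP: ucc => _ ucc.
by apply/and3P; split => //; rewrite (perm_uniq pA).
Qed.

Lemma cyc_break2 C v a : rcyc C -> v \in C -> a \in C -> a != v ->
  exists A B, [/\ seg (next C v) A a, seg (next C a) B v, perm_eq (A ++ B) C &
    perm_eq (ccols C) (cn C v :: cn C a :: cols A ++ cols B)].
Proof.
move=> rC vC aC av; have [s [sg ps rs pc ns]] := cyc_break1 rC vC.
have us := rainbow_uniq rs.
have : a \in s by rewrite (perm_mem ps).
case/splitPr E: {1}_ / => [s1 s2]; rewrite E in sg ps rs pc ns us.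
have sA : seg (next C v) (rcons s1 a) a.
  case: sg => t Et _; case: s1 Et {E ps rs pc ns us} => [|x s1] [-> _].
    by exists [::].
  by exists (rcons s1 a); rewrite ?last_rcons.
case: s2 E sg ps rs pc ns us => [|b s2] E sg ps rs pc ns us.
  have [t /eqP] := seg_rcons sg; rewrite cats1 eqseq_rcons => /andP[_ /eqP ea].
  by rewrite ea eqxx in av.
have sb : next C a = b by rewrite -ns next_mid.
exists (rcons s1 a), (b :: s2); split=> //.
- rewrite sb; exists s2 => //; case: sg => t Et <-.
  by have := congr1 (last v) Et; rewrite /= last_cat.
- by rewrite cat_rcons.
- move: pc; rewrite cols_mid -sb => pc; apply: perm_trans pc _.
  by apply/permP => z /=; rewrite !count_cat /= /cn; clear; lia.
Qed.

Lemma perm_ccols_rev C : perm_eq (ccols (rev C)) (ccols C).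
Proof.
case: C => // a t; have sg : seg a (a :: t) (last a t) by exists t.
apply: perm_trans (ccols_seg (seg_rev sg)) _; rewrite perm_sym.
apply: perm_trans (ccols_seg sg) _.
by rewrite colC cols_rev perm_cons perm_sym perm_rev.
Qed.

Lemma rcyc_rev C : rcyc C -> rcyc (rev C).
Proof.
rewrite /rcyc size_rev rev_uniq (perm_all _ (perm_ccols_rev C)).
by rewrite (perm_uniq (perm_ccols_rev C)).
Qed.

Lemma cn_rev C v : rcyc C -> cn (rev C) v = cn C (prev C v).
Proof.
move=> rC; have u := rcyc_uniq rC; rewrite /cn next_rev // next_prev //.
exact: colC.
Qed.

(* The colours usable as connecting links once the cycle [C] is cut open after
   [v] and after [a]. *)
Definition fresh C v a l := [|| l == cn C v, l == cn C a | l \notin ccols C].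

(** The cycle is opened at the edge leaving [v] and run from [next C v] round to [v]. The released
    colour [cn C v] may serve as a link, which is how the third vertex of that edge enters the
    path. *)
Lemma ear_path C v P1 P2 : rcyc C -> v \in C ->
  uniq (P1 ++ P2) -> (forall x, x \in P1 ++ P2 -> x \notin C) ->
  let L := cols (rcons P1 (next C v)) ++ cols (v :: P2) in
  uniq L -> (forall l, l \in L -> l \in H /\ fresh C v v l) ->
  exists p, [/\ rainbow p, size p = size P1 + size C + size P2,
     (forall x, (x \in p) = (x \in P1 ++ P2 ++ C)) &
     (forall l, l \in ccols C -> l != cn C v -> l \in cols p) /\ {subset L <= cols p}].
Proof.
move=> rC vC uP hP L uL hL; have [s [sg ps rs pc ns]] := cyc_break1 rC vC.
have ucc : uniq (cn C v :: cols s) by rewrite -(perm_uniq pc); case/and4P: rC.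
exists (P1 ++ s ++ P2); split.
- apply: (glue1 sg rs) => //.
    have -> : uniq (P1 ++ s ++ P2) = uniq (s ++ P1 ++ P2).
      by apply/perm_uniq/permP => z; rewrite !count_cat; clear; lia.
    rewrite cat_uniq uP (rainbow_uniq rs) andbT /=; apply/hasPn => x /hP.
    by rewrite (perm_mem ps).
  move=> l /hL[-> /or3P h]; split=> //; apply: contraL ucc => ls; rewrite /=.
  case: h => [/eqP<-|/eqP<-|]; rewrite ?ls //.
  by rewrite (perm_mem pc) inE ls orbT.
- by rewrite !size_cat (perm_size ps) addnA.
- by move=> x; rewrite !mem_cat (perm_mem ps) [(x \in C) || _]orbC.
- split=> l; rewrite (cols_seg _ _ sg) !mem_cat.
    by rewrite (perm_mem pc) inE => /orP[/eqP->|->]; rewrite ?eqxx ?orbT.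
  by case/orP=> ->; rewrite ?orbT.
Qed.

(** The edge from [v] to [next C v] is replaced by a detour through [P]. *)
Lemma ear_cycle C v P : rcyc C -> v \in C -> P != [::] ->
  uniq P -> (forall x, x \in P -> x \notin C) ->
  let L := cols (v :: rcons P (next C v)) in
  uniq L -> (forall l, l \in L -> l \in H /\ fresh C v v l) ->
  exists2 D, rcyc D & size D = size C + size P /\ {subset C ++ P <= D}.
Proof.
move=> rC vC P0 uP hP L uL hL; have [s [sg ps rs pc ns]] := cyc_break1 rC vC.
have ucc : uniq (cn C v :: cols s) by rewrite -(perm_uniq pc); case/and4P: rC.
case/lastP: P P0 uP hP @L uL hL => // P x _ uP hP L uL hL.
have sg2 : seg (next C v) (s ++ rcons P x) x.
  case: sg => t -> _; exists (t ++ rcons P x); rewrite // last_cat last_rcons.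
  by [].
have EL : L = rcons (cols (v :: rcons P x)) (col x (next C v)).
  by rewrite /L -!rcons_cons cols_rcons2.
rewrite EL in uL hL.
have hL2 l : l \in rcons (cols (v :: rcons P x)) (col x (next C v)) -> l \in H /\ l \notin cols s.
  move=> /hL[-> /or3P h]; split=> //; apply: contraL ucc => ls; rewrite /=.
  case: h => [/eqP<-|/eqP<-|]; rewrite ?ls //.
  by rewrite (perm_mem pc) inE ls orbT.
have cE : cols (s ++ rcons P x) = cols s ++ cols (v :: rcons P x).
  by rewrite (cols_seg [::] _ sg).
exists (s ++ rcons P x); last first.
  split; first by rewrite size_cat (perm_size ps).
  by move=> y; rewrite !mem_cat (perm_mem ps).
rewrite rcons_uniq in uL; case/andP: uL => xL uL.
apply: (rcyc_intro sg2).
- by rewrite size_cat (perm_size ps) (leq_trans (rcyc_size rC)) // leq_addr.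
- rewrite -[s ++ _]/([::] ++ s ++ rcons P x); apply: (glue1 sg rs) => //.
    rewrite cat0s cat_uniq uP (rainbow_uniq rs) andbT /=; apply/hasPn => y /hP.
    by rewrite (perm_mem ps).
  by move=> l lL; apply: hL2; rewrite mem_rcons inE lL orbT.
- by have [] := hL2 (col x (next C v)); rewrite // mem_rcons mem_head.
- have [] := hL2 (col x (next C v)); rewrite ?mem_rcons ?mem_head // => _ nx.
  by rewrite cE mem_cat negb_or nx.
Qed.

Lemma cols_rcons x s y : cols (x :: rcons s y) = rcons (cols (x :: s)) (col (last x s) y).
Proof. by rewrite -rcons_cons lastI cols_rcons2 -lastI. Qed.

Lemma chord_uniq C A B P1 Q P2 : rcyc C -> perm_eq (A ++ B) C ->
  uniq (P1 ++ Q ++ P2) -> (forall x, x \in P1 ++ Q ++ P2 -> x \notin C) ->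
  uniq (P1 ++ A ++ Q ++ B ++ P2).
Proof.
move=> rC pC u h.
have -> : uniq (P1 ++ A ++ Q ++ B ++ P2) = uniq (C ++ P1 ++ Q ++ P2).
  apply/perm_uniq/permP => z; move/permP: pC => /(_ z); rewrite !count_cat; lia.
by rewrite cat_uniq u rcyc_uniq // andbT /=; apply/hasPn => x /h.
Qed.

Lemma fresh_notin C v a s l : rcyc C ->
  perm_eq (ccols C) (cn C v :: cn C a :: s) -> fresh C v a l -> l \notin s.
Proof.
move=> rC pc h; have ucc : uniq (cn C v :: cn C a :: s).
  by rewrite -(perm_uniq pc); case/and4P: rC.
apply: contraL ucc => ls; rewrite /= !inE !negb_or.
case/or3P: h => [/eqP<-|/eqP<-|]; rewrite ?ls ?andbF //.
by rewrite (perm_mem pc) !inE ls !orbT.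
Qed.

Lemma fresh_rest C v a s : rcyc C ->
  perm_eq (ccols C) (cn C v :: cn C a :: s) -> uniq s /\ all [in H] s.
Proof.
move=> rC pc; case/and4P: rC => _ _; rewrite (perm_all _ pc) (perm_uniq pc).
by case/and3P=> _ _ ? /and3P[].
Qed.

(** The second arc is reversed. The order is [P1], [next C v] to [a], [Q], [v] back to [next C a],
    [P2]. *)
Lemma chord_path C v a P1 Q P2 : rcyc C -> v \in C -> a \in C -> a != v ->
  uniq (P1 ++ Q ++ P2) -> (forall x, x \in P1 ++ Q ++ P2 -> x \notin C) ->
  let L := cols (rcons P1 (next C v)) ++ cols (a :: rcons Q v) ++
           cols (next C a :: P2) in
  uniq L -> (forall l, l \in L -> l \in H /\ fresh C v a l) ->
  exists2 p, rainbow p & size p = size C + size (P1 ++ Q ++ P2).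
Proof.
move=> rC vC aC av uP hP L uL hL.
have [A [B [sA sB pAB pc]]] := cyc_break2 rC vC aC av.
have pc2 : perm_eq (ccols C) (cn C v :: cn C a :: cols A ++ cols (rev B)).
  by apply: perm_trans pc _; rewrite cols_rev !perm_cons perm_cat2l perm_sym perm_rev.
have pAB2 : perm_eq (A ++ rev B) C.
  by apply: perm_trans pAB; rewrite perm_cat2l perm_rev.
have [u1 u2] := fresh_rest rC pc2.
exists (P1 ++ A ++ Q ++ rev B ++ P2); last first.
  by rewrite -(perm_size pAB) !size_cat size_rev; clear; lia.
apply: (glue2 sA (seg_rev sB)) => //; first exact: (chord_uniq rC).
by move=> l /hL[-> /(fresh_notin rC pc2)->].
Qed.

(** Here the first arc is reversed, so that [Q] joins [next C v] to [next C a] and the free ends are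
    [a] and [v]. *)
Lemma chord_path' C v a P1 Q P2 : rcyc C -> v \in C -> a \in C -> a != v ->
  uniq (P1 ++ Q ++ P2) -> (forall x, x \in P1 ++ Q ++ P2 -> x \notin C) ->
  let L := cols (rcons P1 a) ++ cols (next C v :: rcons Q (next C a)) ++
           cols (v :: P2) in
  uniq L -> (forall l, l \in L -> l \in H /\ fresh C v a l) ->
  exists2 p, rainbow p & size p = size C + size (P1 ++ Q ++ P2).
Proof.
move=> rC vC aC av uP hP L uL hL.
have [A [B [sA sB pAB pc]]] := cyc_break2 rC vC aC av.
have pc2 : perm_eq (ccols C) (cn C v :: cn C a :: cols (rev A) ++ cols B).
  by apply: perm_trans pc _; rewrite cols_rev !perm_cons perm_cat2r perm_sym perm_rev.
have pAB2 : perm_eq (rev A ++ B) C.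
  by apply: perm_trans pAB; rewrite perm_cat2r perm_rev.
have [u1 u2] := fresh_rest rC pc2.
exists (P1 ++ rev A ++ Q ++ B ++ P2); last first.
  by rewrite -(perm_size pAB) !size_cat size_rev; clear; lia.
apply: (glue2 (seg_rev sA) sB) => //; first exact: (chord_uniq rC).
by move=> l /hL[-> /(fresh_notin rC pc2)->].
Qed.

(** The traversal of [chord_path], closed up through [P2] from [next C a] to [next C v]. *)
Lemma chord_cycle C v a Q P2 : rcyc C -> v \in C -> a \in C -> a != v ->
  uniq (Q ++ P2) -> (forall x, x \in Q ++ P2 -> x \notin C) ->
  let L := cols (a :: rcons Q v) ++ cols (next C a :: rcons P2 (next C v)) in
  uniq L -> (forall l, l \in L -> l \in H /\ fresh C v a l) ->
  exists2 D, rcyc D & size D = size C + size (Q ++ P2).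
Proof.
move=> rC vC aC av uP hP L uL hL.
have [A [B [sA sB pAB pc]]] := cyc_break2 rC vC aC av.
have pc2 : perm_eq (ccols C) (cn C v :: cn C a :: cols A ++ cols (rev B)).
  by apply: perm_trans pc _; rewrite cols_rev !perm_cons perm_cat2l perm_sym perm_rev.
have pAB2 : perm_eq (A ++ rev B) C.
  by apply: perm_trans pAB; rewrite perm_cat2l perm_rev.
have [u1 u2] := fresh_rest rC pc2.
have hL2 l : l \in L -> l \in H /\ l \notin cols A ++ cols (rev B).
  by move=> /hL[-> /(fresh_notin rC pc2)->].
pose L1 := cols (a :: rcons Q v) ++ cols (next C a :: P2).
pose x := last (next C a) P2.
have EL : L = rcons L1 (col x (next C v)).
  by rewrite /L (cols_rcons (next C a)) -rcons_cat.
rewrite EL rcons_uniq in uL; case/andP: uL => xL uL.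
have sD : seg (next C v) (A ++ Q ++ rev B ++ P2) x.
  case: sA => t -> _; exists (t ++ Q ++ rev B ++ P2) => //.
  rewrite !last_cat /x; case: sB => t' -> _; rewrite rev_cons last_rcons.
  by [].
have sz : size (A ++ Q ++ rev B ++ P2) = size C + size (Q ++ P2).
  by rewrite -(perm_size pAB) !size_cat size_rev (addnCA (size Q)) addnA.
have hx : col x (next C v) \in L by rewrite EL mem_rcons mem_head.
exists (A ++ Q ++ rev B ++ P2) => //; apply: (rcyc_intro sD).
- by rewrite sz (leq_trans (rcyc_size rC)) // leq_addr.
- rewrite -[A ++ _]/([::] ++ A ++ Q ++ rev B ++ P2).
  apply: (glue2 sA (seg_rev sB)) => //; first exact: (chord_uniq rC).
  by move=> l lL; apply: hL2; rewrite EL mem_rcons inE lL orbT.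
- by have [] := hL2 _ hx.
- have [_ nx] := hL2 _ hx.
  rewrite -[A ++ _]/([::] ++ A ++ Q ++ rev B ++ P2) (cols_seg2 _ _ _ sA (seg_rev sB)).
  move: nx xL; rewrite /L1 !mem_cat !negb_or /= => /andP[-> ->] /andP[-> ->].
  by [].
Qed.
End Rainbow.

(** * Degrees in a minimal dense vertex set, and covering cycles *)

Section Span.
Variables (V : finType) (H : {set {set V}}).
Notation col := (col H). Notation cols := (cols H). Notation ccols := (ccols H).
Notation rainbow := (rainbow H). Notation rcyc := (rcyc H). Notation cn := (cn H).
Notation adj := (adj H). Notation deg := (deg H). Notation D := (deg setT).

Definition span (p : seq V) (L : seq {set V}) :=
  [set x | (x \in p) || has (fun e : {set V} => x \in e) L].
Definition U p := span p (cols p).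
Definition UC C := span C (ccols C).
(* The edge of [C] leaving [v] has its third vertex outside [C]. *)
Definition opn C v := ~~ (cn C v \subset C).

Hypothesis card13 : forall e, e \in H -> 0 < #|e| <= 3.
Hypothesis lin : linear_hg H.

Lemma mem_span x p L : x \in span p L -> x \in p \/ exists2 e, e \in L & x \in e.
Proof. by rewrite inE => /orP[|/hasP]; [left|right]. Qed.

Lemma span1 x p L : x \in p -> x \in span p L.
Proof. by rewrite inE => ->. Qed.

Lemma span2 x (e : {set V}) p (L : seq {set V}) : e \in L -> x \in e -> x \in span p L.
Proof. by move=> eL xe; rewrite inE; apply/orP; right; apply/hasP; exists e. Qed.

Lemma in_neq (s : seq V) x z : x \in s -> z \notin s -> x != z.
Proof. by move=> xs; apply: contraNneq => <-. Qed.

Lemma card_set_seq (s : seq V) : uniq s -> #|[set x in s]| = size s.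
Proof. by move/card_uniqP; rewrite cardsE. Qed.

Lemma notin_UC z C (e : {set V}) : z \notin UC C -> z \in e -> e \notin ccols C.
Proof. by move=> zU ze; apply: contra zU => eC; apply: span2 ze. Qed.

Lemma cn_facts C v : rcyc C -> v \in C ->
  [/\ cn C v \in H, v \in cn C v, next C v \in cn C v & v != next C v].
Proof.
move=> rC vC; have cH := rcyc_colH rC (rcyc_cn rC vC).
have [h1 h2] := col_mem card13 cH; split=> //.
have [s [[t Es Et] ps _ _ _]] := cyc_break1 rC vC.
have us : uniq s by rewrite (perm_uniq ps) (rcyc_uniq rC).
apply/eqP => E; have := rcyc_size rC; rewrite -(perm_size ps) Es.
case: t Es Et => [|x t] //= Es Et; move: us; rewrite Es /= -E.
by rewrite -Et -/(last x t) mem_last.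
Qed.

(** A third vertex [z] off the cycle can be joined to either end of its cycle edge by the very
    colour that is released when the cycle is cut there. *)
Lemma own C v z : rcyc C -> v \in C -> z \notin C -> z \in cn C v ->
  col z (next C v) = cn C v /\ col v z = cn C v.
Proof.
move=> rC vC zC ze; have [cH h1 h2 _] := cn_facts rC vC.
split; apply: (col_eq lin) => //; apply: contraNneq zC.
  by move=> ->; rewrite mem_next.
by move=> <-.
Qed.

Lemma own_uniq C v z z' : rcyc C -> v \in C -> z \notin C -> z' \notin C ->
  z \in cn C v -> z' \in cn C v -> z = z'.
Proof.
move=> rC vC zC zC' ze ze'; have [cH h1 h2 h3] := cn_facts rC vC.
apply/eqP; apply/negPn/negP => zz.
have nC : next C v \in C by rewrite mem_next.
apply: (no4 card13 cH _ h1 h2 ze ze'); rewrite /= !inE !negb_or h3 zz !andbT.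
by rewrite !(in_neq vC, in_neq nC).
Qed.

Lemma deg_sum (X : {set V}) x : deg X x = \sum_(y in X) adj x y.
Proof.
rewrite /deg /nb -sum1_card [LHS]big_mkcond [RHS]big_mkcond /=.
by apply: eq_bigr => y _; rewrite inE; case: (y \in X); case: (adj x y).
Qed.

Lemma degU (X : {set V}) x : D x = deg X x + deg (~: X) x.
Proof.
rewrite !deg_sum (bigID (mem X)) /=; congr (_ + _); apply: eq_bigl => y.
  by rewrite inE.
by rewrite !inE.
Qed.

Lemma deg_sym (X Y : {set V}) : \sum_(x in X) deg Y x = \sum_(x in Y) deg X x.
Proof.
under eq_bigr do rewrite deg_sum; rewrite exchange_big /=.
by apply: eq_bigr => x _; rewrite deg_sum; apply: eq_bigr => y _; rewrite adjC.
Qed.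

Variable k : nat.
Hypothesis k4 : 4 <= k.
Hypothesis dense : (k - 1) * #|V| < \sum_x D x.
Hypothesis sparse : forall Y : {set V}, Y != setT ->
  \sum_(x in Y) deg Y x <= (k - 1) * #|Y|.

(** Deleting [X] lowers the total degree sum by twice the degrees in [X], less the pairs inside [X]
    that this counts twice, and what remains is sparse. The bounds [deg1], [deg2] and [deg3] are the
    cases of one, two and three vertices. *)
Lemma dense_sub (X : {set V}) : X != set0 ->
  (k - 1) * #|X| + \sum_(x in X) deg X x < 2 * \sum_(x in X) D x.
Proof.
move=> X0; have /sparse hY : ~: X != setT.
  by rewrite -(inj_eq (@setC_inj V)) setCK setCT.
have E : \sum_x D x = \sum_(x in X) D x + \sum_(x in ~: X) D x.
  by rewrite (bigID (mem X)) /=; congr (_ + _); apply: eq_bigl => x; rewrite !inE.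
have E2 : \sum_(x in ~: X) D x = \sum_(x in ~: X) deg (~: X) x + \sum_(x in ~: X) deg X x.
  rewrite -big_split /=; apply: eq_bigr => x _; rewrite (degU X); exact: addnC.
have E3 : \sum_(x in X) D x = \sum_(x in X) deg X x + \sum_(x in X) deg (~: X) x.
  by rewrite -big_split /=; apply: eq_bigr => x _; rewrite (degU X).
have E4 := deg_sym X (~: X).
have E5 : #|V| = #|X| + #|~: X| by rewrite cardsC.
by move: dense; rewrite E E2 E5 mulnDr; lia.
Qed.

Lemma deg1 x : k <= 2 * D x.
Proof.
have : [set x] != set0 by apply/set0Pn; exists x; rewrite inE.
by move/dense_sub; rewrite !big_set1 cards1; lia.
Qed.

(** The adjacency of [x] and [y] adds 2 to the left side of [dense_sub], hence the gain of 1 over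
    two uses of [deg1]. *)
Lemma deg2 x y : adj x y -> k.+1 <= D x + D y.
Proof.
move=> a; have xy := adj_neq a.
have : [set x; y] != set0 by apply/set0Pn; exists x; rewrite !inE eqxx.
move/dense_sub; rewrite cards2 xy !big_setU1 ?inE //= !big_set1.
have d1 : 0 < deg [set x; y] x.
  by apply/card_gt0P; exists y; rewrite !inE eqxx orbT.
have d2 : 0 < deg [set x; y] y.
  by apply/card_gt0P; exists x; rewrite !inE eqxx adjC.
lia.
Qed.

Lemma deg3 x y z : adj x y -> adj x z -> adj y z ->
  3 * (k - 1) + 6 < 2 * (D x + D y + D z).
Proof.
move=> a b c; have xy := adj_neq a; have xz := adj_neq b; have yz := adj_neq c.
have : [set x; y; z] != set0 by apply/set0Pn; exists x; rewrite !inE eqxx.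
have E F : \sum_(t in [set x; y; z]) F t = F x + F y + F z.
  rewrite (eq_bigl [in [:: x; y; z]]); last by move=> t; rewrite !inE orbA.
  rewrite -big_uniq /=; last by rewrite !inE negb_or xy xz yz.
  by rewrite !big_cons big_nil; lia.
have E1 : #|[set x; y; z]| = 3 by rewrite -sum1_card E.
move/dense_sub; rewrite E1 !E.
have d t t1 t2 : t1 != t2 -> t1 \in [set x; y; z] -> t2 \in [set x; y; z] ->
    adj t t1 -> adj t t2 -> 1 < deg [set x; y; z] t.
  move=> t12 h1 h2 a1 a2; apply/card_gt1P; exists t1, t2.
  by rewrite ![_ \in nb _ _ _]inE h1 h2 a1 a2.
have d1 : 1 < deg [set x; y; z] x by apply: (d _ y z); rewrite ?inE ?eqxx ?orbT.
have d2 : 1 < deg [set x; y; z] y.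
  by apply: (d _ x z); rewrite ?inE ?eqxx ?orbT // adjC.
have d3 : 1 < deg [set x; y; z] z.
  by apply: (d _ x y); rewrite ?inE ?eqxx ?orbT // adjC.
lia.
Qed.

(** A proper closed set and its complement would both be sparse with no adjacency between them, so
    the whole could not be dense. *)
Lemma connected (S : {set V}) x : x \in S ->
  (forall y z, y \in S -> adj y z -> z \in S) -> S = setT.
Proof.
move=> xS cl; apply/eqP; apply/negPn/negP => ST.
have S0 : ~: S != set0 by rewrite -(inj_eq (@setC_inj V)) setCK setC0.
have := dense_sub S0; have := sparse ST.
have e1 : \sum_(y in S) deg (~: S) y = 0.
  apply: big1 => y yS; apply/eqP; rewrite cards_eq0; apply/eqP/setP => z.
  rewrite !inE; apply/negP => /andP[zS a]; by rewrite (cl y) in zS.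
have e2 : \sum_(y in ~: S) D y = \sum_(y in ~: S) deg (~: S) y.
  rewrite deg_sym in e1.
  have -> : \sum_(y in ~: S) D y = \sum_(y in ~: S) deg S y + \sum_(y in ~: S) deg (~: S) y.
    by rewrite -big_split /=; apply: eq_bigr => y _; rewrite (degU S).
  by rewrite e1.
have := sparse (Y := ~: S); have : ~: S != setT.
  by rewrite -(inj_eq (@setC_inj V)) setCK setCT; apply/set0Pn; exists x.
by move=> -> /(_ isT); rewrite e2; lia.
Qed.

(** The average degree exceeds k - 1 and is at most [#|V| - 1]. *)
Lemma order_gt : k < #|V|.
Proof.
rewrite ltnNge; apply/negP => h.
have : \sum_x D x <= \sum_(x : V) (#|V| - 1).
  apply: leq_sum => x _; rewrite /deg.
  have : nb H setT x \subset ~: [set x].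
    by apply/subsetP => y; rewrite !inE => /adj_neq; rewrite eq_sym.
  move/subset_leq_card => h1; apply: leq_trans h1 _.
  by have := cardsC [set x]; rewrite cards1 => <-; lia.
have -> : \sum_(x : V) (#|V| - 1) = #|V| * (#|V| - 1).
  by rewrite sum_nat_const; congr (_ * _); apply: eq_card.
have h2 : #|V| * (#|V| - 1) <= (k - 1) * #|V|.
  by rewrite mulnC leq_mul2r leq_sub2r ?orbT.
by move=> h1; move: dense; rewrite ltnNge (leq_trans h1 h2).
Qed.

Lemma ex_vertex : exists x : V, True.
Proof.
have := order_gt; have [x _|h] := pickP V; first by exists x.
by rewrite (eq_card0 h).
Qed.

Lemma UC_sub C v p : rcyc C -> v \in C -> {subset C <= p} ->
  (forall l, l \in ccols C -> l != cn C v -> l \in cols p) ->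
  (forall y, y \in cn C v -> y \in U p) -> UC C \subset U p.
Proof.
move=> rC vC h1 h2 h3; apply/subsetP => x /mem_span[/h1 xp|[e eC xe]].
  exact: span1.
by have [E|ne] := eqVneq e (cn C v); [apply: h3; rewrite -E | apply: span2 (h2 _ eC ne) xe].
Qed.

Lemma next_nonconsec (C : seq V) (N : {set V}) : uniq C -> {subset N <= C} ->
  (forall v, v \in N -> next C v \notin N) -> 2 * #|N| <= size C.
Proof.
move=> uC sN nc; pose M := [set next C v | v in N].
have cM : #|M| = #|N| by apply: card_imset; apply: can_inj (prev_next uC).
have dNM : [disjoint N & M].
  by apply/pred0P => x /=; apply/negP => /andP[xN /imsetP[v vN E]]; rewrite E (negPf (nc v vN)) in xN.
have : #|N :|: M| <= #|[set x in C]|.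
  apply: subset_leq_card; apply/subsetP => x; rewrite in_setU => /orP[xN|/imsetP[v vN ->]].
    by rewrite inE sN.
  by rewrite inE mem_next sN.
rewrite cardsU disjoint_setI0 // cards0 card_set_seq // cM; clear; lia.
Qed.

(** * A long cycle with the third vertices of its edges is everything *)

Section Closure.
Variables (C : seq V).
Hypothesis rC : rcyc C.
Hypothesis sizeC : size C <= k - 1.
Hypothesis noU : forall q, rainbow q -> (size C).+2 <= size q -> #|U q| <= #|UC C|.
Hypothesis nocyc : forall E, rcyc E -> size E != (size C).+1.

(** The following lemmas each build a path with two vertices more than the cycle that covers [UC C]
    and the new vertex [z] as well, against [noU]. Only the edge leaving [v] is given up, so only
    its vertices need separate care. *)
Lemma cl_path p v z : rainbow p -> (size C).+2 <= size p -> v \in C ->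
  {subset C <= p} ->
  (forall l, l \in ccols C -> l != cn C v -> l \in cols p) ->
  (forall y, y \in cn C v -> y \in U p) -> z \in p -> z \notin UC C -> False.
Proof.
move=> rp sp vC h1 h2 h3 zp zU; have := noU rp sp; rewrite leqNgt => /negP; apply.
apply: proper_card; apply/properP; split; first exact: (UC_sub rC vC).
by exists z => //; apply: span1.
Qed.

(** Path: [z], [x], then the cycle from [next C v] to [v], where the edge leaving [v] contains
    [x]. *)
Lemma cl_petal x z : x \in UC C -> x \notin C -> z \notin UC C -> adj z x -> False.
Proof.
move=> xU xC zU a; have zC : z \notin C by apply: contra zU; apply: span1.
have [|[e /(rcyc_ccols rC)[v vC ->] xe]] := mem_span xU; first by rewrite (negPf xC).
have [cH h1 h2 h3] := cn_facts rC vC.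
have [o1 o2] := own rC vC xC xe.
have [aH [za xa]] := (adj_col a, col_mem card13 (adj_col a)).
have nz := notin_UC zU za.
have ne : col z x != cn C v by apply: contraNneq nz => ->; apply: rcyc_cn.
have [] := @ear_path _ _ C v [:: z; x] [::] rC vC.
- by rewrite /= inE (adj_neq a).
- by move=> y; rewrite !inE => /orP[]/eqP->.
- by rewrite /= o1 inE ne.
- move=> l; rewrite /= o1 !inE => /orP[/eqP->|/eqP->]; rewrite /fresh ?eqxx //.
  by rewrite aH nz !orbT.
move=> p [rp sp mp [c1 c2]].
apply: (@cl_path p v z) => //.
- by rewrite sp /=; clear; lia.
- by move=> y yC; rewrite mp !mem_cat yC !orbT.
- by move=> y ye; apply: span2 ye; apply: c2; rewrite /= o1 !inE eqxx orbT.
- by rewrite mp mem_head.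
Qed.

(** Path: the third vertex of the edge leaving [x], the cycle from [next C x] to [x], then [z]. *)
Lemma cl_open x z : x \in C -> z \notin UC C -> adj z x -> ~~ opn C x.
Proof.
move=> xC zU a; apply/negP => /subsetPn[y ye yC]; have zC : z \notin C by apply: contra zU; apply: span1.
have [cH h1 h2 h3] := cn_facts rC xC.
have [o1 o2] := own rC xC yC ye.
have [aH [za xa]] := (adj_col a, col_mem card13 (adj_col a)).
have nz := notin_UC zU za.
have ne : col z x != cn C x by apply: contraNneq nz => ->; apply: rcyc_cn.
have yz : y != z.
  by apply: contraNneq zU => <-; apply: span2 ye; apply: rcyc_cn.
have [] := @ear_path _ _ C x [:: y] [:: z] rC xC.
- by rewrite /= inE yz.
- by move=> t; rewrite !inE => /orP[]/eqP->.
- by rewrite /= o1 inE colC eq_sym ne.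
- move=> l; rewrite /= o1 !inE => /orP[/eqP->|/eqP->]; rewrite /fresh ?eqxx //.
  by rewrite colC aH nz !orbT.
move=> p [rp sp mp [c1 c2]].
apply: (@cl_path p x z) => //.
- by rewrite sp /=; clear; lia.
- by move=> t tC; rewrite mp !mem_cat tC !orbT.
- by move=> t te; apply: span2 te; apply: c2; rewrite /= o1 !inE eqxx.
- by rewrite mp !inE eqxx orbT.
Qed.
End Closure.
Section Closure2.
Variables (C : seq V).
Hypothesis rC : rcyc C.
Hypothesis sizeC : size C <= k - 1.
Hypothesis noU : forall q, rainbow q -> (size C).+2 <= size q -> #|U q| <= #|UC C|.
Hypothesis nocyc : forall E, rcyc E -> size E != (size C).+1.

Lemma ccols_rev_mem C' : ccols (rev C') =i ccols C'.
Proof. exact: perm_mem (perm_ccols_rev _ C'). Qed.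

Lemma UC_rev C' : UC (rev C') = UC C'.
Proof.
apply/setP => x; rewrite !inE mem_rev; congr (_ || _).
by apply: eq_has_r; apply: ccols_rev_mem.
Qed.

Lemma opn_rev C' v : rcyc C' -> opn (rev C') v = opn C' (prev C' v).
Proof.
move=> rC'; rewrite /opn cn_rev //; congr (~~ _); apply: eq_subset_r => x.
exact: mem_rev.
Qed.

Lemma cl_open' x z : x \in C -> z \notin UC C -> adj z x -> ~~ opn C (prev C x).
Proof.
move=> xC zU a; rewrite -opn_rev //; apply: (@cl_open (rev C) _ _ x z) => //.
- exact: rcyc_rev.
- by move=> q; rewrite size_rev UC_rev; apply: noU.
- by rewrite mem_rev.
- by rewrite UC_rev.
Qed.

(** Otherwise [z2], [z] and the cycle started at [x] form the forbidden path. The edge given up is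
    the one entering [x], which by [cl_open'] has no vertex off the cycle, so no covered vertex is
    lost. *)
Lemma cl_out x z z2 : x \in C -> z \notin UC C -> adj z x -> z2 \notin C ->
  adj z z2 -> col z z2 = col z x.
Proof.
move=> xC zU a z2C a2; apply/eqP/negPn/negP => ne.
have zC : z \notin C by apply: contra zU; apply: span1.
pose v := prev C x; have vC : v \in C by rewrite mem_prev.
have nv : next C v = x by rewrite next_prev // (rcyc_uniq rC).
have [aH [za xa]] := (adj_col a, col_mem card13 (adj_col a)).
have [aH2 [za2 xa2]] := (adj_col a2, col_mem card13 (adj_col a2)).
have nz := notin_UC zU za; have nz2 := notin_UC zU za2.
have [] := @ear_path _ H C v [:: z2; z] [::] rC vC.
- by rewrite /= inE eq_sym (adj_neq a2).
- by move=> t; rewrite !inE => /orP[]/eqP->.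
- by rewrite /= nv inE colC ne.
- move=> l; rewrite /= nv (colC _ z2) !inE => /orP[/eqP->|/eqP->]; rewrite /fresh.
    by rewrite aH2 nz2 !orbT.
  by rewrite aH nz !orbT.
move=> p [rp sp mp [c1 c2]].
have Cp : {subset C <= p} by move=> t tC; rewrite mp !mem_cat tC !orbT.
apply: (@cl_path C rC noU p v z) => //.
- by rewrite sp /=; clear; lia.
- move=> t te; apply: span1; apply: Cp; have := cl_open' xC zU a.
  by rewrite negbK => /subsetP/(_ t te).
- by rewrite mp !inE eqxx orbT.
Qed.

(** By [cl_out] one edge contains all neighbours of [z]. *)
Lemma cl_deg x z z2 : x \in C -> z \notin UC C -> adj z x -> z2 \notin C ->
  adj z z2 -> D z <= 2.
Proof.
move=> xC zU a z2C a2.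
have sub : nb H setT z \subset col z x :\ z.
  apply/subsetP => t; rewrite !inE => at_; rewrite eq_sym (adj_neq at_) /=.
  have [_ tt] := col_mem card13 (adj_col at_).
  have [tC|tC] := boolP (t \in C).
    by rewrite -(cl_out xC zU a z2C a2) (cl_out tC zU at_ z2C a2).
  by rewrite -(cl_out xC zU a tC at_).
apply: leq_trans (subset_leq_card sub) _.
have := cardsD1 z (col z x); have [-> _] := col_mem card13 (adj_col a).
by have := card13 (adj_col a); lia.
Qed.

(** Let [z] be uncovered and adjacent to the covered set. If it has a neighbour [z2] off the cycle,
    both have degree at most 2, against [deg2]. Otherwise its neighbours lie on the cycle, no two of
    them consecutive as [z] could be inserted there, which is too few for [deg1]. *)
Lemma cyc_closure : UC C = setT.
Proof.
have [x0 x0C] : exists x, x \in C.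
  by case: C rC => // x t _; exists x; rewrite mem_head.
apply: (@connected _ x0); first exact: span1.
move=> x z xU a'; apply/negPn/negP => zU; have a : adj z x by rewrite adjC.
have xC : x \in C by apply/negPn/negP => xC; exact: (cl_petal rC noU xU xC zU a).
have [/existsP[z2 /andP[z2C a2]]|h] := boolP [exists z2, (z2 \notin C) && adj z z2].
  have d1 := cl_deg xC zU a z2C a2.
  have zC : z \notin C by apply: contra zU; apply: span1.
  have z2U : z2 \notin UC C by apply/negP => z2U; exact: (cl_petal rC noU z2U z2C zU a2).
  have ez := cl_out xC zU a z2C a2.
  have a3 : adj z2 z by rewrite adjC.
  have a4 : adj z2 x.
    have [_ h1] := col_mem card13 (adj_col a2); have [_ h2] := col_mem card13 (adj_col a).
    apply: (adj_edge lin (adj_col a)) => //; first by rewrite -ez.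
    by rewrite eq_sym (in_neq xC).
  have d2 := cl_deg xC z2U a4 zC a3; have := deg2 a2; move: d1 d2 k4; clear; lia.
have sN : {subset nb H setT z <= C}.
  move=> t; rewrite !inE /= => at_; apply: contraR h => tC.
  by apply/existsP; exists t; rewrite tC.
have : 2 * #|nb H setT z| <= size C; last by have := deg1 z; rewrite /deg; move: sizeC k4; clear; lia.
apply: next_nonconsec => //; first exact: rcyc_uniq rC.
move=> v; rewrite !inE /= => av; apply/negP => anv.
have vC : v \in C by apply: sN; rewrite !inE.
have zC : z \notin C by apply: contra zU; apply: span1.
have [cH h1 h2 h3] := cn_facts rC vC.
have [zv vv] := col_mem card13 (adj_col av); have [znv nvv] := col_mem card13 (adj_col anv).
have [] := @ear_cycle _ H C v [:: z] rC vC.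
- by [].
- by [].
- by move=> t; rewrite inE => /eqP->.
- rewrite /= inE andbT; apply/negP => /eqP E.
  have E2 : col v z = cn C v.
    rewrite colC; apply: (edges_share1 lin (adj_col av) cH h3) => //.
    by rewrite colC E.
  by have := notin_UC zU zv; rewrite colC E2 rcyc_cn.
- move=> l; rewrite /= !inE => /orP[/eqP->|/eqP->]; rewrite /fresh.
    by rewrite colC (adj_col av) (notin_UC zU zv) !orbT.
  by rewrite (adj_col anv) (notin_UC zU znv) !orbT.
by move=> E rE [sE _]; have := nocyc rE; rewrite sE addn1 eqxx.
Qed.
End Closure2.
End Span.

(** * Counting around a cycle whose edges cover every vertex *)

Section Covered.
Variables (V : finType) (H : {set {set V}}).
Notation col := (col H). Notation cols := (cols H). Notation ccols := (ccols H).
Notation rainbow := (rainbow H). Notation rcyc := (rcyc H). Notation cn := (cn H).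
Notation adj := (adj H). Notation deg := (deg H). Notation D := (deg setT).
Notation UC := (UC H). Notation U := (U H). Notation opn := (opn H).

Hypothesis card13 : forall e, e \in H -> 0 < #|e| <= 3.
Hypothesis lin : linear_hg H.
Variable k : nat.
Hypothesis k4 : 4 <= k.
Hypothesis dense : (k - 1) * #|V| < \sum_x D x.
Hypothesis sparse : forall Y : {set V}, Y != setT ->
  \sum_(x in Y) deg Y x <= (k - 1) * #|Y|.

(** Neighbours reached through an edge that is not a cycle edge, hence usable as a link wherever the
    cycle is cut. *)
Definition newnb C z := [set v in C | adj z v && (col z v \notin ccols C)].
Definition owned C z := [set v in C | z \in cn C v].
Definition opens C := [set v in C | opn C v].
(** The name fits the covered case, where each vertex off the cycle is the third vertex of some
    cycle edge. *)
Definition petals (C : seq V) := ~: [set x in C].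

Section One.
Variable C : seq V.
Hypothesis rC : rcyc C.
Hypothesis cov : UC C = setT.
Notation Cs := [set x in C].
Notation Z := (petals C). Notation I := (opens C).
Notation N := (newnb C). Notation J := (owned C).

Lemma in_petals z : (z \in Z) = (z \notin C).
Proof. by rewrite !inE. Qed.

Lemma in_newnb z v : v \in N z ->
  [/\ v \in C, adj z v, col z v \notin ccols C & col z v \in H].
Proof. by rewrite inE => /and3P[vC a n]; split=> //; apply: adj_col. Qed.

Lemma opn_ex v : v \in I -> exists2 y, y \in cn C v & y \notin C.
Proof. by rewrite inE => /andP[vC /subsetPn]. Qed.

Lemma petal_own z : z \notin C -> exists2 t, t \in C & z \in cn C t.
Proof.
move=> zC; have : z \in UC C by rewrite cov inE.
case/mem_span; first by rewrite (negPf zC).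
by case=> e /(rcyc_ccols rC)[t tC ->] ze; exists t.
Qed.

Lemma new_notin_cn z v t : z \notin C -> v \in N z -> t \in C ->
  z \in cn C t -> v \in cn C t -> False.
Proof.
move=> zC /in_newnb[vC a n cH] tC zt vt.
have [tH _ _ _] := cn_facts card13 rC tC.
have E : col z v = cn C t by apply: (col_eq lin) => //; apply: adj_neq a.
by rewrite E rcyc_cn in n.
Qed.

Lemma cn_mem v : v \in C -> v \in cn C v.
Proof. by case/(cn_facts card13 rC). Qed.
Lemma cn_memn v : v \in C -> next C v \in cn C v.
Proof. by case/(cn_facts card13 rC). Qed.
Lemma cn_H v : v \in C -> cn C v \in H.
Proof. by case/(cn_facts card13 rC). Qed.
Lemma nextC v : (next C v \in C) = (v \in C).
Proof. exact: mem_next. Qed.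
Lemma prevC v : (prev C v \in C) = (v \in C).
Proof. exact: mem_prev. Qed.
Lemma next_prevC v : next C (prev C v) = v.
Proof. exact: next_prev (rcyc_uniq rC) v. Qed.
Lemma prev_nextC v : prev C (next C v) = v.
Proof. exact: prev_next (rcyc_uniq rC) v. Qed.

Lemma new_not_owned z v : z \notin C -> v \in N z -> z \notin cn C v /\ z \notin cn C (prev C v).
Proof.
move=> zC vN; have [vC _ _ _] := in_newnb vN.
split; apply/negP => zt; apply: (new_notin_cn zC vN _ zt); rewrite ?prevC ?cn_mem //.
by rewrite -{1}[v]next_prevC cn_memn ?prevC.
Qed.

(** Consecutive cycle edges already share [next C v], so linearity forbids a second common
    vertex. *)
Lemma owned_next z v : z \notin C -> v \in C -> z \in cn C v -> z \notin cn C (next C v).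
Proof.
move=> zC vC z1; apply/negP => z2.
have nC : next C v \in C by rewrite nextC.
have [_ _ _ n1] := cn_facts card13 rC vC.
have E : cn C v = cn C (next C v).
  apply: (edges_share1 lin (x := z) (y := next C v)); rewrite ?cn_H ?cn_mem ?cn_memn //.
  by rewrite eq_sym (in_neq nC).
by have := cn_inj rC vC nC E => E2; rewrite -E2 eqxx in n1.
Qed.

Lemma owned_half z : z \notin C -> 2 * #|J z| <= size C.
Proof.
move=> zC; apply: next_nonconsec; first exact: rcyc_uniq rC.
  by move=> v; rewrite inE => /andP[].
move=> v; rewrite inE => /andP[vC zv]; rewrite inE negb_and orbC.
by rewrite owned_next.
Qed.

Lemma new_edge_Z z z' : z \notin C -> z' \notin C -> adj z z' -> col z z' \notin ccols C.
Proof.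
move=> zC zC' a; apply/negP => /(rcyc_ccols rC)[v vC E].
have [h1 h2] := col_mem card13 (adj_col a); rewrite E in h1 h2.
by have := adj_neq a; rewrite (own_uniq card13 rC vC zC zC' h1 h2) eqxx.
Qed.

Lemma card_cyc : #|Cs| = size C.
Proof. by rewrite card_set_seq // (rcyc_uniq rC). Qed.

Lemma cardVCZ : #|V| = size C + #|Z|.
Proof. by rewrite -card_cyc cardsC. Qed.

Lemma deg_Cs x : x \in C -> deg Cs x <= (size C).-1.
Proof.
move=> xC; rewrite -card_cyc (cardsD1 x) inE xC /=.
apply: subset_leq_card; apply/subsetP => y; rewrite !inE => /andP[-> a].
by rewrite eq_sym (adj_neq a).
Qed.

(** A cycle edge through [z] provides two cycle vertices; every other neighbour on the cycle is
    new. *)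
Lemma deg_petal z : z \notin C -> deg Cs z <= 2 * #|J z| + #|N z|.
Proof.
move=> zC.
have sub : nb H Cs z \subset (J z :|: [set next C v | v in J z]) :|: N z.
  apply/subsetP => x; rewrite !in_setU inE => /andP[xC a]; rewrite inE in xC.
  have [h|h] := boolP (col z x \in ccols C); last by rewrite [x \in N z]inE xC a h !orbT.
  have [v vC E] := rcyc_ccols rC h.
  have [cH h1 h2 h3] := cn_facts card13 rC vC.
  have [zm xm] := col_mem card13 (adj_col a); rewrite E in zm xm.
  have vJ : v \in J z by rewrite inE vC.
  have [-> | xv] := eqVneq x v; first by rewrite vJ.
  have [-> | xn] := eqVneq x (next C v); first by rewrite imset_f ?orbT.
  case: (no4 card13 cH _ h1 h2 zm xm).
  have nC : next C v \in C by rewrite nextC.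
  by rewrite /= !inE !negb_or h3 (in_neq vC) // (in_neq nC) // ![_ == x]eq_sym xv xn (in_neq xC).
apply: leq_trans (subset_leq_card sub) _.
rewrite cardsU; apply: leq_trans (leq_subr _ _) _; rewrite leq_add2r cardsU.
apply: leq_trans (leq_subr _ _) _; rewrite mul2n -addnn leq_add2l; exact: leq_imset_card.
Qed.

Lemma sum_owned : \sum_(z in Z) #|J z| = #|I|.
Proof.
under eq_bigr => z _ do rewrite -sum1_card big_mkcond /=.
rewrite exchange_big -sum1_card [RHS]big_mkcond /=; apply: eq_bigr => v _.
rewrite [v \in I]inE; have [vC|vC] /= := boolP (v \in C); last first.
  by apply: big1 => z _; rewrite inE (negPf vC).
case: ifP => [|h]; last first.
  apply: big1 => z; rewrite in_petals inE vC /= => zC.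
  by move/negbFE: h => /subsetP h; case: ifP => // /h; rewrite (negPf zC).
case/subsetPn => y yv yC; rewrite (bigD1 y) /=; last by rewrite in_petals.
rewrite inE vC yv /= big1 // => z /andP[]; rewrite in_petals inE vC /= => zC zy.
case: ifP => // zv; by rewrite (own_uniq card13 rC vC zC yC zv yv) eqxx in zy.
Qed.

(** Adjacencies between the cycle and the petals count from both sides, so the bound of [deg_petal],
    summed by means of [sum_owned], enters twice; this gives the coefficients 4 and 2. *)
Lemma cov_main : (k - 1) * (size C + #|Z|) <
  \sum_(x in Cs) deg Cs x + 4 * #|I| + \sum_(z in Z) (2 * #|N z| + deg Z z).
Proof.
rewrite -cardVCZ; apply: leq_trans dense _.
have -> : \sum_x D x = \sum_(x in Cs) D x + \sum_(x in Z) D x.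
  by rewrite (bigID (mem Cs)) /=; congr (_ + _); apply: eq_bigl => x; rewrite !inE.
have -> : \sum_(x in Cs) D x = \sum_(x in Cs) deg Cs x + \sum_(x in Z) deg Cs x.
  rewrite (deg_sym H Z) -big_split /=; apply: eq_bigr => x _; exact: degU.
have -> : \sum_(x in Z) D x = \sum_(x in Z) deg Cs x + \sum_(x in Z) deg Z x.
  rewrite -big_split /=; apply: eq_bigr => x _; exact: degU.
have h : \sum_(x in Z) deg Cs x <= 2 * #|I| + \sum_(z in Z) #|N z|.
  rewrite -sum_owned big_distrr -big_split /=; apply: leq_sum => z.
  by rewrite in_petals; apply: deg_petal.
have -> : \sum_(z in Z) (2 * #|N z| + deg Z z) =
    2 * (\sum_(z in Z) #|N z|) + \sum_(z in Z) deg Z z by rewrite big_split -big_distrr.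
move: h; move: (\sum_(x in Z) deg Cs x) (\sum_(z in Z) #|N z|) (\sum_(z in Z) deg Z z).
move: (\sum_(x in Cs) deg Cs x); clear; lia.
Qed.

Lemma sum_deg_Cs : \sum_(x in Cs) deg Cs x <= size C * (size C).-1.
Proof.
rewrite -{1}card_cyc -sum_nat_const; apply: leq_sum => x; rewrite inE; exact: deg_Cs.
Qed.

Lemma newnb_sub z : {subset N z <= C}.
Proof. by move=> v /in_newnb[]. Qed.

(** [A], its shift by [prev C] and [K] are disjoint. Typically [A] consists of new neighbours of a
    petal and [K] of the starts of open or owned edges. *)
Lemma disjoint_count (A K : {set V}) : {subset A <= C} -> {subset K <= C} ->
  (forall v, v \in A -> next C v \notin A) ->
  (forall v, v \in A -> v \notin K /\ prev C v \notin K) ->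
  2 * #|A| + #|K| <= size C.
Proof.
move=> AC KC nc nK; pose M := [set prev C v | v in A].
have cM : #|M| = #|A|.
  by apply: card_imset; apply: can_inj (next_prev (rcyc_uniq rC)).
have d1 : [disjoint A & M].
  apply/pred0P => x /=; apply/negP => /andP[xN /imsetP[v vN E]].
  by have := nc x xN; rewrite E next_prevC vN.
have d2 : [disjoint A :|: M & K].
  apply/pred0P => x /=; apply/negP => /andP[]; rewrite in_setU.
  by case/orP=> [/nK[/negPf->]|/imsetP[v /nK[_ /negPf h] ->]]; rewrite ?h.
have : #|(A :|: M) :|: K| <= #|Cs|.
  apply: subset_leq_card; apply/subsetP => x; rewrite !in_setU => h; rewrite inE.
  case/orP: h => [/orP[/AC//|/imsetP[v /AC vC ->]]|/KC//].
  by rewrite prevC.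
by rewrite cardsU (disjoint_setI0 d2) cards0 cardsU (disjoint_setI0 d1) cards0 cM card_cyc; clear; lia.
Qed.

Lemma new_nonconsec z v : (forall E, rcyc E -> size E != (size C).+1) ->
  z \notin C -> v \in N z -> next C v \notin N z.
Proof.
move=> nocyc zC vN; apply/negP => nN.
have [vC a n cH] := in_newnb vN; have [nC a' n' cH'] := in_newnb nN.
have [] := @ear_cycle _ H C v [:: z] rC vC.
- by [].
- by [].
- by move=> t; rewrite inE => /eqP->.
- rewrite /= inE andbT; apply/negP => /eqP E.
  have [h1 h2] := col_mem card13 cH; have [h3 h4] := col_mem card13 cH'.
  have [tH g1 g2 g3] := cn_facts card13 rC vC.
  move: n; rewrite (edges_share1 lin cH tH g3) ?rcyc_cn //.
  by rewrite colC E.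
- move=> l; rewrite /= !inE => /orP[/eqP->|/eqP->]; rewrite /fresh.
    by rewrite colC cH n !orbT.
  by rewrite cH' n' !orbT.
by move=> E rE [sE _]; have := nocyc _ rE; rewrite sE addn1 eqxx.
Qed.

(** The third vertex of the open edge precedes [next C v], and [z] follows [v]. *)
Lemma new_open_path z v : z \notin C -> v \in N z -> v \in I ->
  exists2 p, rainbow p & size p = (size C).+2.
Proof.
move=> zC vN /opn_ex[y yv yC]; have [vC a n cH] := in_newnb vN.
have [o1 o2] := own card13 lin rC vC yC yv.
have [nz _] := new_not_owned zC vN.
have [] := @ear_path _ H C v [:: y] [:: z] rC vC.
- by rewrite /= inE andbT; apply: contraNneq nz => <-.
- by move=> t; rewrite !inE => /orP[]/eqP->.
- rewrite /= o1 inE andbT; apply: contraNneq n; rewrite colC => <-; exact: rcyc_cn.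
- move=> l; rewrite /= o1 !inE => /orP[/eqP->|/eqP->]; rewrite /fresh ?eqxx ?cn_H //.
  by rewrite colC cH n !orbT.
by move=> p [rp sp _ _]; exists p => //; rewrite sp /=; clear; lia.
Qed.

Lemma petal_adj_path z z' : z \notin C -> z' \notin C -> adj z z' ->
  exists2 p, rainbow p & size p = (size C).+2.
Proof.
move=> zC zC' a; have [t tC zt] := petal_own zC.
have [o1 o2] := own card13 lin rC tC zC zt; have n := new_edge_Z zC zC' a.
have [] := @ear_path _ H C t [:: z'; z] [::] rC tC.
- by rewrite /= inE eq_sym (adj_neq a).
- by move=> x; rewrite !inE => /orP[]/eqP->.
- by rewrite /= o1 inE andbT; apply: contraNneq n; rewrite colC => ->; exact: rcyc_cn.
- move=> l; rewrite /= o1 !inE => /orP[/eqP->|/eqP->]; rewrite /fresh ?eqxx ?cn_H //.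
  by rewrite colC (adj_col a) n !orbT.
by move=> p [rp sp _ _]; exists p => //; rewrite sp /=; clear; lia.
Qed.

End One.

Lemma newnb_rev C z : newnb (rev C) z = newnb C z.
Proof. by apply/setP => x; rewrite !inE mem_rev ccols_rev_mem. Qed.

Lemma mem_opens_rev C v : rcyc C -> (v \in opens (rev C)) = (prev C v \in opens C).
Proof. by move=> rC; rewrite !inE mem_rev opn_rev // mem_prev. Qed.

Lemma new_open_path' C z v : rcyc C -> z \notin C -> v \in newnb C z ->
  prev C v \in opens C -> exists2 p, rainbow p & size p = (size C).+2.
Proof.
move=> rC zC vN vI; rewrite -(size_rev C); apply: (@new_open_path (rev C) _ z v).
- exact: rcyc_rev.
- by rewrite mem_rev.
- by rewrite newnb_rev.
- by rewrite mem_opens_rev.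
Qed.

End Covered.

(** * Excluding long rainbow cycles *)

Section LongCycles.
Variables (V : finType) (H : {set {set V}}).
Notation col := (col H). Notation cols := (cols H). Notation ccols := (ccols H).
Notation rainbow := (rainbow H). Notation rcyc := (rcyc H). Notation cn := (cn H).
Notation adj := (adj H). Notation deg := (deg H). Notation D := (deg setT).
Notation UC := (UC H). Notation U := (U H). Notation opn := (opn H).

Hypothesis card13 : forall e, e \in H -> 0 < #|e| <= 3.
Hypothesis lin : linear_hg H.
Variable k : nat.
Hypothesis k4 : 4 <= k.
Hypothesis dense : (k - 1) * #|V| < \sum_x D x.
Hypothesis sparse : forall Y : {set V}, Y != setT ->
  \sum_(x in Y) deg Y x <= (k - 1) * #|Y|.
Variable c : nat.
Hypothesis ck : c.+1 <= k.
Hypothesis cmax : forall p, rainbow p -> size p <= c.+1.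

(** A vertex off the cycle with a neighbour on it could be put in front of the opened cycle, making
    a path with too many vertices. So the cycle contains every vertex, against [order_gt]. *)
Lemma no_cycle_Sc C : rcyc C -> size C != c.+1.
Proof.
move=> rC; apply/eqP => sC.
have [x0 x0C] : exists x, x \in C.
  by case: C rC {sC} => // x t _; exists x; rewrite mem_head.
have ear v y : v \in C -> y \notin C -> adj y (next C v) ->
    fresh H C v v (col y (next C v)) -> False.
  move=> vC yC a f; have [] := @ear_path _ H C v [:: y] [::] rC vC.
  - by [].
  - by move=> t; rewrite inE => /eqP->.
  - by [].
  - by move=> l; rewrite /= inE => /eqP->; rewrite (adj_col a).
  by move=> p [/cmax rp sp _ _]; rewrite sp sC /= addn0 add1n ltnn in rp.
have E : [set x in C] = setT.
  apply: (connected k4 dense sparse (x := x0)); first by rewrite inE.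
  move=> y z; rewrite !inE => yC a; apply/negPn/negP => zC.
  (* If the joining edge is a cycle edge, the cycle is cut at that edge; otherwise it is cut just
     before [y]. *)
  have [|n] := boolP (col y z \in ccols C).
    case/(rcyc_ccols rC) => v vC E; have [cH h1 h2 h3] := cn_facts card13 rC vC.
    have [_ zc] := col_mem card13 (adj_col a); rewrite E in zc.
    have [o1 _] := own card13 lin rC vC zC zc.
    apply: (ear v z) => //; last by rewrite /fresh o1 eqxx.
    by rewrite /adj o1 cH eq_sym (in_neq _ zC) // mem_next.
  apply: (ear (prev C y) z) => //; rewrite ?mem_prev ?next_prev ?(rcyc_uniq rC) //.
    by rewrite adjC.
  by rewrite /fresh colC n !orbT.
have := order_gt k4 dense; rewrite -cardsT -E card_set_seq ?(rcyc_uniq rC) // sC.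
by rewrite ltnNge ck.
Qed.

(** * Cycles of length [c] *)

Section CycleOfMaxLength.
Variable C : seq V.
Hypothesis rC : rcyc C.
Hypothesis sC : size C = c.
Notation Cs := [set x in C].
Notation Z := (petals C). Notation I := (opens H C).
Notation N := (newnb H C). Notation J := (owned H C).

Lemma sizeC_lt : size C <= k - 1. Proof. by rewrite sC; move: ck; clear; lia. Qed.

Lemma nolong p : rainbow p -> size p = (size C).+2 -> False.
Proof. by move=> /cmax h E; rewrite E sC ltnn in h. Qed.

Lemma nocyc1 E : rcyc E -> size E != (size C).+1.
Proof. by move/no_cycle_Sc; rewrite sC. Qed.

(** No rainbow path has two vertices more than this cycle, so the covering hypothesis of
    [cyc_closure] holds vacuously. *)
Lemma covC : UC C = setT.
Proof.
apply: (cyc_closure card13 lin k4 dense sparse rC sizeC_lt) nocyc1.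
by move=> q /cmax; rewrite sC leqNgt => /negPf->.
Qed.

Lemma new_closed z v : z \notin C -> v \in N z -> v \notin I /\ prev C v \notin I.
Proof.
move=> zC vN; split; apply/negP => vI.
  by have [p rp /(nolong rp)] := new_open_path card13 lin rC zC vN vI.
by have [p rp /(nolong rp)] := new_open_path' card13 lin rC zC vN vI.
Qed.

Lemma I_sub : {subset I <= C}. Proof. by move=> v; rewrite inE => /andP[]. Qed.

Lemma new_count z : z \notin C -> 2 * #|N z| + #|I| <= size C.
Proof.
move=> zC; apply: (disjoint_count rC); [exact: newnb_sub|exact: I_sub| |].
  move=> v; exact: (new_nonconsec card13 lin rC nocyc1 zC).
by move=> v; apply: new_closed.
Qed.

Lemma Z_indep z z' : z \notin C -> z' \notin C -> ~~ adj z z'.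
Proof.
move=> zC zC'; apply/negP => a.
by have [p rp /(nolong rp)] := petal_adj_path card13 lin rC covC zC zC' a.
Qed.

Lemma degZ0 z : z \in Z -> deg Z z = 0.
Proof.
rewrite in_petals => zC; apply/eqP; rewrite cards_eq0; apply/eqP/setP => x.
by rewrite !inE; apply/negP => /andP[xC]; apply/negP; apply: Z_indep.
Qed.

Lemma main_c : c * (c + #|Z|) <
  \sum_(x in Cs) deg Cs x + 4 * #|I| + \sum_(z in Z) (2 * #|N z|).
Proof.
have := cov_main card13 dense rC; rewrite sC.
have -> : \sum_(z in Z) (2 * #|N z| + deg Z z) = \sum_(z in Z) 2 * #|N z|.
  by apply: eq_bigr => z zZ; rewrite degZ0 // addn0.
apply: leq_ltn_trans; rewrite leq_mul2r; apply/orP; right.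
by move: ck; clear; lia.
Qed.

Lemma cardI_le : #|I| <= c.
Proof.
rewrite -sC -(card_cyc rC); apply: subset_leq_card; apply/subsetP => v /I_sub.
by rewrite inE.
Qed.

(** With q petals and i open edges, [new_count] reduces the main inequality to c + q i < 4 i; since
    i is at most c, this fails for q at least 3. The lower bound is [order_gt]. *)
Lemma cardZ2 : #|Z| = 2.
Proof.
have q2 : 2 <= #|Z|.
  by have := order_gt k4 dense; rewrite (cardVCZ rC) sC; move: ck; clear; lia.
apply/eqP; rewrite eqn_leq q2 andbT leqNgt; apply/negP => q3.
have := main_c; have h1 := sum_deg_Cs rC; have hI := cardI_le.
have h2 : \sum_(z in Z) (2 * #|N z|) <= #|Z| * (c - #|I|).
  rewrite -sum_nat_const; apply: leq_sum => z; rewrite in_petals => /new_count.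
  by rewrite sC; clear; lia.
rewrite sC in h1; have := rcyc_size rC; rewrite sC.
move: h1 h2 q3 hI; move: (\sum_(x in Cs) deg Cs x) (\sum_(z in Z) _) #|Z| #|I|.
clear => a b q i h1 h2 q3 hi c3.
have := leq_mul2l 3 i (c - i); nia.
Qed.

(** A new edge between the starts of two open edges is a chord. If the two open edges have the same
    petal, it closes a cycle of length [c.+1]; if not, their petals become the ends of a path that
    is too long. *)
Lemma I_new_nonadj v v' : v \in I -> v' \in I -> adj v v' -> col v v' \in ccols C.
Proof.
move=> vI vI' a; apply/negPn/negP => n.
have [vC vC'] := (I_sub vI, I_sub vI').
have [y yv yC] := opn_ex vI; have [y' yv' yC'] := opn_ex vI'.
have [o1 o2] := own card13 lin rC vC yC yv.
have [o1' o2'] := own card13 lin rC vC' yC' yv'.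
have vv : v' != v by rewrite eq_sym (adj_neq a).
have ncc : cn C v != cn C v'.
  by apply: contraNneq vv => /(cn_inj rC vC vC')->.
have nv t : t \in C -> col v v' != cn C t by move=> tC; apply: contraNneq n => ->; apply: rcyc_cn.
have [E|ne] := eqVneq y y'.
  have o3 : col (next C v') y = cn C v' by rewrite colC E.
  have [] := @chord_cycle _ H C v v' [::] [:: y] rC vC vC' vv.
  - by [].
  - by move=> t; rewrite !inE => /eqP->.
  - rewrite /= o1 o3 (colC _ v') !inE !negb_or !nv //.
    by rewrite eq_sym ncc.
  - move=> l; rewrite /= o1 o3 (colC _ v') !inE.
    case/or3P=> /eqP->; rewrite /fresh ?eqxx ?orbT ?(cn_H card13 rC) //.
    by rewrite (adj_col a) n !orbT.
  by move=> E0 rE sE; have := nocyc1 rE; rewrite sE addn1 eqxx.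
have [] := @chord_path _ H C v v' [:: y] [::] [:: y'] rC vC vC' vv.
- by rewrite /= inE ne.
- by move=> t; rewrite !inE => /orP[]/eqP->.
- rewrite /= o1 (colC _ _ y') o1' (colC _ v') !inE !negb_or nv // ncc.
  by rewrite eq_sym nv.
- move=> l; rewrite /= o1 (colC _ _ y') o1' (colC _ v') !inE.
  case/or3P=> /eqP->; rewrite /fresh ?eqxx ?orbT ?(cn_H card13 rC) //.
  by rewrite (adj_col a) n !orbT.
by move=> p rp sp; apply: (nolong rp); rewrite sp addn2.
Qed.

(** Last edges of the maximal runs of open edges. Such an edge contains only one vertex of [I], so
    it contributes no adjacent pair inside [I]. *)
Definition kappa := [set t in I | next C t \notin I].

Lemma I_cn t : t \in C -> #|I :&: cn C t| <= 2 /\ (t \in kappa -> #|I :&: cn C t| <= 1).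
Proof.
move=> tC; have [cH h1 h2 h3] := cn_facts card13 rC tC.
have [tI|tI] := boolP (t \in I); last first.
  split; last by rewrite inE (negPf tI).
  have : I :&: cn C t \subset cn C t :\ t.
    apply/subsetP => x; rewrite in_setI => /andP[xI xt]; rewrite !inE xt andbT.
    by apply: contraNneq tI => <-.
  move/subset_leq_card; have := cardsD1 t (cn C t); rewrite h1; have := card13 cH.
  by clear; lia.
have [y yt yC] := opn_ex tI.
have sub : I :&: cn C t \subset cn C t :\ y.
  apply/subsetP => x; rewrite in_setI => /andP[xI xt]; rewrite !inE xt andbT.
  by rewrite (in_neq (I_sub xI)).
have c2 : #|cn C t :\ y| <= 2.
  by have := cardsD1 y (cn C t); rewrite yt; have := card13 cH; clear; lia.
split; first by apply: leq_trans c2; apply: subset_leq_card.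
rewrite inE tI /= => nI.
have : I :&: cn C t \subset (cn C t :\ y) :\ next C t.
  apply/subsetP => x xI; rewrite in_setD1 (subsetP sub x xI) andbT.
  by apply: contraNneq nI => <-; move: xI; rewrite in_setI => /andP[].
move/subset_leq_card; have := cardsD1 (next C t) (cn C t :\ y).
have -> : next C t \in cn C t :\ y.
  by rewrite !inE h2 andbT (in_neq _ yC) // mem_next.
by move: c2; clear; lia.
Qed.

(** By [I_new_nonadj], adjacent pairs in [I] lie on cycle edges. Each of these has at most two
    vertices of [I], that is two ordered pairs, and only one vertex if it is indexed by [kappa]. *)
Lemma sum_degI : \sum_(x in I) deg I x <= 2 * (c - #|kappa|).
Proof.
have h1 : \sum_(x in I) deg I x <=
    \sum_(x in I) \sum_(y in I) \sum_(t in Cs) ((x != y) && (x \in cn C t) && (y \in cn C t)).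
  apply: leq_sum => x xI; rewrite deg_sum; apply: leq_sum => y yI.
  have [a|//] := boolP (adj x y).
  have [t tC E] := rcyc_ccols rC (I_new_nonadj xI yI a).
  have [m1 m2] := col_mem card13 (adj_col a).
  by rewrite (bigD1 t) ?inE //= -E m1 m2 (adj_neq a).
apply: leq_trans h1 _.
under eq_bigr do rewrite exchange_big /=; rewrite exchange_big /=.
have h2 : \sum_(t in Cs) \sum_(x in I) \sum_(y in I)
    ((x != y) && (x \in cn C t) && (y \in cn C t)) <= \sum_(t in Cs) 2 * (t \notin kappa).
  apply: leq_sum => t; rewrite inE => tC; pose A := I :&: cn C t.
  have -> : \sum_(x in I) \sum_(y in I) ((x != y) && (x \in cn C t) && (y \in cn C t)) =
      \sum_(x in A) (#|A| - 1).
    rewrite [RHS]big_mkcond [LHS]big_mkcond; apply: eq_bigr => x _; rewrite in_setI.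
    have [xI|//] := boolP (x \in I); have [xt|xt] /= := boolP (x \in cn C t); last first.
      by apply: big1 => y _; rewrite andbF.
    rewrite -[RHS](_ : #|A :\ x| = _); last first.
      by have := cardsD1 x A; rewrite in_setI xI xt; clear; lia.
    rewrite -sum1_card [RHS]big_mkcond [LHS]big_mkcond; apply: eq_bigr => y _.
    by rewrite in_setD1 in_setI [y == x]eq_sym; case: (y \in I); case: (x == y); case: (y \in cn C t).
  rewrite sum_nat_const; have [a2 a1] := I_cn tC; rewrite -/A in a1 a2.
  have [tk|tk] := boolP (t \in kappa); last by move: a2; clear; nia.
  by move: (a1 tk); clear; nia.
apply: leq_trans h2 _; rewrite -big_distrr leq_mul2l /=.
have -> : \sum_(t in Cs) (t \notin kappa) = #|Cs :\: kappa|.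
  rewrite -sum1_card [RHS]big_mkcond [LHS]big_mkcond; apply: eq_bigr => t _.
  by rewrite in_setD andbC; case: (t \in Cs); case: (t \in kappa).
rewrite cardsD (card_cyc rC) sC leq_sub2l //.
have -> // : Cs :&: kappa = kappa.
apply/setIidPr/subsetP => t; rewrite [t \in kappa]inE => /andP[/I_sub tC _]; by rewrite inE.
Qed.

(** Of the ordered pairs inside [I], those not counted by [sum_degI] are missing from the shadow. *)
Lemma sum_degC : \sum_(x in Cs) deg Cs x + #|I| * (#|I| - 1) <=
  c * (c - 1) + 2 * (c - #|kappa|).
Proof.
apply: leq_trans (leq_add (leqnn _) sum_degI).
have -> : c * (c - 1) = \sum_(x in Cs) (c - 1) by rewrite sum_nat_const (card_cyc rC) sC.
have E : \sum_(x in I) deg I x = \sum_(x in Cs) (if x \in I then deg I x else 0).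
  rewrite -big_mkcondr /=; apply: eq_bigl => x; rewrite [x \in Cs]inE.
  by have [xI|] := boolP (x \in I); rewrite ?andbT ?andbF // I_sub.
have E2 : #|I| * (#|I| - 1) = \sum_(x in Cs) (if x \in I then #|I| - 1 else 0).
  rewrite -big_mkcondr -sum_nat_const /=; apply: eq_bigl => x; rewrite [x \in Cs]inE.
  by have [xI|] := boolP (x \in I); rewrite ?andbT ?andbF // I_sub.
rewrite E E2 -!big_split /=; apply: leq_sum => x; rewrite inE => xC.
have := deg_Cs rC xC; rewrite sC -subn1 => h.
case: ifP => xI; last by rewrite !addn0.
pose A := Cs :\ x; pose B := I :\ x.
have cA : #|A| = c - 1 by have := cardsD1 x Cs; rewrite inE xC (card_cyc rC) sC /A; clear; lia.
have cB : #|B| = #|I| - 1 by have := cardsD1 x I; rewrite xI /B; clear; lia.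
rewrite -cA -cB /deg /nb.
have nbC : [set y in Cs | adj x y] = A :&: [set y | adj x y].
  apply/setP => y; rewrite !inE; have [->|] := eqVneq y x; rewrite ?andbF //=.
  by rewrite /adj eqxx andbF.
have nbI : [set y in I | adj x y] = B :&: [set y | adj x y].
  apply/setP => y; rewrite !inE; have [->|] := eqVneq y x; rewrite ?andbF //=.
  by rewrite /adj eqxx andbF.
rewrite nbC nbI.
have BA : B \subset A.
  by apply/subsetP => y; rewrite !inE => /and3P[-> -> _].
move: (setSD [set y | adj x y] BA) => /subset_leq_card.
move: A B {cA cB nbC nbI BA} => A B.
by rewrite !cardsD; have := subset_leq_card (subsetIl A [set y | adj x y]);
 have := subset_leq_card (subsetIl B [set y | adj x y]); clear; lia.
Qed.

Lemma sum_Z2 (F : V -> nat) : exists z z', [/\ z != z', Z = [set z; z'] &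
  \sum_(z in Z) F z = F z + F z'].
Proof.
have /eqP/cards2P[z [z' [zz E]]] := cardZ2; exists z, z'; split=> //.
by rewrite E big_setU1 ?inE //= big_set1.
Qed.

(** The main inequality with [new_count] gives c < 2 i, and with [sum_degC] it gives i at most 4, so
    c is at most 7. Parity in [new_count] and [owned_half] leaves the two cases listed. *)
Lemma main_cases : exists z z', [/\ z != z', Z = [set z; z'] &
  (#|I| = 4 /\ c = 6 /\ #|kappa| = 0 /\ #|N z| = 1) \/
  (#|I| = 3 /\ c = 5 /\ #|N z| = 1 /\ #|N z'| = 1 /\
   20 <= \sum_(x in Cs) deg Cs x)].
Proof.
have [z [z' [zz EZ Es]]] := sum_Z2 (fun z => 2 * #|N z|).
exists z, z'; split=> //.
have zC : z \notin C by rewrite -in_petals EZ !inE eqxx.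
have zC' : z' \notin C by rewrite -in_petals EZ !inE eqxx orbT.
have h0 := main_c; rewrite Es cardZ2 in h0.
have h1 := sum_deg_Cs rC; have h2 := sum_degC.
have h3 := new_count zC; have h4 := new_count zC'.
have h5 := owned_half card13 lin rC zC; have h6 := owned_half card13 lin rC zC'.
have h7 : #|J z| + #|J z'| = #|I|.
  by rewrite -(sum_owned card13 rC) EZ big_setU1 ?inE //= big_set1.
have h8 := rcyc_size rC; rewrite sC in h1 h3 h4 h5 h6 h8.
have h9 : #|kappa| <= c.
  by apply: leq_trans cardI_le; apply: subset_leq_card; apply/subsetP => t; rewrite inE => /andP[].
move: h0 h1 h2 h3 h4 h5 h6 h7 h8 h9; rewrite -subn1.
move: (\sum_(x in Cs) _) #|I| #|N z| #|N z'| #|kappa| #|J z| #|J z'|.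
clear => s i n n' kp j j' h0 h1 h2 h3 h4 h5 h6 h7 h8 h9.
have e1 : c * (c - 1) = c * c - c by rewrite mulnBr muln1.
have e2 : i * (i - 1) = i * i - i by rewrite mulnBr muln1.
have e3 : c * (c + 2) = c * c + 2 * c by rewrite mulnDr; lia.
have e4 : i * i >= i by nia.
have e5 : c * c >= c by nia.
have hi : i <= 4.
  rewrite leqNgt; apply/negP => i5.
  have : i * i >= 5 * i by nia. lia.
have hc : c <= 7 by lia.
have : i * (i - 1) = 12 /\ i = 4 \/ i * (i - 1) = 6 /\ i = 3 \/ i <= 2 by move: hi; clear; case: i => [|[|[|[|[|i]]]]]; lia.
move=> hi3; clear e1 e2 e3 e4 e5.
move: c hc h0 h1 h2 h3 h4 h5 h6 h8 h9 => [|[|[|[|[|[|[|[|//]]]]]]]] _ h0 h1 h2 h3 h4 h5 h6 h8 h9 //; lia.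
Qed.

Lemma cyc_list v : v \in C -> exists t, [/\ perm_eq (v :: t) C, rainbow (v :: t),
  next (v :: t) =1 next C & last v t = prev C v].
Proof.
move=> vC; have pC : prev C v \in C by rewrite mem_prev.
have [s [[t Es Et] ps rs _ ns]] := cyc_break1 rC pC.
rewrite (next_prev (rcyc_uniq rC)) in Es Et.
by exists t; rewrite -Es.
Qed.

(* The one configuration that survives the degree count for a cycle of length 5
   with two petals. *)
Lemma pentagon z z' v a b d e : z \notin C -> z' \notin C -> z != z' ->
  perm_eq [:: v; a; b; d; e] C -> next [:: v; a; b; d; e] =1 next C ->
  v \in N z -> v \in N z' -> z \in cn C a -> b \in I -> d \in I -> adj a e -> False.
Proof.
move=> zC zC' zz pC nC vN vN' za bI dI ae.
have u : uniq [:: v; a; b; d; e] by rewrite (perm_uniq pC) (rcyc_uniq rC).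
have mC x : x \in [:: v; a; b; d; e] -> x \in C by rewrite (perm_mem pC).
have vC : v \in C by apply: mC; rewrite !inE eqxx.
have aC : a \in C by apply: mC; rewrite !inE eqxx !orbT.
have bC : b \in C by apply: mC; rewrite !inE eqxx !orbT.
have dC : d \in C by apply: mC; rewrite !inE eqxx !orbT.
have eC : e \in C by apply: mC; rewrite !inE eqxx !orbT.
have na : next C a = b.
  by rewrite -nC -[X in next X]/([:: v] ++ [:: a, b & [:: d; e]]) next_mid.
have nb : next C b = d.
  by rewrite -nC -[X in next X]/([:: v; a] ++ [:: b, d & [:: e]]) next_mid.
have nd : next C d = e.
  by rewrite -nC -[X in next X]/([:: v; a; b] ++ [:: d, e & [::]]) next_mid.
have [_ o] := own card13 lin rC aC zC za.
have [_ g1 n1 h1] := in_newnb vN; have [_ g1' n1' h1'] := in_newnb vN'.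
have [cH1 m1 m2 _] := cn_facts card13 rC aC.
have [cH2 m3 m4 _] := cn_facts card13 rC bC.
have [cH3 m5 m6 _] := cn_facts card13 rC dC.
rewrite na in m2; rewrite nb in m4; rewrite nd in m6.
have nw f t : f \notin ccols C -> t \in C -> (f == cn C t) = false.
  by move=> nf tC; apply: contraNF nf => /eqP->; apply: rcyc_cn.
have [w1 w2] := col_mem card13 h1; have [w1' w2'] := col_mem card13 h1'.
have [w3 w4] := col_mem card13 (adj_col ae).
have [y yb yC] := opn_ex bI; have [y' yd yC'] := opn_ex dI.
move: (u); rewrite /= !inE !negb_or.
case/andP=> /and4P[va vb vd ve] /andP[/and3P[ab ad _] /andP[/andP[bd be] /andP[de _]]].
have f12 : (col z' v == col z v) = false.
  apply/negP => /eqP E; have := Z_indep zC zC'; rewrite (adj_edge lin h1 w1) //.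
  by rewrite -E.
have f41 : (col z' v == col a e) = false.
  apply/negP => /eqP E; rewrite E in w1' w2'.
  apply: (no4 card13 (adj_col ae) _ w1' w2' w3 w4).
  by rewrite /= !inE !negb_or ![z' == _]eq_sym !(in_neq _ zC') // va ve (adj_neq ae).
have f42 : (col z v == col a e) = false.
  apply/negP => /eqP E; rewrite E in w1 w2.
  apply: (no4 card13 (adj_col ae) _ w1 w2 w3 w4).
  by rewrite /= !inE !negb_or ![z == _]eq_sym !(in_neq _ zC) // va ve (adj_neq ae).
have f43 : (cn C a == col a e) = false.
  apply/negP => /eqP E; rewrite -E in w3 w4.
  apply: (no4 card13 cH1 _ za m1 m2 w4).
  by rewrite /= !inE !negb_or ![z == _]eq_sym !(in_neq _ zC) // ab be (adj_neq ae).
have f45 : (col a e == cn C d) = false.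
  apply/negP => /eqP E; rewrite E in w3 w4.
  apply: (no4 card13 cH3 _ yd w3 m5 m6).
  by rewrite /= !inE !negb_or ![y' == _]eq_sym !(in_neq _ yC') // ad de (adj_neq ae).
have f46 : (col a e == cn C b) = false.
  apply/negP => /eqP E; rewrite E in w3 w4.
  apply: (no4 card13 cH2 _ yb w3 m3 m4).
  by rewrite /= !inE !negb_or ![y == _]eq_sym !(in_neq _ yC) // ab ad bd.
have cinj x y0 : x \in C -> y0 \in C -> x != y0 -> (cn C x == cn C y0) = false.
  by move=> xC y0C; apply: contraNF => /eqP/(cn_inj rC xC y0C)->.
(* Both petals enter at [v], then [z] continues to [a] on the edge leaving [a], and the chord to [e]
   leads back through [d] to [b]. These are seven vertices, where six are the maximum. *)
have rp : rainbow [:: z'; v; z; a; e; d; b].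
  have Ec : cols [:: z'; v; z; a; e; d; b] =
     [:: col z' v; col z v; cn C a; col a e; cn C d; cn C b].
    by rewrite /= (colC _ v) (colC _ z a) o (colC _ e) (colC _ d b) /cn nb nd.
  apply: rainbow_intro; rewrite ?Ec.
  - rewrite /= !inE !negb_or ![z' == _]eq_sym zz ![z == _]eq_sym !(in_neq _ zC') // !(in_neq _ zC) //.
    by rewrite va vb vd ve ab ad (adj_neq ae) ![e == _]eq_sym be de eq_sym bd.
  - by move=> f; rewrite !inE => /or4P[|||/or3P[]] /eqP-> //; apply: adj_col.
  - rewrite /= !inE !negb_or f12 f41 f42 f43 f45 f46 !(nw _ _ n1) // !(nw _ _ n1') // !cinj //.
    by rewrite eq_sym.
by apply: (nolong rp); rewrite sC; move: (perm_size pC); rewrite sC => <-.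
Qed.

(** Five degrees of at most 4 with sum at least 20 all attain the bound. *)
Lemma complete_adj a e : a \in C -> e \in C -> a != e -> c = 5 ->
  20 <= \sum_(x in Cs) deg Cs x -> adj a e.
Proof.
move=> aC eC ae c5; rewrite (bigD1 a) ?inE //=.
have : \sum_(x in Cs | x != a) deg Cs x <= \sum_(x in Cs | x != a) 4.
  by apply: leq_sum => x /andP[]; rewrite inE => /(deg_Cs rC); rewrite sC c5.
rewrite sum_nat_const.
have -> : #|[pred x | (x \in Cs) && (x != a)]| = 4.
  have := cardsD1 a Cs; rewrite inE aC (card_cyc rC) sC c5 => -[->].
  by apply: eq_card => x; rewrite !inE andbC.
move=> h1 h2; apply/negPn/negP => nae.
have : nb H Cs a \subset (Cs :\ a) :\ e.
  apply/subsetP => x; rewrite [x \in nb _ _ _]inE => /andP[xC ax].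
  rewrite !in_setD1 xC andbT [x == a]eq_sym (adj_neq ax) andbT.
  by apply: contraNneq nae => <-.
move/subset_leq_card; rewrite -/(deg Cs a).
have := cardsD1 a Cs; have := cardsD1 e (Cs :\ a).
rewrite !inE aC eC (eq_sym e) ae (card_cyc rC) sC c5.
have := leq_trans h2 (leq_add (leqnn _) h1).
by move: (deg _ _) #|_ :\ a| #|_ :\ e|; clear; lia.
Qed.

Lemma no_cycle_c : False.
Proof.
have [z [z' [zz EZ [[i4 [c6 [k0 n1]]]|[i3 [c5 [n1 [n1' s20]]]]]]]] := main_cases.
  (* The two edges at [v] are closed, so the four open edges of the hexagon form one run; its last
     edge lies in [kappa], which is empty in this case. *)
  have zC : z \notin C by rewrite -in_petals EZ !inE eqxx.
  have /card_gt0P[v vN] : 0 < #|N z| by rewrite n1.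
  have [vC _ _ _] := in_newnb vN.
  have [vI pI] := new_closed zC vN.
  have [t [pt /rainbow_uniq ut nt lt]] := cyc_list vC.
  have : size (v :: t) = 6 by rewrite (perm_size pt) sC c6.
  case: t pt ut nt lt => [|a [|b [|d [|e [|f [|? ?]]]]]] //= pt ut nt lt _.
  have sub : I \subset [set a; b; d; e].
    apply/subsetP => x xI; have := I_sub xI; rewrite -(perm_mem pt) !inE.
    have -> : (x == v) = false by apply: contraNF vI => /eqP<-.
    have -> : (x == f) = false by rewrite lt; apply: contraNF pI => /eqP<-.
    by rewrite orbF !orbA.
  have /eqP EI : I == [set a; b; d; e].
    rewrite eqEcard sub i4; rewrite !cardsU; apply: leq_trans (leq_subr _ _) _.
    apply: leq_trans (leq_add (leq_trans (leq_subr _ _) (leq_add (leq_subr _ _) (leqnn _))) (leqnn _)) _.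
    by rewrite !cards1.
  have eI : e \in I by rewrite EI !inE eqxx !orbT.
  have ek : e \in kappa.
    rewrite inE eI /= -nt; suff -> : next [:: v; a; b; d; e; f] e = f by rewrite lt.
    by rewrite -[X in next X]/([:: v; a; b; d] ++ [:: e; f]) next_mid.
  by move/eqP: k0; rewrite cards_eq0 => /eqP k0; rewrite k0 inE in ek.
have zC : z \notin C by rewrite -in_petals EZ !inE eqxx.
have zC' : z' \notin C by rewrite -in_petals EZ !inE eqxx orbT.
have /card_gt0P[v vN] : 0 < #|N z| by rewrite n1.
have [vC _ _ _] := in_newnb vN.
have [vI pI] := new_closed zC vN.
have [t [pt /rainbow_uniq ut nt lt]] := cyc_list vC.
have : size (v :: t) = 5 by rewrite (perm_size pt) sC c5.
case: t pt ut nt lt => [|a [|b [|d [|e [|? ?]]]]] // pt ut nt lt _.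
rewrite [last _ _]/= in lt.
have sub : I \subset [set a; b; d].
  apply/subsetP => x xI; have := I_sub xI; rewrite -(perm_mem pt) !inE.
  have -> : (x == v) = false by apply: contraNF vI => /eqP<-.
  have -> : (x == e) = false by rewrite lt; apply: contraNF pI => /eqP<-.
  by rewrite orbF !orbA.
have EI : I = [set a; b; d].
  apply/eqP; rewrite eqEcard sub i3; rewrite !cardsU !cards1.
  by apply: leq_trans (leq_subr _ _) _; rewrite -[3]/(2 + 1) leq_add2r leq_subr.
have aI : a \in I by rewrite EI !inE eqxx.
have bI : b \in I by rewrite EI !inE eqxx orbT.
have dI : d \in I by rewrite EI !inE eqxx orbT.
have nd : next C d = e.
  by rewrite -nt -[X in next X]/([:: v; a; b] ++ [:: d, e & [::]]) next_mid.
have /card_gt0P[v' vN'] : 0 < #|N z'| by rewrite n1'.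
have [vC' _ _ _] := in_newnb vN'.
have [vI' pI'] := new_closed zC' vN'.
(* Every cycle vertex other than [v] is an end of an open edge, which [new_closed] forbids for a new
   neighbour. *)
have E : v' = v.
  move: vC'; rewrite -(perm_mem pt) !inE => /or4P[/eqP//|/eqP h|/eqP h|/orP[]/eqP h];
    rewrite h ?aI ?bI ?dI // in vI' pI'.
  by rewrite -nd (prev_next (rcyc_uniq rC)) dI in pI'.
rewrite {}E in vN'.
have mC x : x \in [:: v; a; b; d; e] -> x \in C by rewrite (perm_mem pt).
have ae : adj a e.
  apply: complete_adj => //; try by apply: mC; rewrite !inE eqxx !orbT.
  by move: ut; rewrite /= !inE !negb_or => /and3P[_ /and3P[]].
have [y ya yC] := opn_ex aI.
have : y \in Z by rewrite in_petals.
rewrite EZ !inE => /orP[]/eqP E; rewrite E in ya.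
  exact: (pentagon zC zC' zz pt nt vN vN' ya bI dI ae).
by apply: (pentagon zC' zC _ pt nt vN' vN ya bI dI ae); rewrite eq_sym.
Qed.
End CycleOfMaxLength.
End LongCycles.

(** * Covering cycles of length [c.-1] *)

Section CycleF.
Variables (V : finType) (H : {set {set V}}).
Notation col := (col H). Notation cols := (cols H). Notation ccols := (ccols H).
Notation rainbow := (rainbow H). Notation rcyc := (rcyc H). Notation cn := (cn H).
Notation adj := (adj H). Notation deg := (deg H). Notation D := (deg setT).
Notation UC := (UC H). Notation U := (U H). Notation opn := (opn H).

Hypothesis card13 : forall e, e \in H -> 0 < #|e| <= 3.
Hypothesis lin : linear_hg H.

Section F.
Variable C : seq V.
Hypothesis rC : rcyc C.
Hypothesis nocyc1 : forall E, rcyc E -> size E != (size C).+1.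
Hypothesis nocyc2 : forall E, rcyc E -> size E != (size C).+2.
Hypothesis nolong : forall p, rainbow p -> size p != (size C).+3.
Notation Z := (petals C). Notation I := (opens H C).
Notation N := (newnb H C). Notation J := (owned H C).

Lemma new_cn f t : f \notin ccols C -> t \in C -> (f == cn C t) = false.
Proof. by move=> nf tC; apply: contraNF nf => /eqP->; apply: rcyc_cn. Qed.

Lemma cn_neq x y : x \in C -> y \in C -> x != y -> (cn C x == cn C y) = false.
Proof. by move=> xC yC; apply: contraNF => /eqP/(cn_inj rC xC yC)->. Qed.

Lemma opens_sub v : v \in I -> v \in C. Proof. by rewrite inE => /andP[]. Qed.

(** Otherwise [z1], [z2], [z3] and the cycle opened at the edge containing [z3] form a path that is
    too long. *)
Lemma petal_path3 z1 z2 z3 t : z1 \notin C -> z2 \notin C -> z3 \notin C ->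
  t \in C -> z3 \in cn C t -> adj z1 z2 -> adj z2 z3 -> col z1 z2 = col z2 z3.
Proof.
move=> zC1 zC2 zC3 tC zt a12 a23; apply/eqP/negPn/negP => ne.
have z13 : z1 != z3 by apply: contraNneq ne => ->; rewrite colC.
have [o1 _] := own card13 lin rC tC zC3 zt.
have n1 := new_edge_Z card13 rC zC1 zC2 a12; have n2 := new_edge_Z card13 rC zC2 zC3 a23.
have [] := @ear_path _ H C t [:: z1; z2; z3] [::] rC tC.
- by rewrite /= !inE negb_or (adj_neq a12) z13 (adj_neq a23).
- by move=> x; rewrite !inE => /or3P[]/eqP->.
- by rewrite /= o1 !inE negb_or ne !new_cn.
- move=> l; rewrite /= o1 !inE => /or3P[]/eqP->; rewrite /fresh ?eqxx ?(cn_H card13 rC) //.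
    by rewrite (adj_col a12) n1 !orbT.
  by rewrite (adj_col a23) n2 !orbT.
by move=> p [/nolong rp sp _ _]; rewrite sp addn0 addnC addn3 eqxx in rp.
Qed.

(** If the edge leaving [v] had petal [z2], the cycle could be enlarged by [z1] and [z2]. Any other
    petal could precede the opened cycle, with [z1] and [z2] following it. *)
Lemma adj_new_closed z1 z2 v : z1 \notin C -> z2 \notin C -> adj z1 z2 ->
  v \in N z1 -> col z1 v != col z1 z2 -> v \notin I.
Proof.
move=> zC1 zC2 a vN ne; apply/negP => /opn_ex[y yv yC].
have [vC g n h] := in_newnb vN; have [nz _] := new_not_owned card13 lin rC zC1 vN.
have [o1 _] := own card13 lin rC vC yC yv.
have n2 := new_edge_Z card13 rC zC1 zC2 a.
have yz1 : y != z1 by apply: contraNneq nz => <-.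
have [E|yz2] := eqVneq y z2.
  rewrite E in o1; have [] := @ear_cycle _ H C v [:: z1; z2] rC vC.
  - by [].
  - by rewrite /= inE (adj_neq a).
  - by move=> x; rewrite !inE => /orP[]/eqP->.
  - by rewrite /= o1 !inE negb_or !(colC _ v) ne !new_cn.
  - move=> l; rewrite /= o1 !(colC _ v) !inE => /or3P[]/eqP->; rewrite /fresh ?eqxx ?(cn_H card13 rC) //.
      by rewrite h n !orbT.
    by rewrite (adj_col a) n2 !orbT.
  by move=> E0 rE [sE _]; have := nocyc2 rE; rewrite sE addn2 eqxx.
have [] := @ear_path _ H C v [:: y] [:: z1; z2] rC vC.
- by rewrite /= !inE negb_or yz1 yz2 (adj_neq a).
- by move=> x; rewrite !inE => /or3P[]/eqP->.
- by rewrite /= o1 !inE negb_or !(colC _ v) ![cn C v == _]eq_sym ne !new_cn.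
- move=> l; rewrite /= o1 !(colC _ v) !inE => /or3P[]/eqP->; rewrite /fresh ?eqxx ?(cn_H card13 rC) //.
    by rewrite h n !orbT.
  by rewrite (adj_col a) n2 !orbT.
by move=> p [/nolong rp sp _ _]; rewrite sp add1n addn2 eqxx in rp.
Qed.

(** Path: [z3], [y], the cycle opened at the edge leaving [v], then [z]. *)
Lemma owner_nbr z v y z3 : z \notin C -> v \in N z -> y \in cn C v -> y \notin C ->
  z3 \notin C -> adj y z3 -> z3 = z.
Proof.
move=> zC vN yv yC zC3 a; apply/eqP/negPn/negP => zz3.
have [vC g n h] := in_newnb vN; have [nz _] := new_not_owned card13 lin rC zC vN.
have [o1 _] := own card13 lin rC vC yC yv.
have n2 := new_edge_Z card13 rC yC zC3 a.
have yz1 : y != z by apply: contraNneq nz => <-.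
have ne : (col y z3 == col z v) = false.
  apply/negP => /eqP E; have [m1 m2] := col_mem card13 h.
  have [m3 m4] := col_mem card13 (adj_col a); rewrite E in m3 m4.
  apply: (no4 card13 h _ m1 m2 m3 m4).
  rewrite /= !inE !negb_or (adj_neq a) (adj_neq g) (eq_sym z) yz1 (eq_sym z) zz3.
  by rewrite !(in_neq vC).
have [] := @ear_path _ H C v [:: z3; y] [:: z] rC vC.
- by rewrite /= !inE negb_or eq_sym (adj_neq a) zz3 yz1.
- by move=> x; rewrite !inE => /or3P[]/eqP->.
- by rewrite /= o1 !inE negb_or (colC _ v) (colC _ z3) ne [cn C v == _]eq_sym !new_cn.
- move=> l; rewrite /= o1 (colC _ v) (colC _ z3) !inE => /or3P[]/eqP->; rewrite /fresh ?eqxx ?(cn_H card13 rC) //.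
    by rewrite (adj_col a) n2 !orbT.
  by rewrite h n !orbT.
by move=> p [/nolong rp sp _ _]; rewrite sp addn1 add2n eqxx in rp.
Qed.

Section Pair.
Variables z z' v : V.
Hypothesis zC : z \notin C.
Hypothesis zC' : z' \notin C.
Hypothesis vN : v \in N z.
Hypothesis zv' : z' \in cn C v.

Lemma new_petal_neq : z != z'.
Proof.
by have [nz _] := new_not_owned card13 lin rC zC vN; apply: contraNneq nz => ->.
Qed.

Lemma owner_notin_new_edge : z' \notin col z v.
Proof.
apply/negP => ze; have [vC g n h] := in_newnb vN; have [m1 m2] := col_mem card13 h.
have vz : v != z' by rewrite (in_neq vC).
have E := edges_share1 lin h (cn_H card13 rC vC) vz m2 ze (cn_mem card13 rC vC) zv'.
by rewrite E rcyc_cn in n.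
Qed.

Lemma new_edge_neq b : b \in N z' -> (col z v == col z' b) = false.
Proof.
move/in_newnb=> [_ _ _ h]; apply: contraNF owner_notin_new_edge => /eqP->.
by case: (col_mem card13 h).
Qed.

(** From [next C v] to [a], through [z] to [v], back to [next C a] and home through [z']: a cycle
    with two more vertices. *)
Lemma pair_no_double_ear a : a \in N z -> a != v -> col z a != col z v -> next C a \in N z' -> False.
Proof.
move=> aN av ne bN; have [vC g n h] := in_newnb vN.
have [aC ga na ha] := in_newnb aN; have [bC gb nb hb] := in_newnb bN.
have [o1 _] := own card13 lin rC vC zC' zv'.
have [cHa a1 a2 a3] := cn_facts card13 rC aC.
have ne2 : (col z a == col z' (next C a)) = false.
  apply/negP => /eqP E; have [m1 m2] := col_mem card13 ha.
  have [m3 m4] := col_mem card13 hb; rewrite -E in m3 m4.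
  apply: (no4 card13 ha _ m1 m2 m3 m4).
  by rewrite /= !inE !negb_or (adj_neq ga) new_petal_neq a3 (eq_sym z) !(in_neq bC) // !(in_neq aC) // eq_sym (in_neq bC).
have [] := @chord_cycle _ H C v a [:: z] [:: z'] rC vC aC av.
- by rewrite /= inE new_petal_neq.
- by move=> x; rewrite !inE => /orP[]/eqP->.
- by rewrite /= o1 (colC _ a) (colC _ _ z') !inE !negb_or ne ne2 new_edge_neq // !new_cn.
- move=> l; rewrite /= o1 (colC _ a) (colC _ _ z') !inE => /or4P[]/eqP->;
    rewrite /fresh ?eqxx ?(cn_H card13 rC) // ?ha ?h ?hb ?na ?n ?nb ?orbT //.
by move=> E rE sE; have := nocyc2 rE; rewrite sE addn2 eqxx.
Qed.

(** If the petal of the edge leaving [a] is [z'], it closes the longer cycle; if it is a third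
    petal, it becomes an end of a path that is too long. *)
Lemma pair_new_closed a : a \in N z -> a != v -> col z a != col z v -> a \notin I.
Proof.
move=> aN av ne; apply/negP => /opn_ex[y ya yC]; have [vC g n h] := in_newnb vN.
have [aC ga na ha] := in_newnb aN.
have [o1 _] := own card13 lin rC vC zC' zv'.
have [o3 _] := own card13 lin rC aC yC ya.
have [nz _] := new_not_owned card13 lin rC zC aN.
have yz : y != z by apply: contraNneq nz => <-.
have av' : v != a by rewrite eq_sym.
have [E|yz'] := eqVneq y z'.
  rewrite E in o3; have [] := @chord_cycle _ H C v a [:: z] [:: z'] rC vC aC av.
  - by rewrite /= inE new_petal_neq.
  - by move=> x; rewrite !inE => /orP[]/eqP->.
  - rewrite /= o1 (colC _ a) (colC _ _ z') o3 !inE !negb_or ne.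
    by rewrite !(new_cn na) // !(new_cn n) // cn_neq.
  - move=> l; rewrite /= o1 (colC _ a) (colC _ _ z') o3 !inE => /or4P[]/eqP->;
      rewrite /fresh ?eqxx ?(cn_H card13 rC) // ?ha ?h ?na ?n ?orbT //.
  by move=> E0 rE sE; have := nocyc2 rE; rewrite sE addn2 eqxx.
have [] := @chord_path _ H C v a [:: z'] [:: z] [:: y] rC vC aC av.
- by rewrite /= !inE negb_or (eq_sym z') new_petal_neq (eq_sym z') yz' eq_sym yz.
- by move=> x; rewrite !inE => /or3P[]/eqP->.
- rewrite /= o1 (colC _ a) (colC _ _ y) o3 !inE !negb_or ![cn C v == col _ _]eq_sym ne.
  by rewrite !(new_cn na) // !(new_cn n) // cn_neq.
- move=> l; rewrite /= o1 (colC _ a) (colC _ _ y) o3 !inE => /or4P[]/eqP->;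
    rewrite /fresh ?eqxx ?(cn_H card13 rC) // ?ha ?h ?na ?n ?orbT //.
by move=> p /nolong rp sp; rewrite sp addn3 eqxx in rp.
Qed.

Lemma pair_prev_closed a : a \in C -> a != v -> next C a \in N z' -> a \notin I.
Proof.
move=> aC av bN; apply/negP => /opn_ex[y ya yC]; have [vC g n h] := in_newnb vN.
have [bC gb nb hb] := in_newnb bN.
have [o1 _] := own card13 lin rC vC zC' zv'.
have [_ o4] := own card13 lin rC aC yC ya.
have [_] := new_not_owned card13 lin rC zC' bN.
rewrite (prev_nextC rC) => nz.
have yz : y != z' by apply: contraNneq nz => <-.
have av' : v != a by rewrite eq_sym.
have nE := new_edge_neq bN.
have [E|yz'] := eqVneq y z.
  rewrite E in o4; have [] := @chord_cycle _ H C v a [:: z] [:: z'] rC vC aC av.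
  - by rewrite /= inE new_petal_neq.
  - by move=> x; rewrite !inE => /orP[]/eqP->.
  - rewrite /= o1 o4 (colC _ _ z') !inE !negb_or ![cn C a == col _ _]eq_sym nE.
    by rewrite !(new_cn nb) // !(new_cn n) // cn_neq.
  - move=> l; rewrite /= o1 o4 (colC _ _ z') !inE => /or4P[]/eqP->;
      rewrite /fresh ?eqxx ?(cn_H card13 rC) // ?hb ?h ?nb ?n ?orbT //.
  by move=> E0 rE sE; have := nocyc2 rE; rewrite sE addn2 eqxx.
have [] := @chord_path' _ H C v a [:: y] [:: z'] [:: z] rC vC aC av.
- by rewrite /= !inE negb_or yz yz' eq_sym new_petal_neq.
- by move=> x; rewrite !inE => /or3P[]/eqP->.
- rewrite /= (colC _ (next C v)) o1 (colC _ y) o4 (colC _ v) !inE !negb_or.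
  rewrite ![cn C a == col _ _]eq_sym ![cn C v == col _ _]eq_sym [col z' _ == col z v]eq_sym nE.
  by rewrite !(new_cn nb) // !(new_cn n) // cn_neq.
- move=> l; rewrite /= (colC _ (next C v)) o1 (colC _ y) o4 (colC _ v) !inE => /or4P[]/eqP->;
    rewrite /fresh ?eqxx ?(cn_H card13 rC) // ?hb ?h ?nb ?n ?orbT //.
by move=> p /nolong rp sp; rewrite sp addn3 eqxx in rp.
Qed.

(** Three disjoint families avoid [v]: new neighbours of [z] off the edge [col z v], predecessors of
    new neighbours of [z'], and open edges other than that of [v]. The edge [col z v] can hide at
    most two new neighbours of [z], hence the excess 2. *)
Lemma pair_count : v \in I -> #|N z| + #|N z'| + #|I| <= (size C).+2.
Proof.
move=> vI; have [vC g n h] := in_newnb vN.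
pose A := [set a in N z | (a != v) && (col z a != col z v)].
pose B := [set prev C b | b in N z'].
have cB : #|B| = #|N z'|.
  by apply: card_imset; apply: can_inj (next_prev (rcyc_uniq rC)).
have B_ex a : a \in B -> [/\ a \in C, a != v & next C a \in N z'].
  case/imsetP => b bN ->; have [bC _ _ _] := in_newnb bN.
  rewrite mem_prev (next_prevC rC); split=> //; apply/eqP => E.
  by apply: (new_notin_cn card13 lin rC zC' bN vC zv'); rewrite -[b](next_prevC rC) E (cn_memn card13 rC).
have cA : #|N z| <= #|A| + 2.
  have sub : N z \subset A :|: (col z v :\ z).
    apply/subsetP => a aN; rewrite in_setU [a \in A]inE aN /= in_setD1.
    have [aC ga na ha] := in_newnb aN; have [m1 m2] := col_mem card13 ha.
    have [m3 m4] := col_mem card13 h.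
    have [->|_] := eqVneq a v; first by rewrite m4 eq_sym (adj_neq g) orbT.
    by have [<-|_] := eqVneq (col z a) (col z v); rewrite //= m2 eq_sym (adj_neq ga).
  apply: leq_trans (subset_leq_card sub) _; rewrite cardsU.
  apply: leq_trans (leq_subr _ _) _; rewrite leq_add2l.
  have := cardsD1 z (col z v); have [-> _] := col_mem card13 h.
  by have := card13 h; clear; lia.
have dAB : [disjoint A & B].
  apply/pred0P => a /=; apply/negP => /andP[]; rewrite inE => /and3P[a1 a2 a3].
  by case/B_ex => _ _; apply: pair_no_double_ear.
have dABI : [disjoint A :|: B & I :\ v].
  apply/pred0P => a /=; apply/negP => /andP[]; rewrite in_setU in_setD1 => h1 /andP[_ aI].
  case/orP: h1 => [|/B_ex[a1 a2 a3]]; last by rewrite (negPf (pair_prev_closed a1 a2 a3)) in aI.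
  by rewrite inE => /and3P[a1 a2 a3]; rewrite (negPf (pair_new_closed a1 a2 a3)) in aI.
have : #|(A :|: B) :|: (I :\ v)| <= #|[set x in C] :\ v|.
  apply: subset_leq_card; apply/subsetP => a; rewrite !in_setU in_setD1 => h1.
  rewrite in_setD1 [a \in [set _ in _]]inE; case/orP: h1 => [/orP[|/B_ex[-> -> //]]|/andP[-> /opens_sub->//]].
  by rewrite inE => /and3P[/in_newnb[-> _ _ _] -> _].
rewrite cardsU (disjoint_setI0 dABI) cardsU (disjoint_setI0 dAB) !cards0 cB.
have := cardsD1 v I; rewrite vI; have := cardsD1 v [set x in C].
rewrite inE vC (card_cyc rC); move: cA; clear.
by move: #|N z| #|A| #|N z'| #|I| #|I :\ v| #|_ :\ v| (size C); clear; lia.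
Qed.
End Pair.
End F.
Section FR.
Variable C : seq V.
Hypothesis rC : rcyc C.
Hypothesis nocyc1 : forall E, rcyc E -> size E != (size C).+1.
Hypothesis nocyc2 : forall E, rcyc E -> size E != (size C).+2.
Hypothesis nolong : forall p, rainbow p -> size p != (size C).+3.
Hypothesis cov : UC C = setT.
Notation Cs := [set x in C].
Notation Z := (petals C). Notation I := (opens H C).
Notation N := (newnb H C). Notation J := (owned H C).

Let rCr : rcyc (rev C). Proof. exact: rcyc_rev. Qed.
Let nocyc2r E : rcyc E -> size E != (size (rev C)).+2.
Proof. by rewrite size_rev; apply: nocyc2. Qed.
Let nolongr p : rainbow p -> size p != (size (rev C)).+3.
Proof. by rewrite size_rev; apply: nolong. Qed.

Lemma adj_new_closed2 z1 z2 v : z1 \notin C -> z2 \notin C -> adj z1 z2 ->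
  v \in N z1 -> col z1 v != col z1 z2 -> v \notin I /\ prev C v \notin I.
Proof.
move=> zC1 zC2 a vN ne; split; first exact: adj_new_closed zC1 zC2 a vN ne.
rewrite -mem_opens_rev //.
by apply: (adj_new_closed rCr nocyc2r nolongr _ _ a); rewrite ?mem_rev ?newnb_rev.
Qed.

Lemma owner_nbr2 z v y z3 : z \notin C -> v \in N z ->
  (y \in cn C v) || (y \in cn C (prev C v)) -> y \notin C ->
  z3 \notin C -> adj y z3 -> z3 = z.
Proof.
move=> zC vN /orP[yv|yv] yC zC3 a; first exact: (owner_nbr rC nolong zC vN yv yC zC3 a).
apply: (@owner_nbr (rev C) rCr nolongr z v y z3) => //; rewrite ?mem_rev ?newnb_rev //.
by rewrite cn_rev.
Qed.

Lemma opens_rev_card : #|opens H (rev C)| = #|I|.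
Proof.
have -> : opens H (rev C) = [set next C v | v in I].
  apply/setP => v; rewrite mem_opens_rev //; apply/idP/imsetP => [vI|[u uI ->]].
    by exists (prev C v); rewrite // (next_prevC rC).
  by rewrite (prev_nextC rC).
by apply: card_imset; apply: can_inj (prev_next (rcyc_uniq rC)).
Qed.

Lemma pair_count2 z z' v : z \notin C -> z' \notin C -> v \in N z ->
  (z' \in cn C v) || (z' \in cn C (prev C v)) ->
  #|N z| + #|N z'| + #|I| <= (size C).+2.
Proof.
move=> zC zC' vN; have [vC _ _ _] := in_newnb vN.
case/orP=> zv.
  apply: (pair_count rC nocyc2 nolong zC zC' vN zv); rewrite inE vC /=.
  by apply/subsetPn; exists z'.
have := @pair_count (rev C) rCr nocyc2r nolongr z z' v.
rewrite !mem_rev !newnb_rev cn_rev // opens_rev_card size_rev; apply=> //.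
rewrite mem_opens_rev // inE mem_prev vC; by apply/subsetPn; exists z'.
Qed.

Lemma petal_adj_edge z1 z2 z3 : z1 \notin C -> z2 \notin C -> z3 \notin C ->
  adj z1 z2 -> adj z2 z3 -> col z1 z2 = col z2 z3.
Proof.
move=> zC1 zC2 zC3 a12 a23; have [t tC zt] := petal_own rC cov zC3.
exact: (petal_path3 rC nolong zC1 zC2 zC3 tC zt a12 a23).
Qed.

Lemma new_cons z v : z \notin C -> v \in N z -> next C v \notin N z.
Proof. exact: (new_nonconsec card13 lin rC nocyc1). Qed.

Lemma owned_gt0 z : z \notin C -> 0 < #|J z|.
Proof.
by move=> zC; have [t tC zt] := petal_own rC cov zC; apply/card_gt0P; exists t; rewrite inE tC.
Qed.

Lemma N_owned z : z \notin C -> 2 * #|N z| < size C.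
Proof.
move=> zC; have := owned_gt0 zC.
suff : 2 * #|N z| + #|J z| <= size C by clear; lia.
apply: (disjoint_count rC); [exact: newnb_sub|by move=> v; rewrite inE => /andP[]| |].
  by move=> v; apply: new_cons.
move=> v vN; have [/negPf h1 /negPf h2] := new_not_owned card13 lin rC zC vN.
by rewrite !inE h1 h2 !andbF.
Qed.

Lemma opens_C : {subset I <= C}. Proof. by move=> v; rewrite inE => /andP[]. Qed.

Lemma cardI_le_size : #|I| <= size C.
Proof.
rewrite -(card_cyc rC); apply: subset_leq_card; apply/subsetP => v /opens_C.
by rewrite inE.
Qed.

(** The petals adjacent to [z] and its new neighbours on the edge [e] share the two places of [e]
    beside [z]. The remaining new neighbours touch no open edge, so [disjoint_count] applies to
    them. *)
Lemma score_adj z z2 : z \notin C -> z2 \notin C -> adj z z2 ->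
  2 * #|N z| + 2 * deg Z z + #|I| <= size C + 4.
Proof.
move=> zC zC2 a; pose e := col z z2; have [m1 m2] := col_mem card13 (adj_col a).
pose M := [set v in N z | col z v != e].
have hM : 2 * #|M| + #|I| <= size C.
  apply: (disjoint_count rC); [|exact: opens_C| |].
  - by move=> v; rewrite inE => /andP[/newnb_sub].
  - move=> v; rewrite inE => /andP[vN _]; rewrite inE negb_and.
    by rewrite new_cons.
  - by move=> v; rewrite inE => /andP[vN ne]; apply: (adj_new_closed2 zC zC2 a vN ne).
pose B := [set v in N z | col z v == e].
have cN : #|N z| = #|M| + #|B|.
  rewrite -(cardsID [set v | col z v != e] (N z)); congr (_ + _); apply: eq_card => v.
    by rewrite !inE.
  by rewrite in_setD [in RHS]inE [v \in [set _ | _]]inE negbK andbC.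
have hB : #|B| + deg Z z <= 2.
  have dB : [disjoint B & nb H Z z].
    apply/pred0P => v /=; apply/negP => /andP[]; rewrite inE => /andP[/newnb_sub vC _].
    by rewrite inE in_petals vC.
  have sub : B :|: nb H Z z \subset e :\ z.
    apply/subsetP => v; rewrite in_setU in_setD1 => /orP[].
      rewrite inE => /andP[/in_newnb[_ g _ h] /eqP <-].
      by have [_ ->] := col_mem card13 h; rewrite eq_sym (adj_neq g).
    rewrite inE in_petals => /andP[vC g]; rewrite eq_sym (adj_neq g) /=.
    have [_ h] := col_mem card13 (adj_col g).
    have g' : adj v z by rewrite adjC.
    by rewrite /e -(petal_adj_edge vC zC zC2 g' a) colC.
  move/subset_leq_card: sub; rewrite cardsU (disjoint_setI0 dB) cards0 subn0.
  have := cardsD1 z e; rewrite m1 -/(deg Z z); have := card13 (adj_col a).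
  by rewrite -/e; clear; lia.
by move: hM hB; rewrite cN; clear; lia.
Qed.

Lemma all_closed_count z : z \notin C ->
  (forall v, v \in N z -> v \notin I /\ prev C v \notin I) -> 2 * #|N z| + #|I| <= size C.
Proof.
move=> zC h; apply: (disjoint_count rC); [exact: newnb_sub|exact: opens_C| |exact: h].
by move=> v; apply: new_cons.
Qed.

Lemma degZ_gt0 z : z \notin C -> 0 < deg Z z -> exists2 z2, z2 \notin C & adj z z2.
Proof. by move=> zC /card_gt0P[z2]; rewrite inE in_petals => /andP[]; exists z2. Qed.

Lemma open_owner z v : z \notin C -> v \in N z -> (v \in I) || (prev C v \in I) ->
  exists y, [/\ y \notin C, y != z & (y \in cn C v) || (y \in cn C (prev C v))].
Proof.
move=> zC vN; have [h1 h2] := new_not_owned card13 lin rC zC vN.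
case/orP => /opn_ex[y yv yC]; exists y; split; rewrite ?yv ?orbT //.
  by apply: contraNneq h1 => <-.
by apply: contraNneq h2 => <-.
Qed.

Lemma degZ_le2 z : z \notin C -> deg Z z <= 2.
Proof.
move=> zC; have [->//|h] := posnP (deg Z z); have [z2 zC2 a] := degZ_gt0 zC h.
have [m1 m2] := col_mem card13 (adj_col a).
have sub : nb H Z z \subset col z z2 :\ z.
  apply/subsetP => v; rewrite inE in_petals in_setD1 => /andP[vC g].
  rewrite eq_sym (adj_neq g) /=; have g' : adj v z by rewrite adjC.
  rewrite -(petal_adj_edge vC zC zC2 g' a) colC.
  by case: (col_mem card13 (adj_col g)).
apply: leq_trans (subset_leq_card sub) _.
by have := cardsD1 z (col z z2); rewrite m1; have := card13 (adj_col a); clear; lia.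
Qed.

Lemma cardI_ge : #|Z| <= #|I|.
Proof.
rewrite -(sum_owned card13 rC) -sum1_card; apply: leq_sum => z.
by rewrite in_petals; apply: owned_gt0.
Qed.

Variable k : nat.
Hypothesis dense : (k - 1) * #|V| < \sum_x D x.
Hypothesis sk : (size C).+2 <= k.
Hypothesis q3 : 3 <= #|Z|.
Let m := size C. Let i := #|I|. Let q := #|Z|.
Let s z := 2 * #|N z| + deg Z z.

Lemma score_sum : (m.+1) * (m + q) < m * m.-1 + 4 * i + \sum_(z in Z) s z.
Proof.
have h1 := cov_main card13 dense rC; have h2 := sum_deg_Cs rC.
have h3 : m.+1 * (m + q) <= (k - 1) * (m + q).
  by rewrite leq_mul2r; apply/orP; right; rewrite /m; move: sk; clear; lia.
apply: leq_ltn_trans h3 _; apply: leq_trans h1 _.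
by rewrite -!addnA leq_add2r.
Qed.

Lemma third z1 z2 : z1 \in Z -> z2 \in Z -> z1 != z2 -> q = 3 ->
  exists z3, [/\ z3 \in Z, z3 != z1, z3 != z2, Z = z1 |: (z2 |: [set z3]) &
    forall F : V -> nat, \sum_(z in Z) F z = F z1 + (F z2 + F z3)].
Proof.
move=> z1Z z2Z z12 q3'.
have : #|(Z :\ z1) :\ z2| = 1.
  have := cardsD1 z1 Z; have := cardsD1 z2 (Z :\ z1).
  by rewrite in_setD1 eq_sym z12 z1Z z2Z -/q q3'; clear; lia.
move/eqP/cards1P=> [z3 E]; exists z3.
have : z3 \in (Z :\ z1) :\ z2 by rewrite E inE.
rewrite !in_setD1 => /and3P[z32 z31 z3Z].
have EZ : Z = z1 |: (z2 |: [set z3]).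
  by rewrite -E setD1K ?setD1K // in_setD1 eq_sym z12.
split=> // F; rewrite EZ big_setU1 ?inE /=; last by rewrite negb_or z12 eq_sym.
by rewrite big_setU1 ?inE /= 1?eq_sym // big_set1.
Qed.

(** At most one cycle edge is closed. The three petals are pairwise nonadjacent, or share an edge,
    or form an adjacent pair and a third petal whose score is 0. *)
Lemma small_case : q = 3 -> m <= i.+1 -> (forall z, z \notin C -> 2 * #|N z| <= 3) ->
  \sum_(z in Z) s z <= 6.
Proof.
move=> q3' mi N1.
have hs z : z \notin C -> 0 < deg Z z -> 2 * #|N z| + 2 * deg Z z <= 4.
  move=> zC hz; have [z2 zC2 a] := degZ_gt0 zC hz.
  by have := score_adj zC zC2 a; move: mi; rewrite /m /i; clear; lia.
have [/existsP[z1 /andP[z1Z h1]]|hn] := boolP [exists z, (z \in Z) && (0 < deg Z z)]; last first.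
  apply: leq_trans (_ : \sum_(z in Z) 2 <= _); last by rewrite sum_nat_const -/q q3'.
  apply: leq_sum => z zZ; rewrite /s; move: (zZ); rewrite in_petals => /N1.
  have -> : deg Z z = 0.
    apply/eqP; rewrite -leqn0 leqNgt; apply: contra hn => h.
    by apply/existsP; exists z; rewrite zZ.
  by clear; lia.
have zC1 : z1 \notin C by rewrite -in_petals.
have [z2 zC2 a] := degZ_gt0 zC1 h1.
have z2Z : z2 \in Z by rewrite in_petals.
have [z3 [z3Z z31 z32 EZ ->]] := third z1Z z2Z (adj_neq a) q3'.
have zC3 : z3 \notin C by rewrite -in_petals.
have h2 : 0 < deg Z z2 by apply/card_gt0P; exists z1; rewrite inE z1Z adjC.
have [m1 m2] := col_mem card13 (adj_col a).
have [m3|m3] := boolP (z3 \in col z1 z2).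
  have d2 x y w : x \in Z -> y \in Z -> w \in Z -> x != y -> x != w -> y != w ->
      x \in col z1 z2 -> y \in col z1 z2 -> w \in col z1 z2 -> s x <= 2.
    move=> xZ yZ wZ xy xw yw mx my mw.
    have : 1 < deg Z x.
      apply/card_gt1P; exists y, w; rewrite ![_ \in nb _ _ _]inE yZ wZ yw.
      by rewrite !(adj_edge lin (adj_col a)).
    by rewrite in_petals in xZ; move=> h; have := hs x xZ; rewrite /s; move: h; clear; lia.
  have := d2 z1 z2 z3; have := d2 z2 z1 z3; have := d2 z3 z1 z2.
  rewrite z1Z z2Z z3Z m1 m2 m3 z31 z32 (adj_neq a) (eq_sym z1 z3) (eq_sym z2 z3) z31 z32.
  rewrite (eq_sym z2 z1) (adj_neq a) => /(_ isT isT isT isT isT isT isT isT isT) e3.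
  move=> /(_ isT isT isT isT isT isT isT isT isT) e2.
  move=> /(_ isT isT isT isT isT isT isT isT isT) e1.
  by move: e1 e2 e3; clear; lia.
have a21 : adj z2 z1 by rewrite adjC.
have d3 : deg Z z3 = 0.
  apply/eqP; rewrite -leqn0 leqNgt; apply/negP => /card_gt0P[y]; rewrite inE => /andP[].
  rewrite EZ !inE => /or3P[]/eqP-> g; last by have := adj_neq g; rewrite eqxx.
    have E := petal_adj_edge zC3 zC1 zC2 g a; have [h _] := col_mem card13 (adj_col g).
    by rewrite -E h in m3.
  have E := petal_adj_edge zC3 zC2 zC1 g a21; have [h _] := col_mem card13 (adj_col g).
  by rewrite colC -E h in m3.
(* A new neighbour of [z3] would touch an open edge with petal [z1] or [z2]; by [owner_nbr2] that
   petal could be adjacent to no petal but [z3]. *)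
have n3 : #|N z3| = 0.
  apply/eqP; rewrite -leqn0 leqNgt; apply/negP => /card_gt0P[v vN].
  have [vC g n h] := in_newnb vN.
  have : (v \in I) || (prev C v \in I).
    apply/negPn/negP; rewrite negb_or => /andP[vI pI].
    have : [set v; prev C v] \subset Cs :\: I.
      by apply/subsetP => x; rewrite in_set2 in_setD => /orP[]/eqP->; rewrite ?vI ?pI inE ?mem_prev.
    move/subset_leq_card; rewrite cards2 cardsD (card_cyc rC).
    have -> : v != prev C v.
      have pC : prev C v \in C by rewrite mem_prev.
      by have [_ _ _] := cn_facts card13 rC pC; rewrite (next_prevC rC) eq_sym.
    have -> : Cs :&: I = I by apply/setIidPr/subsetP => x /opens_C; rewrite inE.
    by move: mi; rewrite /m /i; clear; lia.
  move/(open_owner zC3 vN) => [y [yC yz yv]].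
  have : y \in Z by rewrite in_petals.
  rewrite EZ !inE (negPf yz) orbF => /orP[]/eqP E; rewrite E in yC yz yv.
    by have := owner_nbr2 zC3 vN yv yC zC2 a => E2; rewrite E2 eqxx in z32.
  by have := owner_nbr2 zC3 vN yv yC zC1 a21 => E2; rewrite E2 eqxx in z31.
have := hs z1 zC1 h1; have := hs z2 zC2 h2; rewrite /s d3 n3; move: h1 h2; clear; lia.
Qed.

(** If all scores are at most m + 3 - i, the inequality leaves three petals and at most one closed
    edge, the situation of [small_case]. If not, a petal [y] of maximal score has a new neighbour at
    an open edge, and [pair_count2] limits the petal of that edge. *)
Lemma no_cycle_cp : False.
Proof.
have hsum := score_sum; have mI : i <= m := cardI_le_size; have qi : q <= i := cardI_ge.
have m3 : 3 <= m := rcyc_size rC.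
have hadj z : z \notin C -> 0 < deg Z z -> s z + i <= m + 3.
  move=> zC hz; have [z2 zC2 a] := degZ_gt0 zC hz.
  by have := score_adj zC zC2 a; rewrite /s -/m -/i; move: hz; clear; lia.
have [/existsP[z0 /andP[z0Z hz0]]|hn] := boolP [exists z, (z \in Z) && (m + 4 <= s z + i)]; last first.
  have hs z : z \in Z -> s z + i <= m + 3.
    move=> zZ; rewrite leqNgt -addn1 -addnA; apply: contra hn => h.
    by apply/existsP; exists z; rewrite zZ.
  have b : \sum_(z in Z) s z <= q * (m + 3 - i).
    by rewrite -sum_nat_const; apply: leq_sum => z /hs; clear; lia.
  have [q3' mi] : q = 3 /\ (m = i \/ m = i.+1 /\ m = 4).
    move: hsum b mI qi q3 m3; rewrite -/q; move: (\sum_(z in Z) s z) q i m; clear.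
    move=> S q i m h1 h2 h3 h4 h5 h6.
    have [d E] : exists d, m = i + d by exists (m - i); lia.
    have E2 : m + 3 - i = d + 3 by lia.
    rewrite E2 in h2; have [m' Em] : exists m', m = m'.+1 by exists m.-1; lia.
    rewrite Em /= in E E2 h1 h3 h6 *; clear m Em.
    have q4 : q < 4 by rewrite ltnNge; apply/negP => q4; nia.
    have Eq : q = 3 by lia.
    subst q; split=> //; nia.
  have h6 : \sum_(z in Z) s z <= 6.
    apply: small_case => //; first by move: mi; clear; lia.
    move=> z zC; have := hs z; rewrite in_petals => /(_ zC); have := N_owned zC.
    by rewrite /s -/m; move: mi; clear; lia.
  move: hsum h6 mi m3; rewrite q3' -/q; move: (\sum_(z in Z) s z) i m; clear.
  move=> S i m h1 h2 h3 h4; have [m' Em] : exists m', m = m'.+1 by exists m.-1; lia.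
  by rewrite Em /= in h1 h3 h4; clear m Em; nia.
pose y := [arg max_(z > z0 | z \in Z) s z].
have [yZ ymax] : y \in Z /\ forall z, z \in Z -> s z <= s y.
  by rewrite /y; case: arg_maxnP.
have hy : m + 4 <= s y + i by apply: leq_trans hz0 _; rewrite leq_add2r ymax.
have yC : y \notin C by rewrite -in_petals.
have dy : deg Z y = 0.
  apply/eqP; rewrite -leqn0 leqNgt; apply/negP => /(hadj y yC).
  by move: hy; clear; lia.
have [v vN vI] : exists2 v, v \in N y & (v \in I) || (prev C v \in I).
  have [/existsP[v /andP[vN vI]]|hv] := boolP [exists v, (v \in N y) && ((v \in I) || (prev C v \in I))].
    by exists v.
  have : 2 * #|N y| + i <= m; last by move: hy; rewrite /s dy; clear; lia.
  apply: all_closed_count => // v vN; apply/andP; rewrite -negb_or; apply: contra hv => h.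
  by apply/existsP; exists v; rewrite vN.
have [z' [zC' zy zv']] := open_owner yC vN vI.
have zZ' : z' \in Z by rewrite in_petals.
have hp := pair_count2 yC zC' vN zv'; rewrite -/i -/m in hp.
have hd := degZ_le2 zC'; have hN := N_owned yC; rewrite -/m in hN.
have hS : \sum_(z in Z) s z <= s y + (s z' + (q - 2) * s y).
  rewrite (bigD1 y) //= leq_add2l (bigD1 z') /=; last by rewrite zZ'.
  rewrite leq_add2l; apply: leq_trans (_ : \sum_(z in (Z :\ y) :\ z') s y <= _).
    rewrite (eq_bigl [in (Z :\ y) :\ z']); last first.
      by move=> z; rewrite !in_setD1; case: (z \in Z); case: (z == y); case: (z == z').
    by apply: leq_sum => z; rewrite !in_setD1 => /and3P[_ _ /ymax].
  rewrite sum_nat_const leq_mul2r; apply/orP; right.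
  have := cardsD1 y Z; have := cardsD1 z' (Z :\ y).
  by rewrite in_setD1 zy zZ' yZ -/q; clear; lia.
have [q3' [mi x2]] : q = 3 /\ m = i /\ #|N y| = 2.
  move: hS hsum mI qi q3 m3 hy hp hd hN; rewrite /s dy -/q addn0.
  move: (\sum_(z in Z) _) (deg Z z') #|N y| #|N z'| q i m; clear.
  move=> S d x x' q i m h1 h2 h3 h4 h5 h6 h7 h8 h9 h10.
  have [r Er] : exists r, q = r + 2 by exists (q - 2); lia.
  have [mu E] : exists mu, m = i + mu by exists (m - i); lia.
  have E2 : q - 2 = r by lia.
  rewrite E2 in h1; have [m' Em] : exists m', m = m'.+1 by exists m.-1; lia.
  rewrite Em /= in E h2 h3 h6 h7 h8 h10 *; clear m Em.
  have hr : r * (2 * x) <= r * m' by rewrite leq_mul2l; apply/orP; right; lia.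
  have q4 : q < 4.
    rewrite ltnNge; apply/negP => q4; subst q; nia.
  have Eq : q = 3 by lia.
  have Er1 : r = 1 by lia.
  subst q r; split=> //; nia.
(* Every cycle edge is open. The petals of the two edges at [v] are distinct and differ from [y], so
   these three are all the petals; the first two have score 0 and the total of 4 is too small. *)
have IC x : x \in C -> x \in I.
  move=> xC; have /eqP : I == Cs.
    rewrite eqEcard (card_cyc rC) -/m mi leqnn andbT.
    by apply/subsetP => t /opens_C; rewrite inE.
  by move=> ->; rewrite inE.
have [vC _ _ _] := in_newnb vN.
have [y1 yv1 yC1] := opn_ex (IC v vC).
have pC : prev C v \in C by rewrite mem_prev.
have [y2 yv2 yC2] := opn_ex (IC _ pC).
have y12 : y1 != y2.
  have := owned_next card13 lin rC yC2 pC yv2; rewrite (next_prevC rC) => h.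
  by apply: contraNneq h => <-.
have [o1 o2] := new_not_owned card13 lin rC yC vN.
have yy1 : y != y1 by apply: contraNneq o1 => ->.
have yy2 : y2 != y by apply: contraNneq o2 => <-.
have y1Z : y1 \in Z by rewrite in_petals.
have [z3 [z3Z z31 z32 EZ sE]] := third yZ y1Z yy1 q3'.
have E3 : y2 = z3.
  have : y2 \in Z by rewrite in_petals.
  by rewrite EZ !inE (negPf yy2) eq_sym (negPf y12) => /eqP.
have zero y' : y' \notin C -> (y' \in cn C v) || (y' \in cn C (prev C v)) -> s y' = 0.
  move=> yC' yv'; have hp' := pair_count2 yC yC' vN yv'.
  have d0 : deg Z y' = 0.
    apply/eqP; rewrite -leqn0 leqNgt; apply/negP => h; have [w wC g] := degZ_gt0 yC' h.
    have E := owner_nbr2 yC vN yv' yC' wC g; rewrite {}E in g.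
    have : 0 < deg Z y by apply/card_gt0P; exists y'; rewrite inE in_petals yC' adjC.
    by rewrite dy.
  rewrite /s d0; move: hp'; rewrite x2 -/m -/i mi; clear; lia.
have s1 : s y1 = 0 by apply: zero; rewrite ?yv1.
have s2 : s z3 = 0 by rewrite -E3; apply: zero; rewrite ?yv2 ?orbT.
have sy : s y = 4 by rewrite /s dy x2.
move: hsum; rewrite sE s1 s2 sy q3' mi; move: m3; rewrite mi; move: i; clear.
by case=> // i; rewrite /=; nia.
Qed.
End FR.
End CycleF.

(** * Extremal paths *)

Section LongPath.
Variables (V : finType) (H : {set {set V}}).
Notation col := (col H). Notation cols := (cols H). Notation ccols := (ccols H).
Notation rainbow := (rainbow H). Notation rcyc := (rcyc H).
Notation adj := (adj H). Notation deg := (deg H). Notation D := (deg setT).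
Notation UC := (UC H). Notation U := (U H).

Hypothesis card13 : forall e, e \in H -> 0 < #|e| <= 3.
Hypothesis lin : linear_hg H.

Lemma cols_cat a A b c B d : seg a A b -> seg c B d ->
  cols (A ++ B) = cols A ++ col b c :: cols B.
Proof.
move=> sA sB; have := cols_seg H [::] B sA; rewrite /= => ->.
by case: sB => t -> _.
Qed.

(** If the colour of [u], [b] occurs in one piece, its edge has two consecutive vertices there and a
    third one in the other piece, so it is the first edge of that piece. Dropping the first vertex
    frees the colour, and the next vertex can take over because it lies on the same edge. *)
Lemma drop_side u A a b B w : seg u A a -> seg b B w -> uniq (A ++ B) ->
  uniq (cols A ++ cols B) -> adj u b ->
  exists A2 B2 u' b',
  [/\ seg u' A2 a, seg b' B2 w, col u' b' = col u b & col u b \notin cols A2 ++ cols B2] /\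
  [/\ subseq (A2 ++ B2) (A ++ B), subseq (cols A2 ++ cols B2) (cols A ++ cols B),
   {subset cols A ++ cols B <= col u b :: (cols A2 ++ cols B2)},
   forall x, x \in A ++ B -> (x \in A2 ++ B2) || (x \in col u b) &
   [\/ A2 = A /\ B2 = B, [/\ A = u :: A2, B2 = B & b \in col u u'] |
     [/\ A2 = A, B = b :: B2 & u \in col b b']]].
Proof.
move=> sA sB uV uc aub; have [m1 m2] := col_mem card13 (adj_col aub).
have [] := boolP (col u b \in cols A ++ cols B); last first.
  move=> n; exists A, B, u, b; split; first by [].
  split=> //; last by constructor 1.
  - by move=> e h; rewrite inE h orbT.
  - by move=> x ->.
move: uV; rewrite cat_uniq => /and3P[uA /hasPn dAB uB].
have uA' : u \in A by case: (seg_mem sA).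
have bB' : b \in B by case: (seg_mem sB).
have bA : b \notin A by apply: dAB.
have uB' : u \notin B by apply/negP => /dAB; rewrite /= uA'.
rewrite mem_cat => /orP[/mem_cols|/mem_cols] [p1 [x [y [p2 [E ec]]]]].
  have xA : x \in A by rewrite E mem_cat !inE eqxx !orbT.
  have yA : y \in A by rewrite E mem_cat !inE eqxx !orbT.
  have xy : x != y.
    by move: uA; rewrite E cat_uniq => /and3P[_ _ /=]; rewrite inE negb_or => /andP[/andP[]].
  have eH : col x y \in H by rewrite -ec (adj_col aub).
  have [x1 y1] := col_mem card13 eH; rewrite -ec in x1 y1.
  (* Otherwise [u], [b], [x] and [y] are four vertices of one edge. *)
  have p10 : p1 = [::].
    case: p1 E => // u0 p1 E; case: sA => t0 E0 _; move: (E); rewrite E0 => -[eu _].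
    rewrite -eu in E; case: (no4 card13 (adj_col aub) _ m1 m2 x1 y1).
    rewrite /= !inE !negb_or xy ![b == _]eq_sym !(in_neq _ bA) // ?andbT /=.
    move: uA; rewrite E /= mem_cat !inE !negb_or.
    by case/andP=> /andP[_ /and3P[-> -> _]].
  rewrite p10 /= in E; clear p1 p10; have xu : x = u by case: sA => t0 E0 _; move: E0; rewrite E => -[].
  rewrite xu in E ec xA xy eH x1; clear x xu.
  exists (y :: p2), B, y, b; split; first split=> //.
  - case: sA => t0 E0 l0; exists p2 => //; rewrite -l0; move: E0; rewrite E => -[<-].
    by [].
  - by apply: (col_eq lin) => //; [apply: adj_col|rewrite (in_neq yA)].
  - by move: uc; rewrite E /= -ec => /andP[].
  split.
  - by rewrite E; apply: (subseq_cons ((y :: p2) ++ B) u).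
  - by rewrite E; apply: (subseq_cons (cols (y :: p2) ++ cols B) (col u y)).
  - by move=> e; rewrite E /= -ec.
  - move=> z; rewrite E /= inE => /predU1P[->|->//]; by rewrite m1 orbT.
  - by constructor 2; rewrite E -ec.
have xB : x \in B by rewrite E mem_cat !inE eqxx !orbT.
have yB : y \in B by rewrite E mem_cat !inE eqxx !orbT.
have xy : x != y.
  by move: uB; rewrite E cat_uniq => /and3P[_ _ /=]; rewrite inE negb_or => /andP[/andP[]].
have eH : col x y \in H by rewrite -ec (adj_col aub).
have [x1 y1] := col_mem card13 eH; rewrite -ec in x1 y1.
have p10 : p1 = [::].
  case: p1 E => // u0 p1 E; case: sB => t0 E0 _; move: (E); rewrite E0 => -[eu _].
  rewrite -eu in E; case: (no4 card13 (adj_col aub) _ m1 m2 x1 y1).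
  rewrite /= !inE !negb_or xy ![u == _]eq_sym !(in_neq _ uB') // ?andbT /=.
  move: uB; rewrite E /= mem_cat !inE !negb_or.
  by case/andP=> /andP[_ /and3P[-> -> _]].
rewrite p10 /= in E; clear p1 p10; have xu : x = b by case: sB => t0 E0 _; move: E0; rewrite E => -[].
rewrite xu in E ec xB xy eH x1; clear x xu.
exists A, (y :: p2), u, y; split; first split=> //.
- case: sB => t0 E0 l0; exists p2 => //; rewrite -l0; move: E0; rewrite E => -[<-].
  by [].
- by apply: (col_eq lin) => //; [apply: adj_col|rewrite eq_sym (in_neq yB)].
- move: uc; rewrite E uniq_catC -[cols (b :: _)]/(col b y :: cols (y :: p2)) -ec.
  by rewrite cat_cons cons_uniq mem_cat orbC -mem_cat => /andP[].
split.
- by rewrite E subseq_cat2l; apply: (subseq_cons (y :: p2) b).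
- by rewrite E subseq_cat2l; apply: (subseq_cons (cols (y :: p2)) (col b y)).
- move=> e; rewrite E inE !mem_cat /= inE -ec.
  by case/or3P=> ->; rewrite ?orbT.
- move=> z; rewrite E !mem_cat in_cons => /or3P[->//|/eqP->|->]; by rewrite ?m2 ?orbT.
- by constructor 3; rewrite E -ec.
Qed.

Variable k : nat.
Hypothesis k4 : 4 <= k.
Hypothesis dense : (k - 1) * #|V| < \sum_x D x.
Hypothesis sparse : forall Y : {set V}, Y != setT ->
  \sum_(x in Y) deg Y x <= (k - 1) * #|Y|.
Variable c : nat.
Hypothesis ck : c.+1 <= k.
Hypothesis cmax : forall p, rainbow p -> size p <= c.+1.
Variable Nn : nat.
Hypothesis Umax : forall q, rainbow q -> size q = c.+1 -> #|U q| <= Nn.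

Definition good q := [/\ rainbow q, size q = c.+1 & #|U q| = Nn].

Lemma no_cycle_size_succ C : rcyc C -> size C != c.+1.
Proof. exact: (no_cycle_Sc card13 lin k4 dense sparse ck cmax). Qed.

Lemma no_cycle_size C : rcyc C -> size C != c.
Proof.
move=> rC; apply/eqP => sC.
exact: (no_cycle_c card13 lin k4 dense sparse ck cmax rC sC).
Qed.

(** A path with two vertices more than [C] has exactly [c.+1] vertices, so [Umax] supplies the
    covering hypothesis of [cyc_closure]. *)
Lemma no_covering_cycle_pred C : rcyc C -> c = (size C).+1 -> #|UC C| < Nn.
Proof.
move=> rC sC; rewrite ltnNge; apply/negP => hN.
have n1 E : rcyc E -> size E != (size C).+1 by rewrite -sC; apply: no_cycle_size.
have n2 E : rcyc E -> size E != (size C).+2 by rewrite -sC; apply: no_cycle_size_succ.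
have nl p : rainbow p -> size p != (size C).+3.
  by move/cmax; rewrite -sC; case: eqP => // ->; rewrite ltnn.
have cov : UC C = setT.
  apply: (cyc_closure card13 lin k4 dense sparse rC _ _ n1).
    by move: ck; rewrite sC; move: (size C); clear; lia.
  move=> q rq; rewrite -sC => sq; apply: leq_trans hN; apply: Umax => //.
  by apply/eqP; rewrite eqn_leq sq cmax.
apply: (no_cycle_cp card13 lin rC n1 n2 nl cov dense); first by rewrite -sC.
have := order_gt k4 dense; rewrite (cardVCZ rC); move: ck; rewrite sC.
by move: (size C) #|_|; clear; lia.
Qed.

Hypothesis c2 : 2 <= c.

Lemma good_rev q : good q -> good (rev q).
Proof.
case=> rq sq Uq; split; rewrite ?rainbow_rev ?size_rev // -Uq /U cols_rev.
by congr #|pred_of_set _|; apply/setP => x; rewrite !inE mem_rev has_rev.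
Qed.

(** Dropping [a] frees the first edge, which contains both ends of what is left and closes it to a
    cycle of length [c]. *)
Lemma first_color_end a y p2 b : good (a :: y :: p2) -> seg y (y :: p2) b ->
  y != b -> b \in col a y -> False.
Proof.
case=> rq sq _ sg yb bm; have uq := rainbow_uniq rq.
have eH : col a y \in H by apply: (rainbow_colH rq); rewrite mem_head.
have [m1 m2] := col_mem card13 eH.
have eby : col b y = col a y by apply: (col_eq lin eH) => //; rewrite eq_sym.
have n : col a y \notin cols (y :: p2) by move: (rainbow_cuniq rq) => /= /andP[].
have sz : size (y :: p2) = c by case: sq.
(* For [c] = 2 two vertices do not form a cycle, but then the two colours of the path coincide. *)
have [c3|c3] := leqP 3 c; last first.
  have : size p2 = 1 by move: sz c3 c2 => /=; clear; lia.
  case: p2 sg n sz {sq rq uq} => [|b0 [|]] // [t0 [<-] /= eb] n _ _.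
  by rewrite inE eb (colC _ y b) eby eqxx in n.
have := no_cycle_size (C := y :: p2); rewrite sz eqxx => h; suff: false by []. apply: h.
apply: (rcyc_intro sg); rewrite ?sz ?eby //.
by case/and3P: rq => /andP[_ h1] /andP[_ h2] /andP[_ h3]; apply/and3P.
Qed.

(** A new colour would close a cycle of length [c.+1]. By the size bound a colour in use can only be
    that of the first or last edge, and [first_color_end] applies. *)
Lemma ends_nonadj a q b : good q -> seg a q b -> ~~ adj a b.
Proof.
move=> gq sg; case: (gq) => rq sq _; apply/negP => g.
have [n|] := boolP (col a b \in cols q); last first.
  move=> n; have := no_cycle_size_succ (C := q); rewrite sq eqxx => h; suff: false by []. apply: h.
  by apply: (rcyc_intro sg); rewrite ?sq // colC // (adj_col g).
have [p1 [x [y [p2 [E ec]]]]] := mem_cols n.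
have uq := rainbow_uniq rq; have [m1 m2] := col_mem card13 (adj_col g).
have eH : col x y \in H by rewrite -ec (adj_col g).
have [x1 y1] := col_mem card13 eH; rewrite -ec in x1 y1.
have first a' q' b' x' y' p2' : good q' -> seg a' q' b' -> q' = x' :: y' :: p2' ->
    b' \in col x' y' -> False.
  move=> gq' sg' E'; rewrite E' in gq' sg'; apply: (first_color_end gq').
    by exists p2' => //; case: sg' => t0 [_ <-].
  apply/eqP => yb; case: sg' => t0 [_ <-] /= lb.
  case: gq' => rq' sq' _; case: p2' {E'} lb rq' sq' => [|z p3] /= lb rq' sq'.
    by move: c2; case: sq' => <-.
  by move: (rainbow_uniq rq'); rewrite /= -lb in yb *; rewrite yb mem_last andbF.
have a_q : a \in q by case: (seg_mem sg).
have b_q : b \in q by case: (seg_mem sg).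
have [p10|p10] := eqVneq p1 [::].
  by rewrite p10 in E; apply: (first a q b x y p2 gq sg E); rewrite -ec.
have [p20|p20] := eqVneq p2 [::].
  apply: (first b (rev q) a y x (rev p1) (good_rev gq) (seg_rev sg)).
    by rewrite E p20 rev_cat.
  by rewrite colC -ec.
have ap1 : a \in p1.
  by case: p1 p10 {first} E => // a0 p1 _ E; case: sg => t0 E0 _; move: E0; rewrite E => -[-> _]; rewrite mem_head.
have bp2 : b \in p2.
  have [t0 E0] := seg_rcons sg; case/lastP: p2 p20 E {first} => // p2 b0 _ E.
  have /eqP := E; rewrite E0 -!rcons_cons -rcons_cat eqseq_rcons => /andP[_ /eqP->].
  by rewrite mem_rcons mem_head.
case: (no4 card13 (adj_col g) _ m1 m2 x1 y1); rewrite /= !inE !negb_or (adj_neq g).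
have xy : x != y.
  by move: uq; rewrite E cat_uniq => /and3P[_ _ /=]; rewrite inE negb_or => /andP[/andP[]].
move: uq; rewrite E cat_uniq /= !inE !negb_or => /and3P[_ /and3P[xp yp _] /and3P[/andP[_ xp2] yp2 _]].
by rewrite xy (in_neq ap1 xp) (in_neq ap1 yp) (in_neq bp2 xp2) (in_neq bp2 yp2).
Qed.

(** Without the edge [ab] the path closes to a cycle through the links [sb] and [ea], each colour
    conflict costing one vertex. Lengths [c.+1] and [c] are excluded, so both links conflict, which
    gives the two disjunctions, and the cycle has length [c.-1]. It must fail to cover [U q], and
    all it can miss is a third vertex of [ab] that lies on no other edge of the path. *)
Lemma crossing s T1 a b T2 e (q := s :: rcons T1 a ++ b :: rcons T2 e) : good q ->
  adj s b -> adj e a ->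
  [/\ (b \in col s (head a T1)) || (s \in col b (head e T2)),
      (a \in col (last b T2) e) || (e \in col (last s T1) a) &
   exists y, [/\ y \in col a b, y \notin q &
     forall f, f \in cols (s :: rcons T1 a) ++ cols (b :: rcons T2 e) -> y \notin f]].
Proof.
move=> gq asb aea; case: (gq) => rq sq Uq.
have [A EA] : exists A, A = s :: rcons T1 a by exists (s :: rcons T1 a).
have [B EB] : exists B, B = b :: rcons T2 e by exists (b :: rcons T2 e).
rewrite -EA -EB.
have sA : seg s A a by rewrite EA; exists (rcons T1 a); rewrite ?last_rcons.
have sB : seg b B e by rewrite EB; exists (rcons T2 e); rewrite ?last_rcons.
have Eq : q = A ++ B by rewrite EA EB.
have Ec : cols q = cols A ++ col a b :: cols B by rewrite Eq (cols_cat sA sB).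
have pc : perm_eq (cols q) (col a b :: (cols A ++ cols B)).
  by rewrite Ec; apply/permP => z /=; rewrite !count_cat /=; clear; lia.
have uV : uniq (A ++ B) by rewrite -Eq (rainbow_uniq rq).
have uc : uniq (cols A ++ cols B).
  by move: (rainbow_cuniq rq); rewrite (perm_uniq pc) => /andP[].
have cH f : f \in cols A ++ cols B -> f \in H.
  by move=> h; apply: (rainbow_colH rq); rewrite (perm_mem pc) inE h orbT.
have [A2 [B2 [u' [b' [[sA2 sB2 E1 n1] [sV sc h1 h2 st1]]]]]] := drop_side sA sB uV uc asb.
have uV2 : uniq (A2 ++ B2) := subseq_uniq sV uV.
have uc2 : uniq (cols A2 ++ cols B2) := subseq_uniq sc uc.
have uV2' : uniq (rev B2 ++ rev A2) by rewrite -rev_cat rev_uniq.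
have uc2' : uniq (cols (rev B2) ++ cols (rev A2)).
  by rewrite !cols_rev -rev_cat rev_uniq.
have [B3 [A3 [w' [a' [[sB3 sA3 E2 n2] [sV' sc' h1' h2' st2]]]]]] :=
  drop_side (seg_rev sB2) (seg_rev sA2) uV2' uc2' aea.
have sub3 f : f \in cols B3 ++ cols A3 -> f \in cols A2 ++ cols B2.
  by move/(mem_subseq sc'); rewrite !cols_rev -rev_cat mem_rev.
have sub3H f : f \in cols B3 ++ cols A3 -> f \in H.
  by move/sub3/(mem_subseq sc)/cH.
have [ms mb] := col_mem card13 (adj_col asb); have [me ma] := col_mem card13 (adj_col aea).
have sg_q : seg s q e.
  by rewrite Eq; apply: seg_cat sA sB.
have [sA' aA'] := seg_mem sA; have [bB' eB'] := seg_mem sB.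
have dAB x y : x \in A -> y \in B -> x != y.
  move=> xA yB; move: uV; rewrite cat_uniq => /and3P[_ /hasPn h _].
  by rewrite (in_neq xA) // h.
have sa : s != a by apply: contraTneq aea => <-; rewrite adjC (ends_nonadj gq sg_q).
have be : b != e by apply: contraTneq asb => ->; rewrite (ends_nonadj gq sg_q).
have neq : col s b != col e a.
  apply/eqP => E; rewrite -E in me ma; apply: (no4 card13 (adj_col asb) _ ms mb ma me).
  rewrite /= !inE !negb_or sa be (dAB s b) // (dAB s e) // (dAB a e) //.
  by rewrite (eq_sym b a) (dAB a b).
have sg3 : seg u' (rev A3 ++ B3) b' by apply: seg_cat (seg_rev sA3) sB3.
have Ec3 : perm_eq (cols (rev A3 ++ B3)) (col e a :: (cols B3 ++ cols A3)).
  rewrite (cols_cat (seg_rev sA3) sB3) (colC _ a') E2 cols_rev.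
  by apply/permP => z; rewrite /= !count_cat /= count_rev; clear; lia.
have n1' : col s b \notin cols B3 ++ cols A3 by apply: contra n1; apply: sub3.
have uc3 : uniq (cols B3 ++ cols A3) := subseq_uniq sc' uc2'.
have uV3 : uniq (rev A3 ++ B3).
  have := subseq_uniq sV' uV2'; rewrite (perm_uniq (_ : perm_eq (B3 ++ A3) (rev A3 ++ B3))) //.
  by rewrite perm_catC perm_cat2r perm_sym perm_rev.
have rb : rainbow (rev A3 ++ B3).
  apply: rainbow_intro => //.
    by move=> f; rewrite (perm_mem Ec3) inE => /predU1P[->|/sub3H//]; apply: adj_col.
  by rewrite (perm_uniq Ec3) /= n2 uc3.
have size3 : 3 <= size (rev A3 ++ B3).
  rewrite ltnNge; apply/negP => sz; have := neq.
  case: (seg_rev sA3) sz => tA EA' lA; case: sB3 => tB EB' lB; rewrite EA' EB' size_cat /= => sz.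
  have tA0 : tA = [::] by apply/nilP; rewrite /nilp; move: sz; clear; case: (size tA); lia.
  have tB0 : tB = [::] by apply/nilP; rewrite /nilp; move: sz; clear; case: (size tB); lia.
  by rewrite tA0 tB0 /= in lA lB; rewrite -E1 -E2 lA lB colC eqxx.
have rc : rcyc (rev A3 ++ B3).
  apply: (rcyc_intro sg3) => //; rewrite colC E1; first exact: adj_col.
  by rewrite (perm_mem Ec3) inE negb_or neq n1'.
have sz : size (rev A3 ++ B3) = size B3 + size A3 by rewrite size_cat size_rev addnC.
have szq : size A + size B = c.+1 by rewrite -size_cat -Eq.
have n0 := no_cycle_size_succ rc; have n01 := no_cycle_size rc; rewrite sz in n0 n01.
have ccE f : f \in col s b :: col e a :: (cols B3 ++ cols A3) -> f \in ccols (rev A3 ++ B3).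
  rewrite (perm_mem (ccols_seg H sg3)) (colC _ b') E1 in_cons => /predU1P[->|h].
    by rewrite mem_head.
  by rewrite in_cons (perm_mem Ec3) h orbT.
have szA : [/\ (b \in col s (head a T1)) || (s \in col b (head e T2)),
   (a \in col (last b T2) e) || (e \in col (last s T1) a) & (size (rev A3 ++ B3)).+1 = c].
  have lastr (X : seq V) x0 y : seg y X x0 -> forall z, last z (rev X) = y.
    by move=> [t0 -> _] z; rewrite rev_cons last_rcons.
  have headr (t0 : seq V) x0 y : seg y (rcons t0 x0) x0 -> head x0 t0 = y.
    by case=> t1 E _; case: t0 E => [|z t0] [->].
  rewrite sz; case: st1 => [[e1 e2]|[e1 e2 m]|[e1 e2 m]]; rewrite ?e1 ?e2 in st2.
  - case: st2 => [[e3 e4]|[e3 e4 m']|[e3 e4 m']].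
    + by move: n0 szq; rewrite e3 e4 !size_rev => n0 E; rewrite -E addnC eqxx in n0.
    + move: n01 szq; have := congr1 size e3; rewrite size_rev e4 size_rev /= => -> n01 E.
      by case/eqP: n01; move: E; move: (size A) (size B3); clear; lia.
    + move: n01 szq; have := congr1 size e4; rewrite size_rev e3 size_rev /= => -> n01 E.
      by case/eqP: n01; move: E; move: (size B) (size A3); clear; lia.
  - have eA : A2 = rcons T1 a by move: e1; rewrite EA => -[].
    rewrite eA in sA2 st2; rewrite (headr _ _ _ sA2) m.
    have szA2 : size A = (size A2).+1 by rewrite e1.
    case: st2 => [[e3 e4]|[e3 e4 m']|[e3 e4 m']].
    + move: n01; rewrite e3 e4 !size_rev -eA; move: szq szA2; clear.
      by move: (size A) (size B) (size A2); lia.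
    + have eB : rev B3 = b :: T2.
        apply/eqP; have := congr1 rev e3; rewrite revK rev_cons EB -rcons_cons => /eqP.
        by rewrite eqseq_rcons eq_sym => /andP[].
      have <- : w' = last b T2 by have := lastr _ _ _ sB3 b; rewrite eB.
      rewrite (colC _ w') m'; split=> //; have := congr1 size e3; rewrite e4 !size_rev -eA /=.
      by move: szq szA2; clear; move: (size A) (size B) (size A2) (size B3); lia.
    + have eA3 : rev A3 = T1.
        apply/eqP; have := congr1 rev e4; rewrite revK rev_cons => /eqP.
        by rewrite eqseq_rcons eq_sym => /andP[].
      have <- : a' = last s T1 by have := lastr _ _ _ sA3 s; rewrite eA3.
      rewrite (colC _ a' a) m' orbT; split=> //.
      have := congr1 size e4; rewrite e3 !size_rev -eA /=.
      by move: szq szA2; clear; move: (size A) (size B) (size A2) (size A3); lia.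
  - have eB : B2 = rcons T2 e by move: e2; rewrite EB => -[].
    rewrite eB in sB2 st2; rewrite (headr _ _ _ sB2) m orbT.
    have szB2 : size B = (size B2).+1 by rewrite e2.
    case: st2 => [[e3 e4]|[e3 e4 m']|[e3 e4 m']].
    + move: n01; rewrite e3 e4 !size_rev -eB; move: szq szB2; clear.
      by move: (size A) (size B) (size B2); lia.
    + have eB3 : rev B3 = T2.
        apply/eqP; have := congr1 rev e3; rewrite revK rev_cons => /eqP.
        by rewrite eqseq_rcons eq_sym => /andP[].
      have <- : w' = last b T2 by have := lastr _ _ _ sB3 b; rewrite eB3.
      rewrite (colC _ w') m'; split=> //; have := congr1 size e3; rewrite e4 !size_rev -eB /=.
      by move: szq szB2; clear; move: (size A) (size B) (size B2) (size B3); lia.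
    + have eA3 : rev A3 = s :: T1.
        apply/eqP; have := congr1 rev e4; rewrite revK rev_cons EA -rcons_cons => /eqP.
        by rewrite eqseq_rcons eq_sym => /andP[].
      have <- : a' = last s T1 by have := lastr _ _ _ sA3 s; rewrite eA3.
      rewrite (colC _ a' a) m' orbT; split=> //.
      have := congr1 size e4; rewrite e3 !size_rev -eB /=.
      by move: szq szB2; clear; move: (size A) (size B) (size B2) (size A3); lia.
case: szA => s1 s2 s3; split=> //.
have [/existsP[y /and3P[y1 y2 /allP y3]]|hn] := boolP [exists y, [&& y \in col a b, y \notin q &
     all (fun f : {set V} => y \notin f) (cols A ++ cols B)]].
  by exists y; split.
have cov f x : f \in cols A ++ cols B -> x \in f -> x \in UC (rev A3 ++ B3).
  move=> fc xf; apply: span2 xf; apply: ccE; rewrite inE.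
  have := h1 _ fc; rewrite inE => /predU1P[->|f2]; first by rewrite eqxx.
  have : f \in cols (rev B2) ++ cols (rev A2) by rewrite !cols_rev -rev_cat mem_rev.
  by move/h1' => ->; rewrite orbT.
(* A dropped vertex stays covered because it lies on the edge of the closing link. *)
have covV x : x \in q -> x \in UC (rev A3 ++ B3).
  rewrite Eq => /h2/orP[x2|xc]; last by apply: span2 xc; apply: ccE; rewrite mem_head.
  have : x \in rev B2 ++ rev A2 by rewrite -rev_cat mem_rev.
  move/h2'/orP => [x3|xc]; last by apply: span2 xc; apply: ccE; rewrite !inE eqxx orbT.
  by apply: span1; rewrite mem_cat mem_rev orbC -mem_cat.
have := no_covering_cycle_pred rc (esym s3); rewrite ltnNge => /negP; case.
rewrite -Uq; apply: subset_leq_card; apply/subsetP => x /mem_span[/covV//|[f]].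
rewrite (perm_mem pc) inE => /predU1P[->|fc xf]; last exact: cov fc xf.
move=> xg; have [xq|xq] := boolP (x \in q); first exact: covV.
have [/hasP[f1 fc xf]|hh] := boolP (has (fun f : {set V} => x \in f) (cols A ++ cols B)).
  exact: cov fc xf.
case/negP: hn; apply/existsP; exists x; rewrite xg xq /=; by move: hh; rewrite -all_predC.
Qed.
End LongPath.

(** * Good paths with the most edges leaving them *)

Section BestPath.
Variables (V : finType) (H : {set {set V}}).
Notation col := (col H). Notation cols := (cols H). Notation ccols := (ccols H).
Notation rainbow := (rainbow H). Notation rcyc := (rcyc H).
Notation adj := (adj H). Notation deg := (deg H). Notation D := (deg setT).
Notation UC := (UC H). Notation U := (U H).

Hypothesis card13 : forall e, e \in H -> 0 < #|e| <= 3.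
Hypothesis lin : linear_hg H.

Variable k : nat.
Hypothesis k4 : 4 <= k.
Hypothesis dense : (k - 1) * #|V| < \sum_x D x.
Hypothesis sparse : forall Y : {set V}, Y != setT ->
  \sum_(x in Y) deg Y x <= (k - 1) * #|Y|.
Variable c : nat.
Hypothesis ck : c.+1 <= k.
Hypothesis cmax : forall p, rainbow p -> size p <= c.+1.
Variable Nn : nat.
Hypothesis Umax : forall q, rainbow q -> size q = c.+1 -> #|U q| <= Nn.

Hypothesis c2 : 2 <= c.
Notation good := (good H c Nn).


Definition outer q := count (fun e : {set V} => ~~ (e \subset q)) (cols q).
Variable Im : nat.
Hypothesis Imax : forall q, good q -> outer q <= Im.
Definition best q := good q /\ outer q = Im.
Notation mkp s t e := (s :: rcons t e).

Lemma mkp_cat (s : V) T1 a b T2 e :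
  mkp s (T1 ++ a :: b :: T2) e = s :: rcons T1 a ++ b :: rcons T2 e.
Proof. by rewrite cat_rcons rcons_cat. Qed.

Lemma mkp_rev (s : V) t e : rev (mkp s t e) = mkp e (rev t) s.
Proof. by rewrite rev_cons rev_rcons. Qed.

Lemma mkp_seg (s : V) t e : seg s (mkp s t e) e.
Proof. by exists (rcons t e); rewrite ?last_rcons. Qed.

Lemma outer_rev q : outer (rev q) = outer q.
Proof.
rewrite /outer cols_rev count_rev; apply: eq_count => e; congr (~~ _).
by apply: eq_subset_r => x; rewrite mem_rev.
Qed.

Lemma best_rev q : best q -> best (rev q).
Proof. by case=> g o; split; [exact: good_rev | rewrite outer_rev]. Qed.

(** With the same edges in use, only vertices of [q] could cease to be covered; [Umax] gives the
    other inequality. *)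
Lemma good_same q q' : good q -> size q' = size q -> uniq q' ->
  perm_eq (cols q') (cols q) -> (forall x, x \in q -> x \in U q') -> good q'.
Proof.
case=> rq sq Uq sz u pc h.
have rq' : rainbow q'.
  apply: rainbow_intro => //; last by rewrite (perm_uniq pc) (rainbow_cuniq rq).
  by move=> e; rewrite (perm_mem pc); apply: rainbow_colH.
rewrite -sz in sq; split=> //; apply/eqP; rewrite eqn_leq Umax //=.
rewrite -Uq; apply: subset_leq_card; apply/subsetP => x /mem_span[/h//|[e]].
by rewrite -(perm_mem pc) => ec; apply: span2 ec.
Qed.

Lemma perm_outer q q' : perm_eq (cols q') (cols q) ->
  outer q' = count (fun e : {set V} => ~~ (e \subset q')) (cols q).
Proof. by move/permP => h; rewrite /outer h. Qed.

Lemma count_sub_le (P Q : pred {set V}) s : (forall y, y \in s -> P y -> Q y) ->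
  count P s <= count Q s.
Proof.
elim: s => // y s IH h /=; apply: leq_add; last first.
  by apply: IH => z zs; apply: h; rewrite inE zs orbT.
by case Py: (P y); rewrite // h ?mem_head.
Qed.

Lemma count_sub_lt (P Q : pred {set V}) s x : (forall y, y \in s -> P y -> Q y) ->
  x \in s -> Q x -> ~~ P x -> count P s < count Q s.
Proof.
move=> h xs Qx Px; rewrite !(permP (perm_to_rem xs)).
rewrite /= Qx (negPf Px) ltnS; apply: count_sub_le => y /mem_rem; exact: h.
Qed.

Lemma third_mem e a b d x : e \in H -> uniq [:: a; b; d] -> a \in e -> b \in e ->
  d \in e -> x \in e -> x \in [:: a; b; d].
Proof.
move=> eH u ae be de xe; apply/negPn/negP => n.
by apply: (no4 card13 eH _ xe ae be de); rewrite cons_uniq n.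
Qed.

(* Otherwise rerouting through the end of the path would replace [a] by the outer
   vertex [y], keeping all colours and increasing [outer]. *)
Lemma best_last_not_inner s T1 a b T2 e y (q := s :: rcons T1 a ++ b :: rcons T2 e) :
  best q -> y \in col a b -> y \notin q ->
  (forall f, f \in cols (s :: rcons T1 a) ++ cols (b :: rcons T2 e) -> y \notin f) ->
  e \notin col (last s T1) a.
Proof.
move=> [gq Iq] yg yq yf; apply/negP => ea; case: (gq) => rq sq _.
have [A EA] : exists A, A = s :: T1 by exists (s :: T1).
have [B EB] : exists B, B = b :: rcons T2 e by exists (b :: rcons T2 e).
pose a1 := last s T1.
have sA : seg s A a1 by rewrite EA; exists T1.
have sB : seg b B e by rewrite EB; exists (rcons T2 e); rewrite ?last_rcons.
have Eq : q = A ++ a :: B by rewrite EA EB /q cat_rcons.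
have Ec : cols q = cols A ++ col a1 a :: col a b :: cols B.
  rewrite Eq; have /= := cols_seg H [::] (a :: B) sA => ->.
  by rewrite EB.
have uq := rainbow_uniq rq; rewrite Eq in uq.
have aq : a \in q by rewrite Eq mem_cat mem_head orbT.
have [_ a1A] := seg_mem sA; have [bB eB] := seg_mem sB.
have a1q : a1 \in q by rewrite Eq mem_cat a1A.
have eq_ : e \in q by rewrite Eq mem_cat inE eB !orbT.
have bq : b \in q by rewrite Eq mem_cat inE bB !orbT.
move: (uq); rewrite cat_uniq /= negb_or => /and3P[uA /andP[aA dAB] /andP[aB uB]].
have a1a : a1 != a by rewrite (in_neq a1A).
have a1e : a1 != e by apply: contraNneq dAB => E; apply/hasP; exists e => //=; rewrite -E.
have ae : a != e by rewrite eq_sym (in_neq eB).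
have ab : a != b by rewrite eq_sym (in_neq bB).
have gH : col a b \in H by apply: (rainbow_colH rq); rewrite Ec mem_cat !inE eqxx !orbT.
have wH : col a1 a \in H by apply: (rainbow_colH rq); rewrite Ec mem_cat !inE eqxx !orbT.
have [ga gb] := col_mem card13 gH; have [w1 w2] := col_mem card13 wH.
have by_ : b != y by rewrite (in_neq bq).
have E1 : col a1 e = col a1 a by apply: (col_eq lin wH).
have E2 : col b y = col a b by apply: (col_eq lin gH).
pose P := A ++ rcons (rev B) y.
have sBy : seg e (rcons (rev B) y) y.
  case: (seg_rev sB) => t0 -> _; exists (rcons t0 y); by rewrite ?last_rcons.
have Bne : exists B', rev B = rcons B' b by apply: (seg_rcons (seg_rev sB)).
have EcB : cols (rcons (rev B) y) = rcons (rev (cols B)) (col a b).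
  by case: Bne => B' EB'; rewrite EB' cols_rcons2 E2 -EB' cols_rev.
have pc : perm_eq (cols P) (cols q).
  rewrite (cols_cat H sA sBy) Ec E1 EcB; apply/permP => z.
  by rewrite !count_cat /= -cats1 !count_cat count_rev /=; clear; lia.
have pP : perm_eq P (y :: (A ++ B)).
  rewrite /P; apply/permP => z; rewrite /= !count_cat -cats1 !count_cat count_rev /=; clear; lia.
have yAB : y \notin A ++ B.
  by apply: contra yq; rewrite Eq !mem_cat inE => /orP[]->; rewrite ?orbT.
have uP : uniq P.
  by rewrite (perm_uniq pP) /= yAB cat_uniq uA uB dAB.
have aP : a \notin P.
  rewrite (perm_mem pP) inE negb_or mem_cat negb_or aA aB !andbT.
  by rewrite (in_neq aq).
have gP : good P.
  apply: (good_same gq) => //.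
    by rewrite (perm_size pP) Eq !size_cat /= size_cat addnS.
  move=> x xq; have [->|xa] := eqVneq x a.
    by apply: span2 w2; rewrite (perm_mem pc) Ec mem_cat !inE eqxx !orbT.
  apply: span1; rewrite (perm_mem pP) inE; apply/orP; right.
  by move: xq; rewrite Eq !mem_cat inE (negPf xa).
have := Imax gP; rewrite leqNgt => /negP; apply.
rewrite -Iq (perm_outer pc) /outer; apply: (@count_sub_lt _ _ _ (col a1 a)).
- move=> f fq /subsetPn[x xf xq].
  have [E|ne] := eqVneq f (col a b).
    by rewrite E; apply/subsetPn; exists a.
  apply/subsetPn; exists x => //; rewrite (perm_mem pP) inE negb_or; apply/andP; split.
    apply: contraTneq xf => ->; apply: yf.
    have -> : cols (s :: rcons T1 a) = rcons (cols A) (col a1 a) by rewrite cols_rcons EA.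
    move: fq; rewrite -EB Ec !mem_cat mem_rcons !inE (negPf ne) /=.
    by case/or3P=> ->; rewrite ?orbT.
  by apply: contra xq; rewrite Eq !mem_cat inE => /orP[]->; rewrite ?orbT.
- by rewrite Ec mem_cat !inE eqxx !orbT.
- by apply/subsetPn; exists a.
- rewrite negbK; apply/subsetP => x xw.
  have := third_mem wH _ w1 w2 ea xw; rewrite /= !inE negb_or a1a a1e ae => /(_ isT).
  by case/or3P=> /eqP->.
Qed.

Lemma last_rev (x : V) T : last x (rev T) = head x T.
Proof. by case: T => //= y T; rewrite rev_cons last_rcons. Qed.

(** Applied to the path and to its reverse, [best_last_not_inner] removes one alternative from each
    disjunction of [crossing]. *)
Lemma best_crossing s T1 a b T2 e (q := s :: rcons T1 a ++ b :: rcons T2 e) :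
  best q -> adj s b -> adj e a ->
  [/\ b \in col s (head a T1), a \in col (last b T2) e &
   exists y, [/\ y \in col a b, y \notin q &
     forall f, f \in cols (s :: rcons T1 a) ++ cols (b :: rcons T2 e) -> y \notin f]].
Proof.
move=> bq asb aea; have [gq _] := bq.
have [h1 h2 [y [y1 y2 y3]]] := crossing card13 lin k4 dense sparse ck cmax Umax c2 gq asb aea.
have n1 := best_last_not_inner bq y1 y2 y3.
have Er : rev q = e :: rcons (rev T2) b ++ a :: rcons (rev T1) s.
  by rewrite /q rev_cons rev_cat !rev_cons !rev_rcons rcons_cat /= -cats1 -catA.
have n2 : s \notin col b (head e T2).
  rewrite colC -last_rev; have bq' := best_rev bq; rewrite Er in bq'.
  apply: (@best_last_not_inner e (rev T2) b a (rev T1) s y) => //.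
  - by rewrite colC.
  - by rewrite -Er mem_rev.
  - move=> f; rewrite mem_cat orbC -mem_cat => hf; apply: y3; move: hf.
    have -> : a :: rcons (rev T1) s = rev (s :: rcons T1 a) by rewrite rev_cons rev_rcons.
    have -> : e :: rcons (rev T2) b = rev (b :: rcons T2 e) by rewrite rev_cons rev_rcons.
    by rewrite !cols_rev !mem_cat !mem_rev.
rewrite (negPf n1) orbF in h2; rewrite (negPf n2) orbF in h1.
by split=> //; exists y; split.
Qed.
End BestPath.

(** * Neighbours of the path ends *)

Section PathCases.
Variables (V : finType) (H : {set {set V}}).
Notation col := (col H). Notation cols := (cols H). Notation ccols := (ccols H).
Notation rainbow := (rainbow H). Notation rcyc := (rcyc H).
Notation adj := (adj H). Notation deg := (deg H). Notation D := (deg setT).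
Notation UC := (UC H). Notation U := (U H).

Hypothesis card13 : forall e, e \in H -> 0 < #|e| <= 3.
Hypothesis lin : linear_hg H.

Variable k : nat.
Hypothesis k4 : 4 <= k.
Hypothesis dense : (k - 1) * #|V| < \sum_x D x.
Hypothesis sparse : forall Y : {set V}, Y != setT ->
  \sum_(x in Y) deg Y x <= (k - 1) * #|Y|.
Variable c : nat.
Hypothesis ck : c.+1 <= k.
Hypothesis cmax : forall p, rainbow p -> size p <= c.+1.
Variable Nn : nat.
Hypothesis Umax : forall q, rainbow q -> size q = c.+1 -> #|U q| <= Nn.

Hypothesis c2 : 2 <= c.
Notation good := (good H c Nn).
Notation outer := (outer H).
Variable Im : nat.
Hypothesis Imax : forall q, good q -> outer q <= Im.
Notation best := (best H c Nn Im).
Notation mkp s t e := (s :: rcons t e).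

Notation ends_nonadj := (ends_nonadj card13 lin k4 dense sparse ck cmax c2).

(** Indices stand for gaps between consecutive vertices of [t]: [front] tests the right vertex of
    the gap and [back] the left one, so a common index is a crossing. *)
Definition front n x0 t s := [set i : 'I_n | adj s (nth x0 t i.+1)].
Definition back n x0 t e := [set i : 'I_n | adj e (nth x0 t i)].

Lemma gapE (x0 : V) t i : i < (size t).-1 ->
  t = take i t ++ nth x0 t i :: nth x0 t i.+1 :: drop i.+2 t.
Proof.
move=> h; have h1 : i.+1 < size t by move: h; clear; case: (size t).
by rewrite -(drop_nth x0 h1) -(drop_nth x0 (ltnW h1)) cat_take_drop.
Qed.

Lemma mem_cols_out s t v x : rainbow (s :: v :: t) -> x \notin s :: v :: t ->
  col s x \in cols (s :: v :: t) -> adj s x -> x \in col s v.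
Proof.
move=> rq xq /mem_cols[p1 [y [z [p2 [E ec]]]]] g.
have uq := rainbow_uniq rq; have [m1 m2] := col_mem card13 (adj_col g).
have eH : col y z \in H by rewrite -ec (adj_col g).
have [y1 z1] := col_mem card13 eH; rewrite -ec in y1 z1.
case: p1 E => [[-> -> _]|s0 p1 [es E]]; first by rewrite -ec.
case: (no4 card13 (adj_col g) _ m1 m2 y1 z1).
have yt : y \in v :: t by rewrite E mem_cat !inE eqxx !orbT.
have zt : z \in v :: t by rewrite E mem_cat !inE eqxx !orbT.
have yq : y \in s :: v :: t by rewrite inE yt orbT.
have zq : z \in s :: v :: t by rewrite inE zt orbT.
rewrite /= !inE !negb_or (adj_neq g) ![x == _]eq_sym (in_neq yq xq) (in_neq zq xq) !andbT.
move: uq; rewrite cons_uniq => /andP[st ut].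
rewrite ![s == _]eq_sym (in_neq yt st) (in_neq zt st) /=.
by move: ut; rewrite E cat_uniq => /and3P[_ _]; rewrite /= inE negb_or => /andP[/andP[]].
Qed.

(** The 1 is for [v], and the last term for a third vertex of the first edge off the path. Any other
    neighbour off the path would extend it, and the other end is excluded by [ends_nonadj]. *)
Lemma deg_front n x0 s v t1 e (t := v :: t1) : good (mkp s t e) -> n = (size t).-1 ->
  D s <= #|front n x0 t s| + 1 + ~~ (col s v \subset mkp s t e).
Proof.
move=> gq En; case: (gq) => rq sq _; set p := mkp s t e.
have uq := rainbow_uniq rq.
have sH : col s v \in H by apply: (rainbow_colH rq); rewrite mem_head.
have [m1 m2] := col_mem card13 sH.
have sub : nb H setT s \subset
   (v |: [set nth x0 t (i : 'I_n).+1 | i in front n x0 t s]) :|: (col s v :\: [set x in p]).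
  apply/subsetP => x; rewrite [x \in nb _ _ _]inE in_setT /= => g.
  rewrite in_setU in_setU1 in_setD [x \in [set _ in _]]inE.
  have [xp|xp] := boolP (x \in p); last first.
    apply/orP; right; apply: (mem_cols_out rq xp) => //.
    apply/negPn/negP => nn0; have nn : col s x \notin cols p by exact: nn0.
    have Ex : cols (x :: p) = col x s :: cols p by [].
    have rx : rainbow (x :: p).
      apply: rainbow_intro; first by rewrite cons_uniq xp.
        move=> f; rewrite Ex inE => /predU1P[->|].
          by rewrite colC (adj_col g).
        exact: rainbow_colH.
      by rewrite Ex cons_uniq colC nn (rainbow_cuniq rq).
    by have := cmax rx; rewrite -[size (x :: p)]/(size p).+1 sq ltnn.
  rewrite orbF.
  have xt : x \in t.
    move: xp; rewrite inE mem_rcons inE => /or3P[/eqP E|/eqP E|//].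
      by have := adj_neq g; rewrite E eqxx.
    by have := ends_nonadj gq (mkp_seg s t e); rewrite -E g.
  have [->|xv] := eqVneq x v; first by [].
  have xt1 : x \in t1 by move: xt; rewrite inE (negPf xv).
  have hi : index x t1 < n by rewrite En /= index_mem.
  apply/imsetP; exists (Ordinal hi); last by rewrite /= nth_index.
  by rewrite inE /= nth_index.
apply: leq_trans (subset_leq_card sub) _.
rewrite cardsU; apply: leq_trans (leq_subr _ _) _; apply: leq_add.
  rewrite cardsU1 addnC; apply: leq_add; last by case: (_ \notin _).
  exact: leq_imset_card.
case: (boolP (col s v \subset p)) => [/subsetP h|/subsetPn[y yc yp]] /=.
  rewrite leqn0 cards_eq0; apply/eqP/setP => x; rewrite !inE.
  by apply/negP => /andP[xp /h xp']; case/negP: xp; move: xp'; rewrite !inE.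
have : col s v :\: [set x in p] \subset (col s v :\ s) :\ v.
  apply/subsetP => x; rewrite in_setD [x \in [set _ in _]]inE !in_setD1 => /andP[xp ->].
  have sp : s \in p by rewrite mem_head.
  have vp : v \in p by rewrite !inE eqxx orbT.
  by rewrite ![x == _]eq_sym (in_neq sp xp) (in_neq vp xp).
move/subset_leq_card => h; apply: leq_trans h _.
have := cardsD1 s (col s v); have := cardsD1 v (col s v :\ s).
have sv : v != s by move: uq; rewrite /= inE negb_or eq_sym => /andP[/andP[]].
by rewrite in_setD1 m1 m2 sv; have := card13 sH; clear; lia.
Qed.

Lemma back_rev n x0 (t : seq V) e : n = (size t).-1 ->
  #|front n x0 (rev t) e| = #|back n x0 t e|.
Proof.
move=> En; rewrite -(card_imset (mem (back n x0 t e)) (@rev_ord_inj n)).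
apply: eq_card => i; rewrite inE -{2}[i]rev_ordK mem_imset; last exact: rev_ord_inj.
rewrite inE nth_rev /=; last by move: (ltn_ord i) En; move: (nat_of_ord i) (size t); clear; lia.
by congr (adj e (nth x0 t _)); move: (ltn_ord i) En; move: (nat_of_ord i) (size t); clear; lia.
Qed.

Lemma deg_back n x0 s t e : good (mkp s t e) -> n = (size t).-1 -> 0 < size t ->
  D e <= #|back n x0 t e| + 1 + ~~ (col (last s t) e \subset mkp s t e).
Proof.
move=> gq En t0; have := good_rev gq; rewrite mkp_rev -back_rev // => gq'.
case Er: (rev t) gq' => [|v t1] gq'.
  by move: t0; rewrite -(size_rev t) Er.
have := deg_front (n := n) x0 gq'; rewrite -Er size_rev => /(_ En).
have -> : last s t = v by rewrite -[t]revK Er rev_cons last_rcons.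
rewrite colC -mkp_rev.
have -> // : (col v e \subset rev (mkp s t e)) = (col v e \subset mkp s t e).
by apply: eq_subset_r => x; rewrite mem_rev.
Qed.

Lemma uniq_pred (s1 s2 : seq V) l1 l2 x y x' : uniq (s1 ++ x :: x' :: s2) ->
  s1 ++ x :: x' :: s2 = l1 ++ y :: x' :: l2 -> y = x.
Proof.
move=> u E; have e1 := next_mid u; have u' := u; rewrite E in u'.
by apply: (can_inj (prev_next u)); rewrite e1 {1}E (next_mid u').
Qed.

Lemma uniq_succ (s1 s2 : seq V) l1 l2 x y x' : uniq (s1 ++ x :: x' :: s2) ->
  s1 ++ x :: x' :: s2 = l1 ++ x :: y :: l2 -> y = x'.
Proof.
move=> u E; have e1 := next_mid u; have u' := u; rewrite E in u'.
by rewrite -e1 E (next_mid u').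
Qed.

(* [u] and [y] are the two interchangeable ends of the first edge; if one of
   them lies on a later edge, either the other one can be inserted too, or it
   lies on the following edge. *)
Lemma chain u y v t2 e (t := v :: rcons t2 e) : good (u :: t) -> good (y :: t) ->
  y \in col u v -> y \notin u :: t ->
  forall L2 L1 x x' s s', t = L1 ++ x :: x' :: L2 -> s \in [:: u; y] ->
  s' \in [:: u; y] -> s != s' -> s \in col x x' ->
  (forall z, z \in x' :: L2 -> adj u z = adj y z) -> False.
Proof.
move=> gu gy yF yn; have gs s : s \in [:: u; y] -> good (s :: t).
  by rewrite !inE => /orP[]/eqP->.
case: (gu) => rq sq _; have uq := rainbow_uniq rq.
have FH : col u v \in H by apply: (rainbow_colH rq); rewrite mem_head.
have [Fu Fv] := col_mem card13 FH.
have ut : uniq t by move: uq; rewrite cons_uniq => /andP[].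
have sn s : s \in [:: u; y] -> s \notin t.
  rewrite !inE => /orP[]/eqP->; first by move: uq; rewrite cons_uniq => /andP[].
  by move: yn; rewrite inE negb_or => /andP[].
have uy : u != y by apply: contraNneq yn => <-; rewrite mem_head.
have Fs s s' : s \in [:: u; y] -> s' \in [:: u; y] -> s != s' -> col s s' = col u v.
  have hF z : z \in [:: u; y] -> z \in col u v by rewrite !inE => /orP[]/eqP->.
  by move=> h1 h2 ss; apply: (col_eq lin FH) => //; apply: hF.
(* Induction on the part of the path behind the edge that contains [s]. At the last edge [s] would
   be adjacent to the end [e], against [ends_nonadj]. *)
elim=> [|x'' L2 IH] L1 x x' s s' Et h1 h2 ss sx hadj.
  have xl : x' = e.
    by have := congr1 (last v) Et; rewrite /t /= last_rcons last_cat /= => ->.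
  have sg : seg s (s :: t) e by exists t => //; rewrite /t /= last_rcons.
  have xH : col x x' \in H.
    by apply: (rainbow_colH rq); rewrite /= -/(cols t) -/t inE; apply/orP; right;
       rewrite -[pairmap _ _ _]/(cols t) Et cols_mid mem_cat mem_head orbT.
  have [_ mx] := col_mem card13 xH.
  have et : e \in t by rewrite /t inE mem_rcons mem_head orbT.
  have := ends_nonadj (gs s h1) sg; rewrite (adj_edge lin xH) // -?xl //.
  by rewrite xl eq_sym (in_neq et) // sn.
have Ec : cols t = cols (rcons L1 x) ++ col x x' :: cols (x' :: x'' :: L2) by rewrite Et cols_mid.
have xH : col x x' \in H.
  apply: (rainbow_colH rq); rewrite -[cols _]/(col u v :: cols t) inE Ec mem_cat mem_head.
  by rewrite !orbT.
have [xx xx'] := col_mem card13 xH.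
have xt : x \in t by rewrite Et mem_cat mem_head orbT.
have xt' : x' \in t by rewrite Et mem_cat !inE eqxx !orbT.
have adj_s : adj s x' by apply: (adj_edge lin xH) => //; rewrite eq_sym (in_neq xt') // sn.
have adj_s' : adj s' x'.
  have := hadj x' (mem_head _ _); move: h1 h2 ss adj_s.
  by rewrite !inE => /orP[]/eqP-> /orP[]/eqP->; rewrite ?eqxx // => _ -> // <-.
have xx'n : x != x'.
  by move: ut; rewrite Et cat_uniq => /and3P[_ _]; rewrite /= inE negb_or => /andP[/andP[]].
have [m1 m2] := col_mem card13 (adj_col adj_s').
(* If this colour is in use, it is that of the edge following [x'], where the induction hypothesis
   applies with [s] and [s'] exchanged; any other place puts four vertices on one edge. *)
have [|n] := boolP (col s' x' \in cols t).
  case/mem_cols => M1 [y1 [y2 [M2 [EM ec]]]].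
  have y1t : y1 \in t by rewrite EM mem_cat mem_head orbT.
  have y2t : y2 \in t by rewrite EM mem_cat !inE eqxx !orbT.
  have yH : col y1 y2 \in H by rewrite -ec (adj_col adj_s').
  have [z1 z2] := col_mem card13 yH; rewrite -ec in z1 z2.
  have [E2|n2] := eqVneq y2 x'.
    have E1 : y1 = x.
      apply: (@uniq_pred L1 (x'' :: L2) M1 M2 x y1 x'); first by rewrite -Et.
      by rewrite -Et EM E2.
    rewrite E1 E2 in ec; rewrite ec in m1.
    apply: (no4 card13 xH _ sx m1 xx xx').
    by rewrite /= !inE !negb_or ss xx'n ![s == _]eq_sym ![s' == _]eq_sym !(in_neq _ (sn _ h1)) // !(in_neq _ (sn _ h2)).
  have [E1|n1] := eqVneq y1 x'.
    have Et' : t = rcons L1 x ++ x' :: x'' :: L2 by rewrite cat_rcons.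
    have E2 : y2 = x''.
      apply: (@uniq_succ (rcons L1 x) L2 M1 M2 x' y2 x''); first by rewrite -Et'.
      by rewrite -Et' EM E1.
    rewrite E1 E2 in ec; rewrite ec in m1.
    apply: (IH (rcons L1 x) x' x'' s' s) => //; first by rewrite eq_sym.
    by move=> z zL; apply: hadj; rewrite inE zL orbT.
  apply: (no4 card13 (adj_col adj_s') _ m1 m2 z1 z2).
  rewrite /= !inE !negb_or (adj_neq adj_s') ![s' == _]eq_sym !(in_neq _ (sn _ h2)) //.
  rewrite ![x' == _]eq_sym n1 n2 !andbT /=.
  by move: ut; rewrite EM cat_uniq => /and3P[_ _]; rewrite /= inE negb_or => /andP[/andP[]].
have E1 : col x s = col x x' by apply: (col_eq lin xH) => //; rewrite (in_neq xt) // sn.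
(* Both ends are inserted between [x] and [x']: [x], [s] keeps the old colour, [s], [s'] uses the
   first edge, and [s'], [x'] is new. *)
pose P := rcons L1 x ++ s :: s' :: x' :: x'' :: L2.
have EcP : perm_eq (cols P) (col u v :: col s' x' :: cols t).
  rewrite /P cat_rcons cols_mid Ec E1 -[cols (s :: _)]/(col s s' :: col s' x' :: cols (x' :: x'' :: L2)).
  by rewrite (Fs s s' h1 h2 ss); apply/permP => z; rewrite /= !count_cat /=; clear; lia.
have pP : perm_eq P (s :: s' :: t).
  by rewrite Et /P cat_rcons; apply/permP => z; rewrite /= !count_cat /=; clear; lia.
have uc := rainbow_cuniq rq; rewrite -[cols _]/(col u v :: cols t) in uc.
case/andP: uc => Fn uct.
have nF : col u v != col s' x'.
  apply/eqP => E; rewrite -E in m2.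
  apply: (no4 card13 FH _ Fu yF Fv m2).
  have vt : v \in t by rewrite mem_head.
  have h_u : u \notin t by apply: sn; rewrite mem_head.
  have h_y : y \notin t by apply: sn; rewrite !inE eqxx orbT.
  rewrite /= !inE !negb_or uy ![u == _]eq_sym ![y == _]eq_sym !(in_neq _ h_u) // !(in_neq _ h_y) //=.
  case: L1 Et {IH Ec EcP pP P} => [|v0 L1] [ev Et].
    by rewrite ev xx'n.
  by move: ut; rewrite /t Et /= mem_cat !inE !negb_or => /andP[/andP[_ /and3P[_ -> _]]].
have rP : rainbow P.
  apply: rainbow_intro.
  - by rewrite (perm_uniq pP) /= inE negb_or ss (sn s) // (sn s').
  - move=> f; rewrite (perm_mem EcP) !inE => /or3P[/eqP->//|/eqP->|ft]; first exact: adj_col.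
    by apply: (rainbow_colH rq); rewrite -[cols _]/(col u v :: cols t) inE ft orbT.
  - by rewrite (perm_uniq EcP) /= inE negb_or nF Fn n.
have := cmax rP; rewrite (perm_size pP) -[size _]/(size t).+2; move: sq => /= [->].
by rewrite ltnn.
Qed.
End PathCases.

(** * Paths that contain both of their end edges *)

Section PathEnd.
Variables (V : finType) (H : {set {set V}}).
Notation col := (col H). Notation cols := (cols H). Notation ccols := (ccols H).
Notation rainbow := (rainbow H). Notation rcyc := (rcyc H).
Notation adj := (adj H). Notation deg := (deg H). Notation D := (deg setT).
Notation UC := (UC H). Notation U := (U H).

Hypothesis card13 : forall e, e \in H -> 0 < #|e| <= 3.
Hypothesis lin : linear_hg H.

Variable k : nat.
Hypothesis k4 : 4 <= k.
Hypothesis dense : (k - 1) * #|V| < \sum_x D x.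
Hypothesis sparse : forall Y : {set V}, Y != setT ->
  \sum_(x in Y) deg Y x <= (k - 1) * #|Y|.
Variable c : nat.
Hypothesis ck : c.+1 <= k.
Hypothesis cmax : forall p, rainbow p -> size p <= c.+1.
Variable Nn : nat.
Hypothesis Umax : forall q, rainbow q -> size q = c.+1 -> #|U q| <= Nn.

Hypothesis c2 : 2 <= c.
Notation good := (good H c Nn).
Notation outer := (outer H).
Variable Im : nat.
Hypothesis Imax : forall q, good q -> outer q <= Im.
Notation best := (best H c Nn Im).
Notation mkp s t e := (s :: rcons t e).

Notation bcross := (best_crossing card13 lin k4 dense sparse ck cmax Umax c2 Imax).
Notation blni := (best_last_not_inner card13 lin Umax Imax).
Notation cross := (crossing card13 lin k4 dense sparse ck cmax Umax c2).
Notation chainL := (chain card13 lin k4 dense sparse ck cmax c2).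
Notation dfront := (deg_front card13 lin k4 dense sparse ck cmax c2).
Notation dback := (deg_back card13 lin k4 dense sparse ck cmax c2).
Notation nonadj := (ends_nonadj card13 lin k4 dense sparse ck cmax c2).
Notation front := (front H). Notation back := (back H).

Lemma mkp_facts s t e : good (mkp s t e) ->
  [/\ c = (size t).+1, uniq t, s \notin t, e \notin t & s != e].
Proof.
case=> /rainbow_uniq u /= [E] _; rewrite size_rcons in E.
move: u; rewrite /= mem_rcons inE negb_or rcons_uniq => /andP[/andP[se st] /andP[et ut]].
by split.
Qed.

(** The same edges are in use, and [u] remains covered by the first of them. *)
Lemma petal_good u v t1 w y : good (mkp u (v :: t1) w) -> y \in col u v ->
  y \notin mkp u (v :: t1) w -> good (mkp y (v :: t1) w) /\ col y v = col u v.
Proof.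
move=> g yF yn; have [rq _ _] := g; have FH : col u v \in H.
  by apply: (rainbow_colH rq); rewrite mem_head.
have [Fu Fv] := col_mem card13 FH.
have E : col y v = col u v.
  by apply: (col_eq lin FH) => //; rewrite eq_sym (in_neq _ yn) // !inE eqxx orbT.
split=> //; apply: (good_same Umax g) => //.
- have := rainbow_uniq rq; rewrite !cons_uniq => /andP[_ ->]; rewrite andbT.
  by move: yn; rewrite inE negb_or => /andP[].
- by rewrite /= E.
- move=> x; rewrite inE => /predU1P[->|xt]; last by apply: span1; rewrite inE xt orbT.
  by apply: span2 Fu; rewrite -E mem_head.
Qed.

Lemma cross_of n x0 t s e (i : 'I_n) : n = (size t).-1 -> i \in front n x0 t s ->
  i \in back n x0 t e -> exists T1 a b T2,
  [/\ t = T1 ++ a :: b :: T2, adj s b, adj e a & size T1 = i /\ a = nth x0 t i].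
Proof.
rewrite !inE => En h1 h2; have hi : i < (size t).-1 by rewrite -En.
exists (take i t), (nth x0 t i), (nth x0 t i.+1), (drop i.+2 t); split=> //.
  exact: gapE.
by rewrite size_take; split=> //; case: ltnP => //; move: hi; move: (nat_of_ord i) (size t); clear; lia.
Qed.

Lemma disj_le n (A B : {set 'I_n}) : (forall i, i \in A -> i \in B -> False) ->
  #|A| + #|B| <= n.
Proof.
move=> h; have : #|A| + #|~: A| = n by rewrite cardsC card_ord.
have : B \subset ~: A.
  by apply/subsetP => i iB; rewrite inE; apply/negP => iA; apply: (h i).
by move/subset_leq_card; clear; lia.
Qed.

Lemma disj_compl n (A B : {set 'I_n}) : (forall i, i \in A -> i \in B -> False) ->
  #|A| + #|B| = n -> forall i, (i \in B) = (i \notin A).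
Proof.
move=> h; have cA : #|A| + #|~: A| = n by rewrite cardsC card_ord.
have sub : B \subset ~: A.
  by apply/subsetP => i iB; rewrite inE; apply/negP => iA; apply: (h i).
move=> E i; have /eqP -> : B == ~: A; last by rewrite inE.
by rewrite eqEcard sub; move: E cA; clear; lia.
Qed.

(** Without a crossing, [front] and [back] are disjoint among c - 2 gaps, so the two end degrees,
    each at least k/2, would sum to at most c < k. *)
Lemma ff_crossing u t w : best (mkp u t w) -> col u (head w t) \subset mkp u t w ->
  col (last u t) w \subset mkp u t w ->
  exists T1 a b T2 y, [/\ t = T1 ++ a :: b :: T2, b \in col u (head a T1),
    a \in col (last b T2) w &
    [/\ y \in col a b, y \notin mkp u t w &
      forall f, f \in cols (u :: rcons T1 a) ++ cols (b :: rcons T2 w) -> y \notin f]].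
Proof.
move=> bq o1 o2; have [gq _] := bq; have [Ec ut _ _ _] := mkp_facts gq.
have t0 : 0 < size t by move: c2; rewrite Ec; clear; lia.
pose n := (size t).-1.
have [/existsP[i /andP[i1 i2]]|hn] := boolP [exists i : 'I_n, (i \in front n u t u) && (i \in back n u t w)].
  have [T1 [a [b [T2 [Et g1 g2 _]]]]] := cross_of (erefl n) i1 i2.
  rewrite Et mkp_cat in bq; have [h1 h2 [y [y1 y2 y3]]] := bcross bq g1 g2.
  by exists T1, a, b, T2, y; split=> //; split=> //; rewrite Et mkp_cat.
have h : #|front n u t u| + #|back n u t w| <= n.
  by apply: disj_le => i i1 i2; case/negP: hn; apply/existsP; exists i; rewrite i1.
have d2 := dback (n := n) u gq (erefl _) t0; rewrite o2 in d2.
case: t t0 @n {hn} gq o1 ut bq o2 h d2 Ec => // v t1 _ n gq o1 _ _ _ h d2 Ec.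
have d1 := dfront (n := n) u gq (erefl _); rewrite [head _ _]/= in o1; rewrite o1 in d1.
have e1 := deg1 k4 dense sparse u; have e2 := deg1 k4 dense sparse w.
by move: h d1 d2 e1 e2 ck c2 Ec; rewrite /n /=; clear; lia.
Qed.

Lemma cat_head_uniq (X S R : seq V) a : uniq (X ++ a :: S) -> X ++ a :: S = a :: R ->
  X = [::].
Proof. by case: X => //= x X u [E _]; move: u; rewrite E mem_cat mem_head orbT. Qed.

(* Rerouting at the crossing gives another best path, whose own crossing would
   have to reuse the same edge. *)
Lemma no_ff u t w : best (mkp u t w) -> col u (head w t) \subset mkp u t w ->
  col (last u t) w \subset mkp u t w -> False.
Proof.
move=> bq o1 o2; have [T1 [a [b [T2 [y [Et h1 h2 [y1 y2 y3]]]]]]] := ff_crossing bq o1 o2.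
have [gq Iq] := bq; case: (gq) => rq sq _.
rewrite Et mkp_cat in bq gq rq sq y2 Iq o2.
set q := u :: _ in bq gq rq sq y2 Iq o2.
have [A EA] : exists A, A = u :: rcons T1 a by exists (u :: rcons T1 a).
have [B EB] : exists B, B = b :: T2 by exists (b :: T2).
pose w1 := last b T2.
have sA : seg u A a by rewrite EA; exists (rcons T1 a); rewrite ?last_rcons.
have sB : seg b B w1 by rewrite EB; exists T2.
have Eq : q = A ++ rcons B w by rewrite EA EB.
have EBw : b :: rcons T2 w = rcons B w by rewrite EB.
have sBw : seg b (rcons B w) w by rewrite EB; exists (rcons T2 w); rewrite ?last_rcons.
have EcB : cols (rcons B w) = rcons (cols B) (col w1 w) by rewrite EB cols_rcons.
have Ecq : cols q = cols A ++ col a b :: rcons (cols B) (col w1 w).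
  by rewrite Eq (cols_cat H sA sBw) EcB.
have uc := rainbow_cuniq rq; have uq := rainbow_uniq rq.
(* The rerouted path runs from [y] to [b], on to [w1], and from [a] back to [u]. The edge that
   joined [w1] to [w] now joins [w1] to [a], so [y] replaces [w]. *)
pose t2 := B ++ a :: rev T1.
have EP : mkp y t2 u = y :: B ++ rev A.
  by rewrite /t2 rcons_cat EA rev_cons rev_rcons.
have [aA uA] : a \in A /\ u \in A by case: (seg_mem sA).
have [bB w1B] := seg_mem sB.
have inq x : (x \in q) = (x \in A) || (x \in B) || (x == w).
  by rewrite Eq mem_cat mem_rcons inE; case: (x \in A); case: (x == w); rewrite ?orbT ?orbF.
have inP x : (x \in mkp y t2 u) = (x == y) || ((x \in A) || (x \in B)).
  by rewrite EP inE mem_cat mem_rev [(x \in B) || _]orbC.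
have aq : a \in q by rewrite inq aA.
have bq' : b \in q by rewrite inq bB orbT.
have w1q : w1 \in q by rewrite inq w1B orbT.
have wq : w \in q by rewrite inq eqxx orbT.
have gH : col a b \in H by apply: (rainbow_colH rq); rewrite Ecq mem_cat mem_head orbT.
have wH : col w1 w \in H.
  by apply: (rainbow_colH rq); rewrite Ecq mem_cat inE mem_rcons mem_head !orbT.
have [ga gb] := col_mem card13 gH; have [lw1 lw] := col_mem card13 wH.
move: (uq); rewrite Eq cat_uniq rcons_uniq => /and3P[uuA /hasPn dAB /andP[wB uB]].
have dA x : x \in B -> x \notin A by move=> xB; apply: dAB; rewrite mem_rcons inE xB orbT.
have wA : w \notin A by apply: dAB; rewrite mem_rcons mem_head.
have ab : a != b by rewrite (in_neq aA) // dA.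
have yb : y != b by rewrite eq_sym (in_neq bq').
have ay : a != y by rewrite (in_neq aq).
have E1 : col y b = col a b by apply: (col_eq lin gH).
have E2 : col w1 a = col w1 w.
  by apply: (col_eq lin wH) => //; rewrite eq_sym (in_neq aA) // dA.
have EcP : cols (mkp y t2 u) = col a b :: (cols B ++ col w1 w :: rev (cols A)).
  rewrite EP; have -> : y :: B ++ rev A = [:: y] ++ B ++ rev A by [].
  have sBA : seg b (B ++ rev A) u by apply: seg_cat sB (seg_rev sA).
  by rewrite (cols_cat H (seg1 y) sBA) (cols_cat H sB (seg_rev sA)) E1 E2 cols_rev.
have pc : perm_eq (cols (mkp y t2 u)) (cols q).
  by rewrite EcP Ecq; apply/permP => z; rewrite /= !count_cat /= -cats1 !count_cat count_rev /=; clear; lia.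
have yA : y \notin A by apply: contra y2; rewrite inq => ->.
have yB : y \notin B by apply: contra y2; rewrite inq => ->; rewrite orbT.
have uP : uniq (mkp y t2 u).
  rewrite EP cons_uniq mem_cat mem_rev negb_or yA yB /= cat_uniq uB rev_uniq uuA andbT /=.
  by apply/hasPn => x; rewrite mem_rev; apply: contraL; apply: dA.
have gP : good (mkp y t2 u).
  apply: (good_same Umax gq) => //.
    by rewrite EP Eq /= !size_cat size_rev size_rcons addnS addnC.
  move=> x; rewrite inq => /orP[h|/eqP->]; first by apply: span1; rewrite inP h orbT.
  by apply: span2 lw; rewrite EcP inE mem_cat mem_head !orbT.
(* The edge [ab] may now lie inside the path, but the former last edge, which did, now leaves it at
   [w]. *)
have bP : best (mkp y t2 u).
  split=> //; apply/eqP; rewrite eqn_leq Imax //= -Iq (perm_outer pc) /outer.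
  have pq : perm_eq (cols q) (col a b :: col w1 w :: (cols A ++ cols B)).
    by rewrite Ecq; apply/permP => z; rewrite /= !count_cat /= -cats1 !count_cat /=; clear; lia.
  have o2' : col w1 w \subset q by move: o2; rewrite last_cat.
  have n2 : (col w1 w \subset mkp y t2 u) = false.
    apply/negbTE/subsetPn; exists w => //; rewrite inP (negPf wA) (negPf wB) !orbF.
    by rewrite (in_neq wq).
  have cE P : count P (cols q) = P (col a b) + (P (col w1 w) + count P (cols A ++ cols B)).
    by rewrite (permP pq).
  rewrite !cE o2' n2; cbv beta.
  have : count (fun e : {set V} => ~~ (e \subset q)) (cols A ++ cols B) <=
      count (fun e : {set V} => ~~ (e \subset mkp y t2 u)) (cols A ++ cols B).
    apply: count_sub_le => f fc /subsetPn[x xf xq]; apply/subsetPn; exists x => //.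
    rewrite inP negb_or; apply/andP; split.
      apply: contraTneq xf => ->; apply: y3; rewrite -EA EBw EcB.
      by move: fc; rewrite !mem_cat mem_rcons inE => /orP[]->; rewrite ?orbT.
    by apply: contra xq; rewrite inq => ->.
  move: (count _ _) (count _ (cols A ++ cols B)) => m1 m2.
  by case: (_ \subset _); case: (_ \subset _); clear; lia.
pose v2 := head a T1.
have lt2 z : last z t2 = v2 by rewrite /t2 last_cat /= last_rev.
have v2A : v2 \in A.
  by rewrite /v2 EA inE mem_rcons; case: (T1) => [|x T]; rewrite ?mem_head ?inE ?eqxx ?orbT.
have v2u : u != v2.
  by move: uuA; rewrite EA /v2; case: (T1) => [|x T] /=; rewrite !inE ?negb_or => /andP[] // /andP[].
have FH : col u v2 \in H.
  apply: (rainbow_colH rq); rewrite Ecq mem_cat; apply/orP; left; rewrite EA /v2.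
  by case: (T1) => [|x T]; rewrite mem_head.
have [Fu Fv] := col_mem card13 FH.
have uF : uniq [:: u; v2; b].
  by rewrite /= !inE negb_or v2u (in_neq uA (dA _ bB)) (in_neq v2A (dA _ bB)).
have ug : uniq [:: a; b; y] by rewrite /= !inE negb_or ab ay eq_sym yb.
have Ht2 z : head z t2 = b by rewrite /t2 EB.
have [||T1' [a' [b' [T2' [y' [Et' h1' h2' _]]]]]] := ff_crossing bP.
- apply/subsetP => x; rewrite Ht2 E1 => xg; have := third_mem card13 gH ug ga gb y1 xg.
  by rewrite !inE -in_cons inP => /or3P[]/eqP->; rewrite ?aA ?bB ?eqxx ?orbT.
- apply/subsetP => x; rewrite lt2 colC => xF; have := third_mem card13 FH uF Fu Fv h1 xF.
  by rewrite !inE -in_cons inP => /or3P[]/eqP->; rewrite ?uA ?bB ?v2A ?eqxx ?orbT.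
have [_ ut2 yt2 ut2' _] := mkp_facts gP.
have bt2' : b' \in t2 by rewrite Et' mem_cat !inE eqxx !orbT.
have at2' : a' \in t2 by rewrite Et' mem_cat mem_head !orbT.
have hd : head a' T1' = b.
  by have := Ht2 a'; rewrite Et'; case: (T1').
have b'b : b' != b.
  move: ut2; rewrite Et' -hd cat_uniq => /and3P[_ /hasPn h /=].
  rewrite inE negb_or => /andP[/andP[ab' _] _].
  case: (T1') h => [|x T] h /=; first by rewrite eq_sym.
  by have := h b'; rewrite !inE eqxx orbT => /(_ isT); rewrite negb_or => /andP[].
(* The second crossing needs [b'] on the edge [ab] and [a'] on the first edge of [q], which forces
   [b'] = [a] and [a'] = [b]. Then [T2] is empty and the edges [ab] and [bw] coincide. *)
rewrite hd E1 in h1'; have := third_mem card13 gH ug ga gb y1 h1'.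
rewrite !inE (negPf b'b) /= => /orP[/eqP b'a|/eqP b'y]; last first.
  by rewrite -b'y bt2' in yt2.
have l' : last b' T2' = v2 by rewrite -(lt2 a') Et' last_cat.
have a'v : a' != v2.
  move: ut2; rewrite Et' cat_uniq => /and3P[_ _ /=] /andP[h _].
  by apply: contraNneq h => ->; rewrite -l' mem_last.
rewrite l' colC in h2'; have := third_mem card13 FH uF Fu Fv h1 h2'.
rewrite !inE (negPf a'v) /= => /orP[/eqP a'u|/eqP a'b].
  by rewrite -a'u at2' in ut2'.
have T10 : T1' = [::].
  case: T1' hd Et' => //= x T -> Et'; move: ut2; rewrite Et' a'b /=.
  by rewrite mem_cat inE eqxx orbT.
have T20 : T2 = [::].
  have ut2b : uniq (T2 ++ a :: rev T1).
    by move: ut2; rewrite /t2 EB cat_cons cons_uniq => /andP[].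
  apply: (cat_head_uniq ut2b (R := T2')).
  by move: Et'; rewrite T10 a'b b'a /t2 EB => -[].
move: uc lw1 h2; rewrite Ecq /w1 T20 /= => uc lw1 h2.
have wH' : col b w \in H by move: wH; rewrite /w1 T20.
have E3 : col b w = col a b by apply: (edges_share1 lin wH' gH ab) => //; rewrite /w1 T20 in lw1.
move: uc; rewrite E3 EB T20 cat_uniq /= => /and3P[_ _].
by rewrite mem_head.
Qed.
End PathEnd.

(** * Paths with an end edge that leaves them *)

Section Petals.
Variables (V : finType) (H : {set {set V}}).
Notation col := (col H). Notation cols := (cols H). Notation ccols := (ccols H).
Notation rainbow := (rainbow H). Notation rcyc := (rcyc H).
Notation adj := (adj H). Notation deg := (deg H). Notation D := (deg setT).
Notation UC := (UC H). Notation U := (U H).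

Hypothesis card13 : forall e, e \in H -> 0 < #|e| <= 3.
Hypothesis lin : linear_hg H.

Variable k : nat.
Hypothesis k4 : 4 <= k.
Hypothesis dense : (k - 1) * #|V| < \sum_x D x.
Hypothesis sparse : forall Y : {set V}, Y != setT ->
  \sum_(x in Y) deg Y x <= (k - 1) * #|Y|.
Variable c : nat.
Hypothesis ck : c.+1 <= k.
Hypothesis cmax : forall p, rainbow p -> size p <= c.+1.
Variable Nn : nat.
Hypothesis Umax : forall q, rainbow q -> size q = c.+1 -> #|U q| <= Nn.

Hypothesis c2 : 2 <= c.
Notation good := (good H c Nn).
Notation outer := (outer H).
Variable Im : nat.
Hypothesis Imax : forall q, good q -> outer q <= Im.
Notation best := (best H c Nn Im).
Notation mkp s t e := (s :: rcons t e).

Notation bcross := (best_crossing card13 lin k4 dense sparse ck cmax Umax c2 Imax).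
Notation blni := (best_last_not_inner card13 lin Umax Imax).
Notation cross := (crossing card13 lin k4 dense sparse ck cmax Umax c2).
Notation chainL := (chain card13 lin k4 dense sparse ck cmax c2).
Notation dfront := (deg_front card13 lin k4 dense sparse ck cmax c2).
Notation dback := (deg_back card13 lin k4 dense sparse ck cmax c2).
Notation nonadj := (ends_nonadj card13 lin k4 dense sparse ck cmax c2).
Notation front := (front H). Notation back := (back H).
Notation petal_good := (petal_good card13 lin Umax).

Section Front.
Variables (u v : V) (t1 : seq V) (w y : V).
Let t := v :: t1.
Let p := mkp u t w.
Hypothesis bp : best p.
Hypothesis yF : y \in col u v.
Hypothesis yn : y \notin p.

Let gp : good p. Proof. by case: bp. Qed.
Let gy : good (mkp y t w). Proof. by case: (petal_good gp yF yn). Qed.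
Let colY : col y v = col u v. Proof. by case: (petal_good gp yF yn). Qed.

Lemma first_edge : [/\ col u v \in H, u \in col u v, v \in col u v &
  forall x, x \in col u v -> x \in [:: u; v; y]].
Proof.
have [rq _ _] := gp; have FH : col u v \in H by apply: (rainbow_colH rq); rewrite mem_head.
have [m1 m2] := col_mem card13 FH; split=> // x; apply: (third_mem card13 FH _ m1 m2 yF).
have [_ _ ut _ _] := mkp_facts gp; have up : u \in p by rewrite mem_head.
have vp : v \in p by rewrite !inE eqxx orbT.
rewrite /= !inE !negb_or (in_neq up yn) (in_neq vp yn) !andbT.
by move: ut; rewrite inE negb_or => /andP[].
Qed.

Lemma adj_uy : adj u y.
Proof.
have [FH m1 m2 _] := first_edge; apply: (adj_edge lin FH) => //.
by rewrite (in_neq _ yn) // mem_head.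
Qed.

Lemma head_t T1 a b T2 : t = T1 ++ a :: b :: T2 -> head a T1 = v.
Proof. by rewrite /t; case: T1 => [|x T] [-> _]. Qed.

Lemma gap_notin_first T1 a b T2 : t = T1 ++ a :: b :: T2 -> b \notin col u v.
Proof.
move=> Et; have [_ _ _ h] := first_edge; apply/negP => /h; rewrite !inE.
have [_ ut us _ _] := mkp_facts gp.
have bt : b \in t by rewrite Et mem_cat !inE eqxx !orbT.
have bp' : b \in p by rewrite inE mem_rcons inE bt !orbT.
rewrite (negPf (in_neq bt us)) (negPf (in_neq bp' yn)) orbF /= => /eqP bv.
move: ut; rewrite Et bv; move: (head_t Et).
case: T1 {Et} => [|x T] /= ->; first by rewrite mem_head.
by rewrite mem_cat !inE eqxx !orbT.
Qed.

(** By [best_crossing] the vertex [b] would lie on the first edge, whose vertices are [u], [v] and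
    [y]. *)
Lemma no_cross_uw T1 a b T2 : t = T1 ++ a :: b :: T2 -> adj u b -> adj w a -> False.
Proof.
move=> Et g1 g2; have b0 := bp; rewrite /p Et mkp_cat in b0.
have [h _ _] := bcross b0 g1 g2; rewrite (head_t Et) in h.
by rewrite (negPf (gap_notin_first Et)) in h.
Qed.

Lemma w_notin_first : w \notin col u v.
Proof.
have [_ _ _ h] := first_edge; apply/negP => /h; rewrite !inE.
have [_ _ _ wt uw] := mkp_facts gp; have wp : w \in p by rewrite inE mem_rcons mem_head orbT.
rewrite eq_sym (negPf uw) (negPf (in_neq wp yn)) orbF /= => /eqP E.
by rewrite E mem_head in wt.
Qed.

(** The path from [y] is only known to be good, so [crossing] gives disjunctions. The first
    alternative at [b] fails as for [u]; the one at [w] is refuted on the best path from [u]. *)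
Lemma cross_yw T1 a b T2 : t = T1 ++ a :: b :: T2 -> adj y b -> adj w a ->
  y \in col b (head w T2) /\ a \in col (last b T2) w.
Proof.
move=> Et g1 g2; have g := gy; have b0 := bp; rewrite Et mkp_cat in g; rewrite /p Et mkp_cat in b0.
have [h1 h2 [z [z1 z2 z3]]] := cross g g1 g2.
rewrite (head_t Et) colY (negPf (gap_notin_first Et)) in h1.
split=> //; case/orP: h2 => // wa.
have Ec : cols (u :: rcons T1 a) = cols (y :: rcons T1 a).
  have := head_t Et; case: (T1) => [|x T] /= ->; by rewrite colY.
have Fin : col u v \in cols (y :: rcons T1 a).
  have := head_t Et; case: (T1) => [|x T] /= ->; by rewrite colY mem_head.
have zu : z != u.
  have [_ m1 _ _] := first_edge; apply/eqP => E.
  by have := z3 (col u v); rewrite mem_cat Fin E m1 => /(_ isT).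
have : w \notin col (last u T1) a.
  apply: (blni b0 z1); last by rewrite Ec.
  by move: z2; rewrite !inE !negb_or zu => /andP[_ ->].
have := head_t Et; case: (T1) wa => [|x T] /= wa ha; last by rewrite wa.
by move=> _; rewrite ha colY (negPf w_notin_first) in wa.
Qed.

Lemma chain_gap n T1 a b T2 : n = (size t).-1 -> t = T1 ++ a :: b :: T2 ->
  y \in col b (head w T2) ->
  (forall i : 'I_n, (i : nat) != size T1 -> (i \in front n u t u) = (i \in front n u t y)) ->
  False.
Proof.
move=> En Et yb hf.
have Et0 : v :: rcons t1 w = rcons T1 a ++ b :: head w T2 :: behead (rcons T2 w).
  by rewrite -[v :: _]/(rcons t w) Et rcons_cat cat_rcons /=; case: (T2).
have Er : head w T2 :: behead (rcons T2 w) = rcons T2 w by case: (T2).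
apply: (chainL gp gy yF yn Et0 (s := y) (s' := u)) => //; rewrite ?inE ?eqxx ?orbT //.
  by rewrite eq_sym (adj_neq adj_uy).
move=> z; rewrite Er mem_rcons inE => /predU1P[->|zT].
  by rewrite (negPf (nonadj gp (mkp_seg u t w))) (negPf (nonadj gy (mkp_seg y t w))).
pose j := size T1 + 1 + index z T2.
have ij : index z T2 < size T2 by rewrite index_mem.
have jn : j < n.
  have := congr1 size Et; rewrite size_cat [size (a :: _)]/= En /j => ->.
  by move: ij; move: (index z T2) (size T1) (size T2); clear; lia.
have Ej : nth u t j.+1 = z.
  rewrite Et nth_cat /j; have -> : (size T1 + 1 + index z T2).+1 < size T1 = false by move: (index z T2); clear; lia.
  have -> : (size T1 + 1 + index z T2).+1 - size T1 = (index z T2).+2 by move: (index z T2); clear; lia.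
  by rewrite /= nth_index.
have := hf (Ordinal jn); rewrite !inE /= -/t -[nth u t1 j]/(nth u t j.+1) Ej; apply.
by rewrite /j; move: (index z T2); clear; lia.
Qed.

(** By [deg2] for [u], [y] and [deg1] for [w], the sum D u + D y + 2 D w is at least 2k + 1; the gap
    counts bound it by 2c + 3, so all is tight. Then the fronts of [u] and [y] agree except at the
    single crossing of [y], where [chain_gap] applies. *)
Lemma no_petal_flat : col (last v t1) w \subset p -> False.
Proof.
move=> ow; have [Ec ut un wn uw] := mkp_facts gp.
pose n := (size t).-1.
have d1 := dfront (n := n) u gp (erefl _); have d2 := dfront (n := n) u gy (erefl _).
have d3 := dback (n := n) u gp (erefl _) (ltn0Sn _); rewrite [last _ _]/= ow in d3.
have d1' : D u <= #|front n u t u| + 2 by apply: leq_trans d1 _; rewrite -addnA; apply: leq_add => //; case: (~~ _).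
have d2' : D y <= #|front n u t y| + 2 by apply: leq_trans d2 _; rewrite -addnA; apply: leq_add => //; case: (~~ _).
have dis : forall i : 'I_n, i \in front n u t u -> i \in back n u t w -> False.
  move=> i i1 i2; have [T1 [a [b [T2 [Et g1 g2 _]]]]] := cross_of (erefl n) i1 i2.
  exact: no_cross_uw Et g1 g2.
have le1 := disj_le dis.
(* The left vertex of each such crossing lies on the last edge, which has room for one vertex
   besides [last v t1] and [w]. *)
have one : #|front n u t y :&: back n u t w| <= 1.
  apply/card_le1_eqP => i j; rewrite !in_setI => /andP[i1 i2] /andP[j1 j2].
  have [T1 [a [b [T2 [Et g1 g2 [s1 a1]]]]]] := cross_of (erefl n) i1 i2.
  have [T1' [a' [b' [T2' [Et' g1' g2' [s1' a1']]]]]] := cross_of (erefl n) j1 j2.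
  have [_ h] := cross_yw Et g1 g2; have [_ h'] := cross_yw Et' g1' g2'.
  have l1 : last b T2 = last v t1 by have := congr1 (last v) Et; rewrite /= last_cat.
  have l1' : last b' T2' = last v t1 by have := congr1 (last v) Et'; rewrite /= last_cat.
  rewrite l1 in h; rewrite l1' in h'.
  have lt : last v t1 \in t by rewrite mem_last.
  have [rq _ _] := gp.
  have LH : col (last v t1) w \in H.
    by apply: (rainbow_colH rq); rewrite /p cols_rcons mem_rcons; apply: mem_head.
  have [m1 m2] := col_mem card13 LH.
  have al x y0 X Y : t = X ++ x :: y0 :: Y -> x != last v t1.
    move=> E; have := congr1 (last v) E; rewrite /= last_cat /= => ->.
    by move: ut; rewrite E cat_uniq => /and3P[_ _ /= /andP[hx _]]; apply: contraNneq hx => ->; rewrite mem_last.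
  have at_ : a \in t by rewrite Et mem_cat mem_head orbT.
  have at_' : a' \in t by rewrite Et' mem_cat mem_head orbT.
  have u3 : uniq [:: last v t1; w; a].
    by rewrite /= !inE negb_or (in_neq lt wn) eq_sym (al _ _ _ _ Et) eq_sym (in_neq at_ wn).
  have := third_mem card13 LH u3 m1 m2 h h'; rewrite !inE (negPf (al _ _ _ _ Et')).
  rewrite (negPf (in_neq at_' wn)) /= => /eqP E.
  have lti (x : 'I_n) : x < size t by apply: leq_trans (ltn_ord x) _; rewrite /n leq_pred.
  by apply/val_inj/eqP; rewrite /= -(nth_uniq u _ _ ut) ?lti // -a1 -a1' E.
have un_le : #|front n u t y :|: back n u t w| <= n by rewrite -[leqRHS]card_ord max_card.
have cU := cardsU (front n u t y) (back n u t w).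
have cI : #|front n u t y :&: back n u t w| <= #|front n u t y|.
  by apply: subset_leq_card; apply: subsetIl.
have e1 := deg2 k4 dense sparse adj_uy; have e2 := deg1 k4 dense sparse w.
have En : n.+2 = c by rewrite Ec /n /=.
have [f1 [f2 f3]] : #|front n u t u| + #|back n u t w| = n /\
   #|front n u t y :&: back n u t w| = 1 /\ #|front n u t y :|: back n u t w| = n.
  rewrite /= in d3; move: d1' d2' d3 le1 one un_le cU cI e1 e2 En ck.
  move: #|front n u t u| #|front n u t y| #|back n u t w| #|_ :|: _| #|_ :&: _| (D u) (D y) (D w).
  by clearbody n; clear; lia.
have hB := disj_compl dis f1.
move/eqP/cards1P: f2 => [i Ei].
have : i \in front n u t y :&: back n u t w by rewrite Ei inE.
rewrite in_setI => /andP[i1 i2].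
have [T1 [a [b [T2 [Et g1 g2 [s1 _]]]]]] := cross_of (erefl n) i1 i2.
have [h _] := cross_yw Et g1 g2.
apply: (chain_gap (erefl n) Et h) => j; rewrite s1 => ji.
have full : j \in front n u t y :|: back n u t w.
  have /eqP -> : (front n u t y :|: back n u t w) == setT; last by rewrite inE.
  by rewrite eqEcard subsetT cardsT card_ord f3 leqnn.
have nI : (j \in front n u t y) && (j \in back n u t w) = false.
  by rewrite -in_setI Ei inE; apply: contraNF ji => /eqP->.
move: full nI; rewrite in_setU hB.
by case: (j \in front n u t u); case: (j \in front n u t y).
Qed.
End Front.
Section Both.
Variables (u v : V) (t1 : seq V) (w y y' : V).
Let t := v :: t1.
Let p := mkp u t w.
Let vl := last v t1.
Let r1 := rev (belast v t1).
Hypothesis bp : best p.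
Hypothesis yF : y \in col u v.
Hypothesis yn : y \notin p.
Hypothesis yF' : y' \in col vl w.
Hypothesis yn' : y' \notin p.

Let gp : good p. Proof. by case: bp. Qed.

Lemma rev_t : rev t = vl :: r1.
Proof. by rewrite /t lastI rev_rcons. Qed.

Lemma rev_best : best (mkp w (vl :: r1) u).
Proof. by have := best_rev bp; rewrite mkp_rev rev_t. Qed.

Lemma rev_yF : y' \in col w vl. Proof. by rewrite colC. Qed.

Lemma rev_yn : y' \notin mkp w (vl :: r1) u.
Proof. by rewrite -rev_t -mkp_rev mem_rev. Qed.

Lemma rev_vl : last vl r1 = v.
Proof.
by have := last_rev vl t; rewrite rev_t.
Qed.

Lemma rev_gap T1 a b T2 : t = T1 ++ a :: b :: T2 -> vl :: r1 = rev T2 ++ b :: a :: rev T1.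
Proof. by rewrite -rev_t => ->; rewrite rev_cat !rev_cons -!cats1 -!catA. Qed.

Lemma last_gap T1 a b T2 : t = T1 ++ a :: b :: T2 -> last b T2 = vl.
Proof. by move=> Et; have := congr1 (last v) Et; rewrite /= last_cat. Qed.

Let gy : good (mkp y t w). Proof. by case: (petal_good gp yF yn). Qed.
Let colY : col y v = col u v. Proof. by case: (petal_good gp yF yn). Qed.

Lemma gp_end : good (mkp u t y').
Proof.
have [g _] := petal_good (proj1 rev_best) rev_yF rev_yn.
by have := good_rev g; rewrite mkp_rev -rev_t revK.
Qed.

Lemma colY' : col y' vl = col w vl.
Proof. by case: (petal_good (proj1 rev_best) rev_yF rev_yn). Qed.

Lemma last_edge x : x \in col w vl -> x \in [:: w; vl; y'].
Proof. by case: (first_edge rev_best rev_yF rev_yn) => _ _ _; apply. Qed.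

Lemma vl_t : vl \in t. Proof. by rewrite mem_last. Qed.

Lemma in_t_p x : x \in t -> x \in p.
Proof. by move=> xt; rewrite inE mem_rcons inE xt !orbT. Qed.

(** A common third vertex would close [t] to a cycle of length [c]. *)
Lemma petals_neq : y != y'.
Proof.
apply/eqP => E; have [FH m1 m2 _] := first_edge bp yF yn.
have [LH l1 l2 _] := first_edge rev_best rev_yF rev_yn.
have [Ec ut un wn uw] := mkp_facts gp.
have yt : y \notin t by apply: contra yn; apply: in_t_p.
have [rq sq _] := gp; have uc := rainbow_cuniq rq.
have Ecp : cols p = col u v :: rcons (cols t) (col vl w).
  by rewrite /p -[mkp u t w]/(u :: v :: rcons t1 w) -[LHS]/(col u v :: cols (v :: rcons t1 w)) cols_rcons.
have Lv : col vl y = col vl w by rewrite E colC colY' colC.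
have Fn : col u v \notin rcons (cols t) (col vl w) by move: uc; rewrite Ecp => /andP[].
have [t0|t0] := eqVneq t1 [::].
  have vv : vl = v by rewrite /vl t0.
  by case/negP: Fn; rewrite mem_rcons -Lv vv (colC _ v y) colY mem_head.
have := no_cycle_size card13 lin k4 dense sparse ck cmax (C := rcons t y).
rewrite size_rcons -Ec eqxx => h; suff: false by []. apply: h.
have sg : seg v (rcons t y) y by exists (rcons t1 y); rewrite ?last_rcons.
have EcC : cols (rcons t y) = rcons (cols t) (col vl w).
  by rewrite -Lv -[rcons t y]/(v :: rcons t1 y) cols_rcons.
apply: (rcyc_intro sg).
- by rewrite size_rcons /=; case: (t1) t0.
- apply: rainbow_intro; first by rewrite rcons_uniq yt ut.
    move=> f; rewrite EcC => hf; apply: (rainbow_colH rq); by rewrite Ecp inE hf orbT.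
  by rewrite EcC; move: uc; rewrite Ecp => /andP[].
- by rewrite colY.
- by rewrite colY EcC.
Qed.

Lemma gyy : good (mkp y t y').
Proof.
have [] // := petal_good gp_end yF _.
apply: contra yn; rewrite !inE !mem_rcons !inE (negPf petals_neq) /=.
by case/or3P=> ->; rewrite ?orbT.
Qed.

Lemma no_cross_uy' T1 a b T2 : t = T1 ++ a :: b :: T2 -> adj u b -> adj y' a -> False.
Proof.
move=> Et g1 g2; have [_] := cross_yw rev_best rev_yF rev_yn (rev_gap Et) g2 g1.
rewrite last_rev (head_t Et) colC => h.
by rewrite (negPf (gap_notin_first bp yF yn Et)) in h.
Qed.

Lemma no_cross_yw T1 a b T2 : t = T1 ++ a :: b :: T2 -> adj y b -> adj w a -> False.
Proof.
move=> Et g1 g2; have [_] := cross_yw bp yF yn Et g1 g2.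
rewrite (last_gap Et) colC => h.
by rewrite (negPf (gap_notin_first rev_best rev_yF rev_yn (rev_gap Et))) in h.
Qed.

(** By [crossing], [y] lies on the edge after [b] in the path ending at [y']. That edge cannot be
    the last one, whose vertices are [w], [vl] and [y']. *)
Lemma cross_yy' T1 a b T2 : t = T1 ++ a :: b :: T2 -> adj y b -> adj y' a ->
  y \in col b (head w T2).
Proof.
move=> Et g1 g2; have g := gyy; rewrite Et mkp_cat in g.
have [h1 _ _] := cross g g1 g2.
rewrite (head_t Et) colY (negPf (gap_notin_first bp yF yn Et)) /= in h1.
have := last_gap Et; case: (T2) h1 => //= h1 bl; rewrite bl colC colY' in h1.
have := last_edge h1; rewrite !inE (negPf petals_neq) orbF.
have wp : w \in p by rewrite inE mem_rcons mem_head orbT.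
by rewrite ![y == _]eq_sym (negPf (in_neq wp yn)) (negPf (in_neq (in_t_p vl_t) yn)).
Qed.

(** The pair bounds at the two ends sum to 2k + 2, the gap counts to at most 2c + 4, so all
    estimates are tight. Were the fronts of [u] and [y] different, they would differ in one index, a
    crossing of [y] and [y'], and [chain_gap] would apply there. *)
Lemma both_main n : n = (size t).-1 ->
  [/\ c.+1 = k, 2 * D u = k.+1, 2 * D y = k.+1,
   forall i, (i \in front n u t u) = (i \in front n u t y) &
   forall i, (i \in back n u t w) = (i \notin front n u t u)].
Proof.
move=> Hn; have [Ec ut un wn uw] := mkp_facts gp.
have d1 := dfront u gp Hn; have d2 := dfront u gy Hn.
have d3 := dback u gp Hn (ltn0Sn _); have d4 := dback u gp_end Hn (ltn0Sn _).
have d1' : D u <= #|front n u t u| + 2.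
  by apply: leq_trans d1 _; rewrite -addnA; apply: leq_add => //; case: (~~ _).
have d2' : D y <= #|front n u t y| + 2.
  by apply: leq_trans d2 _; rewrite -addnA; apply: leq_add => //; case: (~~ _).
have d3' : D w <= #|back n u t w| + 2.
  by apply: leq_trans d3 _; rewrite -addnA; apply: leq_add => //; case: (~~ _).
have d4' : D y' <= #|back n u t y'| + 2.
  by apply: leq_trans d4 _; rewrite -addnA; apply: leq_add => //; case: (~~ _).
have dis1 : forall i : 'I_n, i \in front n u t u -> i \in back n u t w -> False.
  move=> i i1 i2; have [T1 [a [b [T2 [Et g1 g2 _]]]]] := cross_of Hn i1 i2.
  exact: (no_cross_uw bp yF yn Et g1 g2).
have dis2 : forall i : 'I_n, i \in front n u t u -> i \in back n u t y' -> False.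
  move=> i i1 i2; have [T1 [a [b [T2 [Et g1 g2 _]]]]] := cross_of Hn i1 i2.
  exact: (no_cross_uy' Et g1 g2).
have dis3 : forall i : 'I_n, i \in front n u t y -> i \in back n u t w -> False.
  move=> i i1 i2; have [T1 [a [b [T2 [Et g1 g2 _]]]]] := cross_of Hn i1 i2.
  exact: (no_cross_yw Et g1 g2).
have l1 := disj_le dis1; have l2 := disj_le dis2; have l3 := disj_le dis3.
have e1 := deg2 k4 dense sparse (adj_uy bp yF yn).
have e2 := deg2 k4 dense sparse (adj_uy rev_best rev_yF rev_yn).
have e3 := deg1 k4 dense sparse u; have e4 := deg1 k4 dense sparse y.
have En : n.+2 = c by rewrite Ec Hn /=.
have [q1 [q2 [q3 [q4 [q5 q6]]]]] : c.+1 = k /\ #|front n u t u| + #|back n u t y'| = n /\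
  #|front n u t y| + #|back n u t w| = n /\ D u = #|front n u t u| + 2 /\
  D y = #|front n u t y| + 2 /\ D u + D y = k.+1.
  move: d1' d2' d3' d4' l1 l2 l3 e1 e2 En ck.
  move: #|front n u t u| #|front n u t y| #|back n u t w| #|back n u t y'| (D u) (D y) (D w) (D y').
  by clear; lia.
have c1 := disj_compl dis2 q2; have c3 := disj_compl dis3 q3.
have sub : front n u t u \subset front n u t y.
  by apply/subsetP => i iu; apply/negPn; rewrite -c3; apply/negP => /(dis1 i iu).
have E : front n u t u = front n u t y.
  apply/eqP; rewrite eqEcard sub /= leqNgt; apply/negP => lt.
  have cD : #|front n u t y :\: front n u t u| = 1.
    rewrite cardsD (setIidPr sub); move: lt q4 q5 q6 e3; clear.
    by move: #|front n u t u| #|front n u t y|; lia.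
  move/eqP/cards1P: cD => [i Ei].
  have : i \in front n u t y :\: front n u t u by rewrite Ei inE.
  rewrite in_setD => /andP[i1 i2].
  have i3 : i \in back n u t y' by rewrite c1.
  have [T1 [a [b [T2 [Et g1 g2 [s1 _]]]]]] := cross_of Hn i2 i3.
  apply: (chain_gap bp yF yn Hn Et (cross_yy' Et g1 g2)) => j; rewrite s1 => ji.
  have nj : j \notin front n u t y :\: front n u t u.
    by rewrite Ei inE; apply: contra ji => /eqP->.
  move: nj (subsetP sub j); rewrite in_setD -/t; case: (j \in front n u t u); case: (j \in front n u t y) => //.
  by move=> _ /(_ isT).
rewrite E in q4; split=> //; rewrite ?E //.
- by rewrite q4 -q5; move: q4 q5 q6; clear; lia.
- by move: q4 q5 q6; clear; lia.
Qed.

Lemma same_adj z : z \in rcons t w -> adj u z = adj y z.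
Proof.
have [_ _ _ h _] := both_main (erefl _).
rewrite mem_rcons inE => /predU1P[->|].
  by rewrite (negPf (nonadj gp (mkp_seg u t w))) (negPf (nonadj gy (mkp_seg y t w))).
rewrite inE => /predU1P[->|zt].
  have [FH m1 m2 _] := first_edge bp yF yn; have vp : v \in p by apply: in_t_p; rewrite mem_head.
  have [_ _ un _ _] := mkp_facts gp.
  rewrite !(adj_edge lin FH) //; first by rewrite eq_sym (in_neq vp yn).
  by move: un; rewrite inE negb_or => /andP[].
have hi : index z t1 < (size t).-1 by rewrite /= index_mem.
by have := h (Ordinal hi); rewrite !inE /= nth_index.
Qed.

Lemma no_inner f s : f \in cols (rcons t w) -> s \in [:: u; y] -> s \notin f.
Proof.
move/mem_cols => [L1 [x [x' [L2 [Et ->]]]]] hs; apply/negP => sx.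
have uy : u != y := adj_neq (adj_uy bp yF yn).
have sa z : z \in x' :: L2 -> adj u z = adj y z.
  by move=> zL; apply: same_adj; rewrite Et mem_cat inE zL !orbT.
have [s' [hs' ss]] : exists s', s' \in [:: u; y] /\ s != s'.
  move: hs; rewrite !inE => /orP[]/eqP->.
    by exists y; rewrite !inE eqxx orbT.
  by exists u; rewrite mem_head (eq_sym y u).
exact: (chainL gp gy yF yn Et hs hs' ss sx sa).
Qed.
End Both.

(** With this chord, [u] and [v] can be exchanged to give a best path with the same third vertices,
    so by [both_main] also [v] has degree (k + 1)/2. The triangle [u], [v], [y] then just misses
    [deg3]. *)
Lemma no_short_chord u v v3 t2 w y y' (t := v :: v3 :: t2) (p := mkp u t w) :
  best p -> y \in col u v -> y \notin p -> y' \in col (last v3 t2) w -> y' \notin p ->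
  ~~ adj u v3.
Proof.
move=> bp yF yn yF' yn'; apply/negP => g.
have [gp Ip] := bp; case: (gp) => rq sq Uq.
have [ck1 du dy _ _] := both_main bp yF yn yF' yn' (erefl _).
have [FH Fu Fv F3] := first_edge bp yF yn.
have [Ec ut un wn uw] := mkp_facts gp.
have Ecp : cols p = col u v :: col v v3 :: cols (v3 :: rcons t2 w) by [].
have uc := rainbow_cuniq rq; rewrite Ecp in uc.
have uq := rainbow_uniq rq.
have v3t : v3 \in t by rewrite !inE eqxx orbT.
have v3p : v3 \in p by rewrite !inE eqxx !orbT.
have vp : v \in p by rewrite !inE eqxx !orbT.
have vv3 : v != v3 by move: ut; rewrite /= inE negb_or => /andP[/andP[]].
have uv : u != v by move: un; rewrite inE negb_or => /andP[].
have [m1 m2] := col_mem card13 (adj_col g).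
have fF : col u v3 != col u v.
  apply/eqP => E; rewrite E in m2; have := F3 _ m2; rewrite !inE ![v3 == _]eq_sym.
  by rewrite (negPf (adj_neq g)) (negPf vv3) eq_sym (negPf (in_neq v3p yn)).
have fn : col u v3 \notin cols (rcons t w).
  apply/negP => hf; have := no_inner bp yF yn yF' yn' hf (mem_head u _).
  by rewrite m1.
have fn2 : col u v3 \notin cols (v3 :: rcons t2 w).
  by move: fn; rewrite -[cols (rcons t w)]/(col v v3 :: cols (v3 :: rcons t2 w)) inE negb_or => /andP[].
have cH f : f \in cols p -> f \in H by apply: rainbow_colH.
have vH : col v v3 \in H by apply: cH; rewrite Ecp !inE eqxx orbT.
have [k1 k2] := col_mem card13 vH.
have nv : col v v3 != col u v3.
  by apply: contraNneq fn => <-; rewrite mem_head.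
have uvq : uniq [:: col u v, col u v3 & cols (v3 :: rcons t2 w)].
  move: uc; rewrite !cons_uniq !inE !negb_or => /and3P[/andP[_ n1] _ n3].
  by rewrite eq_sym fF n1 fn2 n3.
(* This edge is given up in the exchange. A third vertex off the path could be put before [v] to
   lengthen the path, so no covered vertex is lost. *)
have sub : col v v3 \subset p.
  apply/subsetP => z zv; apply/negPn/negP => zp.
  pose P := z :: v :: u :: v3 :: rcons t2 w.
  have zE : col z v = col v v3 by apply: (col_eq lin vH) => //; rewrite eq_sym (in_neq vp zp).
  have EcP : cols P = [:: col v v3, col u v, col u v3 & cols (v3 :: rcons t2 w)].
    by rewrite /P -[LHS]/[:: col z v, col v u, col u v3 & cols (v3 :: rcons t2 w)] zE (colC _ v u).
  have pP : perm_eq P (z :: p) by rewrite perm_cons; apply/permP => x /=; clear; lia.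
  have rP : rainbow P.
    apply: rainbow_intro.
    - by rewrite (perm_uniq pP) cons_uniq zp uq.
    - move=> f; rewrite EcP !inE => /or4P[/eqP->|/eqP->|/eqP->|hf] //; first exact: adj_col.
      by apply: cH; rewrite Ecp !inE hf !orbT.
    - rewrite EcP cons_uniq uvq andbT !inE !negb_or nv.
      move: uc; rewrite !cons_uniq !inE !negb_or => /and3P[/andP[n0 _] n2 _].
      by rewrite eq_sym n0 n2.
  by have := cmax rP; rewrite (perm_size pP) -[size _]/(size p).+1 sq ltnn.
pose q := mkp v (u :: v3 :: t2) w.
have Ecq : cols q = [:: col u v, col u v3 & cols (v3 :: rcons t2 w)].
  by rewrite /q -[LHS]/[:: col v u, col u v3 & cols (v3 :: rcons t2 w)] (colC _ v u).
have pq : perm_eq q p by apply/permP => x /=; clear; lia.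
have mq x : (x \in q) = (x \in p) by rewrite (perm_mem pq).
have rq' : rainbow q.
  apply: rainbow_intro; rewrite ?Ecq //; first by rewrite (perm_uniq pq).
  move=> f; rewrite !inE => /or3P[/eqP->|/eqP->|hf] //; first exact: adj_col.
  by apply: cH; rewrite Ecp !inE hf !orbT.
have gq : good q.
  have sq' : size q = c.+1 by rewrite -sq.
  split=> //; apply/eqP; rewrite eqn_leq Umax //= -Uq.
  apply: subset_leq_card; apply/subsetP => x /mem_span[xp|[f]].
    by apply: span1; rewrite mq.
  move=> hf xf; have h : [|| f == col u v, f == col v v3 | f \in cols (v3 :: rcons t2 w)].
    by move: hf; rewrite Ecp !inE.
  case/or3P: h => [/eqP E|/eqP E|{}hf]; rewrite ?E in xf.
  - by apply: span2 xf; rewrite Ecq mem_head.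
  - by apply: span1; rewrite mq (subsetP sub).
  - by apply: span2 xf; rewrite Ecq !inE hf !orbT.
have bq : best q.
  split=> //; apply/eqP; rewrite eqn_leq Imax //= -Ip /outer.
  have e2 (f : {set V}) : (f \subset q) = (f \subset p) by apply: eq_subset_r => x; rewrite mq.
  pose F := fun f : {set V} => ~~ (f \subset p).
  have -> : count (fun f : {set V} => ~~ (f \subset q)) (cols q) = count F (cols q).
    by apply: eq_count => f; rewrite e2.
  have cE f1 f2 L : count F (f1 :: f2 :: L) = F f1 + (F f2 + count F L) by [].
  have F0 : F (col v v3) = false by rewrite /F sub.
  by rewrite -/F Ecp Ecq !cE F0 leq_add2l leq_add2r; case: (F _).
have ynq : y \notin q by rewrite mq.
have ynq' : y' \notin q by rewrite mq.
have yFq : y \in col v u by rewrite colC.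
have [_ dv _ _ _] := both_main bq yFq ynq yF' ynq' (erefl _).
have a1 : adj u v by apply: (adj_edge lin FH).
have a2 := adj_uy bp yF yn.
have a3 : adj y v by apply: (adj_edge lin FH) => //; rewrite eq_sym (in_neq vp yn).
by have := deg3 k4 dense sparse a2 a1 a3; move: du dy dv k4; clear; lia.
Qed.

(** As the short chords are missing, tightness makes [w] adjacent to [v] and [u] to the last vertex
    of [t]. Both colours are new, so [w], [t], [u], [y] in this order is a path with one vertex too
    many. *)
Lemma no_two_petals u v t1 w y y' (t := v :: t1) (p := mkp u t w) :
  best p -> y \in col u v -> y \notin p -> y' \in col (last v t1) w -> y' \notin p -> False.
Proof.
move=> bp yF yn yF' yn'.
have [gp _] := bp; case: (gp) => rq sq _.
have [ck1 du _ _ hB] := both_main bp yF yn yF' yn' (erefl _).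
have [Ec ut un wn uw] := mkp_facts gp.
pose vl := last v t1; pose r1 := rev (belast v t1).
have rb := rev_best bp; have rF := rev_yF yF'; have rn := rev_yn yn'.
have rvl := rev_vl v t1; rewrite -/vl -/r1 in rb rF rn rvl.
have rF' : y \in col (last vl r1) u by rewrite rvl colC.
have rn' : y \notin mkp w (vl :: r1) u by rewrite -rev_t -mkp_rev mem_rev.
have [_ _ _ _ hB'] := both_main rb rF rn rF' rn' (erefl _).
have szr : size (vl :: r1) = size t by rewrite -rev_t size_rev.
(* By [both_main] k is odd, hence at least 5, and [c] is at least 4. *)
have sz3 : 3 <= size t by move: ck1 du k4; rewrite Ec; move: (D u) (size t); clear; lia.
have awv : adj w v.
  case: (t1) @t @p bp yF yn yF' yn' hB sz3 {gp rq sq Ec ut un wn uw vl r1 rb rF rn rvl rF' rn' hB' szr} => // v3 t2 t p bp yF yn yF' yn' hB sz3.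
  have h0 : 0 < (size t).-1 by [].
  have := hB (Ordinal h0); rewrite !inE /= => ->; exact: (no_short_chord bp yF yn yF' yn').
have auv : adj u vl.
  move: r1 rb rF rn rvl rF' rn' hB' szr => r1; case: r1 => [|v3 t2] rb rF rn rvl rF' rn' hB' szr.
    by rewrite -szr in sz3.
  have h0 : 0 < (size (vl :: v3 :: t2)).-1 by [].
  have := hB' (Ordinal h0); rewrite !inE /= => ->; exact: (no_short_chord rb rF rn rF' rn').
have [FH Fu Fv F3] := first_edge bp yF yn.
have L3 := last_edge bp yF' yn'.
have vlt : vl \in t by rewrite mem_last.
have vt : v \in t by rewrite mem_head.
have inp x : x \in t -> x \in p by move=> xt; rewrite inE mem_rcons inE xt !orbT.
have vvl : v != vl.
  move: ut sz3; rewrite /t /vl; case: (t1) => // x T /= /andP[h _] _.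
  by apply: contraNneq h => ->; rewrite mem_last.
have [w1 w2] := col_mem card13 (adj_col awv); have [u1 u2] := col_mem card13 (adj_col auv).
have Ecp : cols p = col u v :: cols (rcons t w) by [].
have Ecp2 : cols p = rcons (cols (u :: t)) (col vl w) by rewrite /p cols_rcons.
have nu : col u vl \notin cols p.
  rewrite Ecp inE negb_or; apply/andP; split.
    apply/eqP => E; rewrite E in u2; have := F3 _ u2; rewrite !inE.
    by rewrite (negPf (in_neq vlt un)) eq_sym (negPf vvl) (negPf (in_neq (inp _ vlt) yn)).
  apply/negP => hf; have := no_inner bp yF yn yF' yn' hf (mem_head u _).
  by rewrite u1.
have nw : col w v \notin cols p.
  rewrite Ecp2 mem_rcons inE negb_or; apply/andP; split.
    apply/eqP => E; rewrite E colC in w2; have := L3 _ w2; rewrite !inE.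
    by rewrite (negPf (in_neq vt wn)) (negPf vvl) (negPf (in_neq (inp _ vt) yn')).
  apply/negP => hf; have hf' : col w v \in cols (rcons (vl :: r1) u).
    by rewrite -rev_t -rev_cons cols_rev mem_rev.
  have := no_inner rb rF rn rF' rn' hf' (mem_head w _).
  by rewrite w1.
have nuw : col w v != col u vl.
  apply/eqP => E; rewrite E in w1 w2; apply: (no4 card13 (adj_col auv) _ u1 u2 w1 w2).
  rewrite /= !inE !negb_or uw ![u == _]eq_sym (in_neq vlt un) (in_neq vt un) (in_neq vlt wn).
  by rewrite eq_sym vvl eq_sym (in_neq vt wn).
have uyE : col u y = col u v by apply: (col_eq lin FH) => //; apply: adj_neq (adj_uy bp yF yn).
pose P := w :: rcons (rcons t u) y.
have EcP : cols P = rcons (rcons (col w v :: cols t) (col u vl)) (col u v).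
  rewrite /P cols_rcons last_rcons uyE cols_rcons (colC _ _ u).
  by [].
have pP : perm_eq P (y :: p).
  by apply/permP => x; rewrite /P /p /= -!cats1 !count_cat /=; clear; lia.
have ct f : f \in cols t -> f \in cols (rcons t w).
  by move=> hf; rewrite -[rcons t w]/(v :: rcons t1 w) cols_rcons mem_rcons inE hf orbT.
have uc := rainbow_cuniq rq; have uq := rainbow_uniq rq.
have rP : rainbow P.
  apply: rainbow_intro.
  - by rewrite (perm_uniq pP) cons_uniq yn uq.
  - move=> f; rewrite EcP mem_rcons inE mem_rcons !inE => /or4P[/eqP->|/eqP->|/eqP->|hf] //; try exact: adj_col.
    by apply: (rainbow_colH rq); rewrite Ecp inE ct ?orbT.
  - rewrite EcP !rcons_uniq mem_rcons !inE !negb_or cons_uniq.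
    move: uc; rewrite Ecp cons_uniq => /andP[n1 n2].
    have n3 : uniq (cols t).
      by move: n2; rewrite -[rcons t w]/(v :: rcons t1 w) cols_rcons rcons_uniq => /andP[].
    move: nu nw; rewrite !Ecp !inE !negb_or => /andP[a1 a2] /andP[b1 b2].
    rewrite eq_sym a1 [col u v == _]eq_sym b1 [col u vl == _]eq_sym nuw n3 !andbT /=.
    have ct' f : f \notin cols (rcons t w) -> f \notin cols t by apply: contra; apply: ct.
    by rewrite !ct'.
by have := cmax rP; rewrite (perm_size pP) -[size _]/(size p).+1 sq ltnn.
Qed.

Lemma no_best p : ~ best p.
Proof.
move=> bp; have [gp _] := bp; case: (gp) => _ sq _.
case: p sq gp bp => [//|u s] sq gp bp.
case/lastP: s sq gp bp => [|t w] sq gp bp; first by case: sq c2 => <-.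
case: t sq gp bp => [|v t1] sq gp bp; first by case: sq c2 => <-.
have [o1|/subsetPn[y yF yn]] := boolP (col u v \subset mkp u (v :: t1) w).
  have [o2|/subsetPn[y yF yn]] := boolP (col (last v t1) w \subset mkp u (v :: t1) w).
    exact: (no_ff card13 lin k4 dense sparse ck cmax Umax c2 Imax bp).
  have rb := rev_best bp; have rF := rev_yF yF; have rn := rev_yn yn.
  apply: (no_petal_flat rb rF rn); rewrite rev_vl -rev_t -mkp_rev colC.
  by apply/subsetP => x /(subsetP o1); rewrite mem_rev.
have [o2|/subsetPn[y' yF' yn']] := boolP (col (last v t1) w \subset mkp u (v :: t1) w).
  exact: (no_petal_flat bp yF yn o2).
exact: (no_two_petals bp yF yn yF' yn').
Qed.
End Petals.

(** * Choice of the extremal path *)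

Lemma exists_max (A : Type) (P : A -> Prop) (f : A -> nat) b :
  (exists x, P x) -> (forall x, P x -> f x <= b) ->
  exists x, P x /\ forall y, P y -> f y <= f x.
Proof.
move=> [x Px] hb; have [m] : exists m, b - f x <= m by exists (b - f x).
elim: m x Px => [|m IH] x Px hm.
  by exists x; split=> // y /hb; move: (hb _ Px) hm; clear; lia.
have [h|h] := classic (exists y, P y /\ f x < f y).
  by case: h => y [Py lt]; apply: (IH y) => //; move: (hb _ Py) lt hm; clear; lia.
exists x; split=> // y Py; rewrite leqNgt; apply/negP => lt; apply: h.
by exists y.
Qed.

Lemma dense_long_rainbow (V : finType) (H : {set {set V}}) (k : nat) :
  (forall e, e \in H -> 0 < #|e| <= 3) -> linear_hg H -> 4 <= k ->
  (k - 1) * #|V| < \sum_x deg H setT x ->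
  (forall Y : {set V}, Y != setT -> \sum_(x in Y) deg H Y x <= (k - 1) * #|Y|) ->
  exists p, rainbow H p /\ k < size p.
Proof.
move=> card13 lin k4 dense sparse; apply: NNPP => hn.
have hk p : rainbow H p -> size p <= k.
  by move=> rp; rewrite leqNgt; apply/negP => lt; apply: hn; exists p.
have [x0 _] := ex_vertex k4 dense.
have [p [rp pmax]] : exists p, rainbow H p /\ forall q, rainbow H q -> size q <= size p.
  by apply: (exists_max (b := k)) => //; exists [:: x0].
have p0 : 0 < size p by apply: (leq_trans _ (pmax [:: x0] _)).
have [c sc] : exists c, size p = c.+1 by exists (size p).-1; rewrite prednK.
have ck : c.+1 <= k by rewrite -sc hk.
have cmax q : rainbow H q -> size q <= c.+1 by rewrite -sc; apply: pmax.
(* If one colour were the maximum, all neighbours of both ends of an edge would lie on that edge, so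
   their degrees would be at most 2, against [deg2]. *)
have c2 : 2 <= c.
  rewrite leqNgt; apply/negP => c1.
  have [c0|c0] := posnP c.
    have : 0 < deg H setT x0 by have := deg1 k4 dense sparse x0; move: k4; clear; lia.
    case/card_gt0P => y; rewrite inE => /andP[_ g].
    have r2 : rainbow H [:: x0; y].
      apply: rainbow_intro; rewrite ?cons_uniq ?inE ?(adj_neq g) //.
      by move=> f; rewrite /= inE => /eqP->; apply: adj_col.
    by have := cmax _ r2; rewrite c0.
  have {c0} {}c1 : c = 1 by move: c0 c1; clear; lia.
  have d2 a b : rainbow H [:: a; b] -> deg H setT a <= 2.
    move=> r; have eH : col H a b \in H by apply: (rainbow_colH r); rewrite mem_head.
    have [m1 m2] := col_mem card13 eH.
    have sub : nb H setT a \subset col H a b :\ a.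
      apply/subsetP => x; rewrite inE in_setT in_setD1 /= => g.
      rewrite eq_sym (adj_neq g) /=; apply/negPn/negP => xn.
      have [n1 n2] := col_mem card13 (adj_col g).
      have r3 : rainbow H [:: x; a; b].
        apply: rainbow_intro.
        - rewrite cons_uniq (rainbow_uniq r) !inE negb_or eq_sym (adj_neq g) /= andbT.
          by apply: contraNneq xn => ->.
        - move=> f; rewrite /= !inE => /orP[]/eqP-> //; rewrite colC; exact: adj_col.
        - by rewrite /= inE andbT; apply: contraNneq xn => <-; rewrite colC.
      by have := cmax _ r3; rewrite c1.
    apply: leq_trans (subset_leq_card sub) _.
    by have := cardsD1 a (col H a b); rewrite m1; have := card13 _ eH; clear; lia.
  case: p rp pmax p0 sc => [|a [|b [|? ?]]] //= rp _ _ sc; rewrite ?c1 // in sc.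
  have rr : rainbow H [:: b; a] by rewrite -(rainbow_rev H [:: a; b]) in rp.
  have g : adj H a b.
    rewrite /adj (rainbow_colH rp (mem_head _ _)) andbT.
    by move: (rainbow_uniq rp); rewrite /= inE andbT.
  by have := deg2 k4 dense sparse g; have := d2 _ _ rp; have := d2 _ _ rr; move: k4; clear; lia.
have [q [[rq sq] qmax]] : exists q, (rainbow H q /\ size q = c.+1) /\
    forall r, rainbow H r /\ size r = c.+1 -> #|U H r| <= #|U H q|.
  apply: (@exists_max _ _ (fun q => #|U H q|) #|V|); first by exists p.
  by move=> x _; apply: max_card.
have Umax r : rainbow H r -> size r = c.+1 -> #|U H r| <= #|U H q|.
  by move=> rr sr; apply: qmax.
have [r [gr rmax]] : exists r, good H c #|U H q| r /\
    forall s, good H c #|U H q| s -> outer H s <= outer H r.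
  apply: (@exists_max _ _ (outer H) c); first by exists q.
  move=> s [_ ss _]; apply: leq_trans (count_size _ _) _.
  by rewrite size_cols ss.
exact: (no_best card13 lin k4 dense sparse ck cmax Umax c2 rmax (conj gr erefl)).
Qed.

(** * Reduction to a minimal dense vertex set *)

Section Trace.
Variables (T : finType) (H : {set {set T}}) (W : {set T}).
Hypothesis H3 : uniform3 H.
Hypothesis lin : linear_hg H.
Notation V := {x : T | x \in W}.

Definition trace (e : {set T}) : {set V} := [set x | val x \in e].
(** Empty traces are removed to keep [card13]. Singletons remain but create no adjacency, and by
    linearity only edges with a singleton trace can be merged. *)
Definition traces : {set {set V}} := [set f | (f != set0) && (f \in [set trace e | e in H])].

Lemma tracesP f : f \in traces -> exists2 e, e \in H & f = trace e.
Proof. by rewrite inE => /andP[_ /imsetP]. Qed.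

Lemma mem_traces e (x : V) : e \in H -> val x \in e -> trace e \in traces.
Proof.
move=> eH xe; rewrite inE imset_f // andbT; apply/set0Pn; exists x.
by rewrite inE.
Qed.

Lemma card_uniform e : e \in H -> 0 < #|e| <= 3.
Proof. by move/H3->. Qed.

Lemma traces_card f : f \in traces -> 0 < #|f| <= 3.
Proof.
move=> fT; have [e eH E] := tracesP fT; apply/andP; split.
  by rewrite card_gt0; move: fT; rewrite inE => /andP[].
rewrite -(H3 eH) -(card_imset _ val_inj); apply: subset_leq_card; apply/subsetP => x.
by case/imsetP => z; rewrite E inE => ze ->.
Qed.

Lemma traces_lin : linear_hg traces.
Proof.
move=> f f' /tracesP[e eH ->] /tracesP[e' eH' ->] ne.
have ne' : e != e' by apply: contraNneq ne => ->.
apply: leq_trans (lin eH eH' ne'); rewrite -(card_imset _ val_inj).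
apply: subset_leq_card; apply/subsetP => x /imsetP[z]; rewrite !inE => h ->.
exact: h.
Qed.

Lemma traces_adj (x y : V) : adj traces x y = adj H (val x) (val y).
Proof.
apply/idP/idP => g.
  have [m1 m2] := col_mem traces_card (adj_col g).
  have [e eH E] := tracesP (adj_col g); rewrite E !inE in m1 m2.
  by apply: (adj_edge lin eH) => //; rewrite (inj_eq val_inj) (adj_neq g).
have [m1 m2] := col_mem card_uniform (adj_col g).
apply: (adj_edge traces_lin (mem_traces (adj_col g) m1)); rewrite ?inE //.
by have := adj_neq g; rewrite (inj_eq val_inj).
Qed.

Lemma traces_deg (X : {set V}) x : deg traces X x = deg H (val @: X) (val x).
Proof.
rewrite /deg -(card_imset _ val_inj); congr #|pred_of_set _|; apply/setP => z.
apply/imsetP/idP => [[y]|].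
  by rewrite !inE => /andP[yX g] ->; rewrite imset_f // -traces_adj.
rewrite inE => /andP[/imsetP[y yX ->] g]; exists y => //.
by rewrite inE yX traces_adj.
Qed.

Lemma traces_sum (X : {set V}) :
  \sum_(x in X) deg traces X x = \sum_(z in val @: X) deg H (val @: X) z.
Proof.
rewrite big_imset /=; last by move=> a b _ _; apply: val_inj.
by apply: eq_bigr => x _; apply: traces_deg.
Qed.

Lemma val_setT : val @: [set: V] = W.
Proof.
apply/setP => z; apply/imsetP/idP => [[x _ ->]|zW]; first exact: valP.
by exists (exist _ z zW).
Qed.

(** Distinct traces come from distinct edges, so any choice of preimages gives distinct hyperedges;
    the default [set0] in [pre] is never reached. *)
Lemma rainbow_berge k (p : seq V) : rainbow traces p -> k < size p -> has_berge_path H k.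
Proof.
move=> rp sp.
have [x0 px] : exists x0 : V, x0 \in p by case: p sp {rp} => // x s _; exists x; rewrite mem_head.
pose v (i : 'I_k.+1) := val (nth x0 p i).
pose pre (f : {set V}) := odflt set0 [pick e in H | f == trace e].
have preP f : f \in traces -> pre f \in H /\ f = trace (pre f).
  move/tracesP => [e eH E]; rewrite /pre; case: pickP => [e' /andP[eH' /eqP]|/(_ e)] //=.
  by rewrite eH E eqxx.
pose h (i : 'I_k) := pre (nth set0 (cols traces p) i).
have sc : k <= size (cols traces p) by rewrite size_cols -ltnS prednK // (leq_trans _ sp).
have ti (i : 'I_k) : nth set0 (cols traces p) i \in traces.
  by apply: (rainbow_colH rp); rewrite mem_nth // (leq_trans (ltn_ord i)).
have ni (i : 'I_k) : nth set0 (cols traces p) i = col traces (nth x0 p i) (nth x0 p i.+1).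
  case: (p) sp => // a s sp; rewrite /cols (nth_pairmap x0) //.
  by rewrite (leq_trans (ltn_ord i)).
exists v, h; split; last split.
- move=> i j /val_inj/eqP; rewrite nth_uniq ?(rainbow_uniq rp) //.
  + by move/eqP/val_inj.
  + by rewrite (leq_trans (ltn_ord i)).
  + by rewrite (leq_trans (ltn_ord j)).
- move=> i j E; apply/val_inj/eqP => /=.
  rewrite -(nth_uniq set0 _ _ (rainbow_cuniq rp)) ?(leq_trans (ltn_ord _)) //.
  have [_ e1] := preP _ (ti i); have [_ e2] := preP _ (ti j).
  by rewrite e1 e2 -/(h i) -/(h j) E.
- move=> i; have [hH E] := preP _ (ti i); rewrite -/(h i) in hH E; split=> //.
  have cH : col traces (nth x0 p i) (nth x0 p i.+1) \in traces by rewrite -ni.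
  have [m1 m2] := col_mem traces_card cH.
  by rewrite -ni E !inE in m1 m2; split; rewrite /v ?lift0.
Qed.
End Trace.

(** An edge gives six ordered pairs, and by linearity no pair lies on two edges. *)
Lemma sum_deg_edges (T : finType) (H : {set {set T}}) : uniform3 H -> linear_hg H ->
  6 * #|H| <= \sum_(x in setT) deg H setT x.
Proof.
move=> H3 lin.
have h1 : \sum_(x in setT) \sum_(y in setT) \sum_(e in H)
    ((x != y) && (x \in e) && (y \in e)) <= \sum_(x in setT) deg H setT x.
  apply: leq_sum => x _; rewrite deg_sum; apply: leq_sum => y _.
  have [/existsP[e /and4P[eH xy xe ye]]|hn] :=
    boolP [exists e, [&& e \in H, x != y, x \in e & y \in e]].
    rewrite (adj_edge lin eH) // (bigD1 e) //= xy xe ye big1 // => f /andP[fH fe].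
    case: (boolP (x \in f)) => //= xf; case: (boolP (y \in f)) => //= yf.
    by rewrite (edges_share1 lin fH eH xy) ?eqxx // in fe.
  rewrite big1 // => e eH; apply/eqP; rewrite eqb0; apply: contra hn => /andP[/andP[xy xe] ye].
  by apply/existsP; exists e; rewrite eH xy xe ye.
apply: leq_trans h1.
under [leqRHS]eq_bigr do rewrite exchange_big /=; rewrite exchange_big /=.
rewrite mulnC -sum_nat_const; apply: leq_sum => e eH.
have -> : \sum_(x in setT) \sum_(y in setT) ((x != y) && (x \in e) && (y \in e)) =
    \sum_(x in e) (#|e| - 1).
  rewrite [RHS]big_mkcond [LHS]big_mkcond; apply: eq_bigr => x _; rewrite in_setT.
  have [xe|xe] := boolP (x \in e); last by apply: big1 => y _; rewrite andbF.
  rewrite -[RHS](_ : #|e :\ x| = _); last by have := cardsD1 x e; rewrite xe; clear; lia.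
  rewrite -sum1_card [RHS]big_mkcond [LHS]big_mkcond; apply: eq_bigr => y _.
  by rewrite in_setT in_setD1 [y == x]eq_sym; case: (x == y); case: (y \in e).
by rewrite sum_nat_const (H3 _ eH).
Qed.

Theorem theorem2 (k : nat) (T : finType) (H : {set {set T}}) :
  4 <= k -> uniform3 H -> linear_hg H -> ~ has_berge_path H k ->
  6 * #|H| <= (k - 1) * #|T|.
Proof.
move=> k4 H3 lin nb; rewrite leqNgt; apply/negP => lt.
pose P (W : {set T}) := (k - 1) * #|W| < \sum_(x in W) deg H W x.
have PT : P setT by rewrite /P cardsT; apply: leq_trans lt (sum_deg_edges H3 lin).
have [W PW minW] := arg_minnP (fun W : {set T} => #|W|) PT.
apply: nb; have [|||||p [rp sp]] := @dense_long_rainbow {x : T | x \in W} (traces H W) k.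
- exact: traces_card.
- exact: traces_lin.
- by [].
- have := traces_sum H3 lin [set: {x : T | x \in W}]; rewrite val_setT.
  rewrite (eq_bigl xpredT) => [->|x]; last by rewrite inE.
  by rewrite card_sig.
- move=> Y YT; rewrite traces_sum // -(card_imset _ val_inj) leqNgt; apply/negP => PY.
  have := minW _ PY; rewrite leqNgt => /negP; apply; rewrite card_imset; last exact: val_inj.
  rewrite -[X in _ < X](_ : #|[set: {x : T | x \in W}]| = _); last by rewrite cardsT card_sig.
  by apply: proper_card; rewrite properT.
exact: (rainbow_berge H3 rp sp).
Qed.
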